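(* Let $m,\nu,\mu,\lambda\in\mathbb{R}$, $k\in\mathbb{Z}\setminus\{0\}$, and let $h$, $h^*$ be the radial Dirac operators defined in the context. Set $\delta:=(k+\lambda)^2+\mu^2-\nu^2$, assume $0\le\delta<\tfrac14$, and set $\gamma:=\sqrt{\delta}$. The following hold: (i) If $0<\gamma<\tfrac12$, there is a one (real) parameter family $(t(\theta))_{\theta\in[0,\pi)}$ of self-adjoint extensions $h\subset t(\theta)=t(\theta)^*\subset h^*$. Moreover, $(f^+,f^-)\in\mathcal{D}(t(\theta))$ if and only if $(f^+,f^-)\in\mathcal{D}(h^* )$ and there exists $(A^+,A^-)\in\mathbb{C}^2$ such that $$A^+\sin\theta+A^-\cos\theta=0,\qquad \lim_{r\to0}\left|\begin{pmatrix} f^+(r)\\ f^-(r)\end{pmatrix}-D\begin{pmatrix} A^+r^{\gamma}\\ A^-r^{-\gamma}\end{pmatrix}\right|r^{-1/2}=0,$$ where $D\in\mathbb{R}^{2\times2}$ is invertible and $$D:=\begin{cases}\dfrac{1}{2\gamma(\lambda+k-\gamma)}\begin{pmatrix}\lambda+k-\gamma & \nu-\mu\\ -(\nu+\mu) & -(\lambda+k-\gamma)\end{pmatrix} & \text{if }\lambda+k-\gamma\ne0,\\[3mm] \dfrac{1}{-4\gamma^2}\begin{pmatrix}\mu-\nu & 2\gamma\\ 2\gamma & -(\nu+\mu)\end{pmatrix} & \text{if }\lambda+k-\gamma=0.\end{cases}$$ Conversely, any self-adjoint extension $t$ of $h$ verifies $t=t(\theta)$ for some $\theta\in[0,\pi)$.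 (ii) If $\gamma=0$, there is a one (real) parameter family $(t(\theta))_{\theta\in[0,\pi)}$ of self-adjoint extensions $h\subset t(\theta)=t(\theta)^*\subset h^*$. Moreover, $(f^+,f^-)\in\mathcal{D}(t(\theta))$ if and only if $(f^+,f^-)\in\mathcal{D}(h^* )$ and there exists $(A^+,A^-)\in\mathbb{C}^2$ such that $$A^+\sin\theta+A^-\cos\theta=0,\qquad \lim_{r\to0}\left|\begin{pmatrix} f^+(r)\\ f^-(r)\end{pmatrix}-(M\log r+\mathbb{I}_2)\begin{pmatrix} A^+\\ A^-\end{pmatrix}\right|r^{-1/2}=0,$$ where $M\in\mathbb{R}^{2\times2}$, $M^2=0$, is $$M:=\begin{pmatrix}-(k+\lambda) & -\nu+\mu\\ \nu+\mu & k+\lambda\end{pmatrix}.$$ Conversely, any self-adjoint extension $t$ of $h$ verifies $t=t(\theta)$ for some $\theta\in[0,\pi)$.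
   Context: All operators act in the Hilbert space $L^2(0,+\infty)^2=L^2((0,+\infty);\mathbb{C}^2)$ (Lebesgue measure $dr$); $\mathcal{D}(\cdot)$ denotes the domain, $S\subset T$ for operators means that $T$ extends $S$, and $\mathbb{I}_2$ is the $2\times2$ identity matrix. The integer $k$ is the index $k=k_j=\pm(j+1/2)$, $j\in\{1/2,3/2,\dots\}$, of a partial wave subspace; the operators below (written $h_{m_j,k_j}$ etc. in the paper) depend only on $k$ and on $m,\nu,\mu,\lambda$. Minimal operator: $\mathcal{D}(h)=C_c^\infty(0,+\infty)^2$ (with values in $\mathbb{C}^2$), and $$h\begin{pmatrix} f^+\\ f^-\end{pmatrix}=\begin{pmatrix} m+\frac{\nu+\mu}{r} & -\partial_r+\frac{k+\lambda}{r}\\ \partial_r+\frac{k+\lambda}{r} & -m+\frac{\nu-\mu}{r}\end{pmatrix}\begin{pmatrix} f^+\\ f^-\end{pmatrix}.$$ Maximal operator: $h^*$ is given by the same matrix differential expression, understood in the sense of distributions on $(0,+\infty)$, with domain $\mathcal{D}(h^* )=\{(f^+,f^-)\in L^2(0,+\infty)^2 : h^*(f^+,f^-)\in L^2(0,+\infty)^2\}$; it is the adjoint of $h$. Each $t(\theta)$ acts as the restriction of $h^*$ to $\mathcal{D}(t(\theta))$. Elements of $\mathcal{D}(h^* )$ are identified with their continuous representatives on $(0,+\infty)$ in pointwise statements. *)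

(* Defs.v *)
From HB Require Import structures.
From mathcomp Require Import all_boot all_order all_algebra.
From mathcomp Require Import all_classical all_reals all_analysis.
From mathcomp.real_closed Require Export complex.

Set Implicit Arguments.
Unset Strict Implicit.
Unset Printing Implicit Defensive.

Import Order.TTheory GRing.Theory Num.Theory.
Import numFieldNormedType.Exports.

Local Open Scope classical_set_scope.
Local Open Scope ring_scope.
Local Open Scope complex_scope.

Definition cv2 (T : Type) (a b : T) : 'cV[T]_2 :=
  \col_(i < 2) (if i == 0 then a else b).

Definition mx2 (T : Type) (a b c d : T) : 'M[T]_2 :=
  \matrix_(i < 2, j < 2)
    (if i == 0 then (if j == 0 then a else b) else (if j == 0 then c else d)).

Definition toC (R : realType) (M : 'M[R]_2) : 'M[R[i]]_2 :=
  map_mx (fun x : R => x%:C) M.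

Definition norm2 (R : realType) (v : 'cV[R[i]]_2) : R :=
  Num.sqrt (\sum_(i < 2) (complex.Re (v i 0) ^+ 2 + complex.Im (v i 0) ^+ 2)).

(* An element of L^2((0,+oo); C^2) is represented by a Borel function on R;
   its values outside (0,+oo) are irrelevant and two functions represent the
   same element when they agree almost everywhere on (0,+oo) ([aeq]). *)
Definition wave (R : realType) := R -> 'cV[R[i]]_2.

Definition halfline (R : realType) : set R := `]0, +oo[%classic.
Arguments halfline : clear implicits.

Definition aeq (R : realType) (f g : wave R) : Prop :=
  ae_eq (@lebesgue_measure R) (halfline R) f g.

Definition L2 (R : realType) (f : wave R) : Prop :=
  (forall i : 'I_2,
     measurable_fun (halfline R) (fun r => complex.Re (f r i 0)) /\
     measurable_fun (halfline R) (fun r => complex.Im (f r i 0))) /\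
  (\int[lebesgue_measure]_(r in halfline R) (norm2 (f r) ^+ 2)%:E < +oo)%E.

Definition integralC (R : realType) (u : R -> R[i]) : R[i] :=
  (\int[lebesgue_measure]_(r in halfline R) complex.Re (u r))%R
  +i* (\int[lebesgue_measure]_(r in halfline R) complex.Im (u r))%R.

Definition inner (R : realType) (f g : wave R) : R[i] :=
  integralC (fun r => \sum_(i < 2) (f r i 0)^* * g r i 0).

Definition L2norm (R : realType) (f : wave R) : R :=
  Num.sqrt (complex.Re (inner f f)).

(* Operators in L^2((0,+oo); C^2) are identified with their graphs, saturated
   for almost everywhere equality.  Hence inclusion of graphs is extension of
   operators and equality of graphs is equality of operators. *)
Definition graph (R : realType) := set (wave R * wave R).

Definition domain (R : realType) (T : graph R) : set (wave R) :=
  [set f | exists g, T (f, g)].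

Record linear_operator (R : realType) (T : graph R) : Prop := LinearOperator {
  operator_L2 : forall f g, T (f, g) -> L2 f /\ L2 g;
  operator_aeq : forall f g f' g', T (f, g) -> L2 f' -> L2 g' ->
    aeq f f' -> aeq g g' -> T (f', g');
  operator_fun : forall f g g', T (f, g) -> T (f, g') -> aeq g g';
  operator0 : T (fun=> 0, fun=> 0);
  operator_lin : forall (a : R[i]) f g f' g', T (f, g) -> T (f', g') ->
    T (fun r => a *: f r + f' r, fun r => a *: g r + g' r)
}.

Definition densely_defined (R : realType) (T : graph R) : Prop :=
  forall u, L2 u -> forall e : R, 0 < e ->
    exists2 f, domain T f & L2norm (fun r => u r - f r) < e.

Definition adjoint (R : realType) (T : graph R) : graph R :=
  [set uv | L2 uv.1 /\ L2 uv.2 /\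
    forall f g, T (f, g) -> inner g uv.1 = inner f uv.2].

Definition self_adjoint (R : realType) (T : graph R) : Prop :=
  linear_operator T /\ densely_defined T /\ T = adjoint T.

(* C_c^oo((0,+oo)) with real, then complex, values: smooth functions on R whose
   support is contained in some [a, b] with 0 < a. *)
Definition smooth (R : realType) (u : R -> R) : Prop :=
  forall (n : nat) (x : R), derivable (derive1n n u) x 1.

Definition test_function (R : realType) (phi : R -> R[i]) : Prop :=
  smooth (fun r => complex.Re (phi r)) /\
  smooth (fun r => complex.Im (phi r)) /\
  exists a b : R, 0 < a /\ forall r, ~~ (a <= r <= b) -> phi r = 0.

Definition derivC (R : realType) (phi : R -> R[i]) (r : R) : R[i] :=
  derive1 (fun x => complex.Re (phi x)) r
  +i* derive1 (fun x => complex.Im (phi x)) r.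

Definition dirac_expr (R : realType) (m nu mu lam : R) (k : int)
    (f : wave R) : wave R :=
  let kap := k%:~R + lam in
  fun r => cv2
    ((m + (nu + mu) / r)%:C * f r 0 0
       + (- derivC (fun x => f x 1 0) r + (kap / r)%:C * f r 1 0))
    ((derivC (fun x => f x 0 0) r + (kap / r)%:C * f r 0 0)
       + (- m + (nu - mu) / r)%:C * f r 1 0).

(* The minimal operator h. *)
Definition dirac_min (R : realType) (m nu mu lam : R) (k : int) : graph R :=
  [set fg | L2 fg.1 /\ L2 fg.2 /\
    exists phi : wave R, (forall i : 'I_2, test_function (fun r => phi r i 0)) /\
      aeq fg.1 phi /\ aeq fg.2 (dirac_expr m nu mu lam k phi)].

(* The maximal operator h^*: both sides are distributions on (0,+oo) evaluated
   at phi, with the bilinear pairing, so that the distribution f' sends phi to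
   minus the integral of f times phi'. *)
Definition dirac_max (R : realType) (m nu mu lam : R) (k : int) : graph R :=
  let kap := k%:~R + lam in
  [set fg | L2 fg.1 /\ L2 fg.2 /\
    forall phi : R -> R[i], test_function phi ->
      integralC (fun r => fg.2 r 0 0 * phi r) =
        integralC (fun r => (m + (nu + mu) / r)%:C * fg.1 r 0 0 * phi r
          + (fg.1 r 1 0 * derivC phi r + (kap / r)%:C * fg.1 r 1 0 * phi r)) /\
      integralC (fun r => fg.2 r 1 0 * phi r) =
        integralC (fun r =>
          (- (fg.1 r 0 0 * derivC phi r) + (kap / r)%:C * fg.1 r 0 0 * phi r)
          + (- m + (nu - mu) / r)%:C * fg.1 r 1 0 * phi r)].

Definition continuous_representative (R : realType) (f fc : wave R) : Prop :=
  aeq f fc /\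
  forall (i : 'I_2) (r : R), 0 < r ->
    {for r, continuous (fun x => complex.Re (fc x i 0))} /\
    {for r, continuous (fun x => complex.Im (fc x i 0))}.

Definition Dmx (R : realType) (nu mu lam : R) (k : int) (gam : R) : 'M[R]_2 :=
  let c := lam + k%:~R - gam in
  if c != 0 then
    (2 * gam * c)^-1 *: mx2 c         (nu - mu)
                            (- (nu + mu)) (- c)
  else
    (- 4 * gam ^+ 2)^-1 *: mx2 (mu - nu)  (2 * gam)
                               (2 * gam)  (- (nu + mu)).

Definition Mmx (R : realType) (nu mu lam : R) (k : int) : 'M[R]_2 :=
  mx2 (- (k%:~R + lam)) (- nu + mu)
      (nu + mu)         (k%:~R + lam).

(* Main.v *)
Require Import Defs.
From HB Require Import structures.
From mathcomp Require Import all_boot all_order all_algebra.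
From mathcomp Require Import all_classical all_reals all_analysis.
From mathcomp Require Import ring lra measurable_realfun.

Import Order.TTheory GRing.Theory Num.Theory.
Import numFieldNormedType.Exports.

Local Open Scope classical_set_scope.
Local Open Scope ring_scope.
Local Open Scope complex_scope.

Set Implicit Arguments.
Unset Strict Implicit.
Unset Printing Implicit Defensive.

(** Write [kap = k + lam], [p = nu + mu], [q = nu - mu], and let [M] be the matrix
    [Mmx], with rows [(-kap, -q)] and [(p, kap)]; then [M^2 = delta I].

    The distributional equation that defines the maximal operator says that a
    wave in its domain is, up to almost everywhere equality, a locally
    absolutely continuous solution of the first-order system
    [u' = (M / r) u + F], where the source [F] is square-integrable
    ([weak_derivative_primitive], [dirac_max_solves]). The homogeneous system is
    solved by [r^M = a(r) I + b(r) M]. Here [a] and [b] are the half sum of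
    [r^gam] and [r^(-gam)] and their half difference divided by [gam] if
    [gam > 0], and [1] and [ln r] if [gam = 0]; [propagator] collects the
    properties shared by both cases.

    As [gam < 1/2], the matrix [r^M] is square-integrable near the origin.
    Variation of constants then shows that [r^(-M) u(r)] has a limit, the boundary
    datum of [u] ([boundary_data_exists]), and that [u(r)] differs from [r^M]
    applied to that datum by the integral of [(r / t)^M F(t)] over [0 < t < r],
    which is [o(r^(1/2))] ([boundary_data_asymptotic]). Conversely such an
    expansion determines the datum ([asymptotic_boundary_data]). The limits in
    the theorem are these expansions: if [gam > 0], [D] diagonalises [M], hence
    [r^M D = D diag (r^gam, r^(-gam))] ([Dmx_flow]); if [gam = 0], [r^M] is
    [M ln r + I] itself.

    Green's formula expresses [<h^* f, u> - <f, h^* u>] as minus the determinant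
    formed by the conjugate of the datum of [f] and the datum of [u], without a
    contribution from infinity ([green_wave]). All real data are attained
    ([boundary_data_surjective]), elements of the minimal operator have datum
    zero, and the adjoint of the minimal operator is contained in the maximal one
    ([adjoint_dirac_min]). The self-adjoint extensions thus correspond to the
    lines of [C^2] that are isotropic for this form, and these are the complex
    lines spanned by a real vector ([isotropic_real],
    [boundary_restriction_self_adjoint], [self_adjoint_above_min]). Their domains
    are dense because test functions are ([square_intg_approximable]). Finally
    the real lines are those spanned by [D (cos theta, - sin theta)] for
    [0 <= theta < pi], with [D = I] if [gam = 0], which gives the parametrisation of the theorem
    ([self_adjoint_extensions]). *)

(** * Smooth functions on the line *)

Section smooth_functions.
Context {R : realType}.
Implicit Types (u v : R -> R).

(** Peels off the first derivative, where [smooth] iterates from the last one: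
    the rules of calculus then apply directly in an induction on [n]. *)
Fixpoint differentiable_upto (n : nat) u : Prop :=
  if n is n'.+1 then
    (forall x, derivable u x 1) /\ differentiable_upto n' (derive1 u)
  else True.

Lemma differentiable_uptoP n u :
  (forall k x, (k < n)%N -> derivable (derive1n k u) x 1) <->
  differentiable_upto n u.
Proof.
elim: n u => [|n IH] u /=; first by split.
split=> [H|[H0 /IH H] [|k] x kn].
- split; first by move=> x; exact: (H 0%N x).
  by apply/IH => k x kn; have := H k.+1 x kn; rewrite derive1Sn.
- exact: H0.
- by rewrite derive1Sn; exact: H.
Qed.

Lemma smoothP u : smooth u <-> forall n, differentiable_upto n u.
Proof.
split=> [H n|H n x]; first by apply/differentiable_uptoP => k x _; exact: H.
by move/differentiable_uptoP : (H n.+1); apply.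
Qed.

Lemma differentiable_upto1 n u : differentiable_upto n.+1 u ->
  differentiable_upto n u.
Proof.
by move/differentiable_uptoP => H; apply/differentiable_uptoP => k x kn;
  apply: H; rewrite (ltn_trans kn).
Qed.

Lemma differentiable_uptoD n u v : differentiable_upto n u ->
  differentiable_upto n v -> differentiable_upto n (u \+ v).
Proof.
elim: n u v => //= n IH u v [du Hu] [dv Hv]; split.
  by move=> x; apply: derivableD.
rewrite (_ : derive1 _ = derive1 u \+ derive1 v); first exact: IH.
by apply/funext => x; rewrite /= !derive1E deriveD.
Qed.

Lemma differentiable_uptoZ n (c : R) u : differentiable_upto n u ->
  differentiable_upto n (fun x => c * u x).
Proof.
elim: n u => //= n IH u [du Hu]; split.
  by move=> x; apply: derivableZ.
rewrite (_ : derive1 _ = (fun x => c * derive1 u x)); first exact: IH.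
by apply/funext => x; rewrite /= !derive1E deriveZ.
Qed.

(** The Leibniz rule keeps one factor underived, so the induction hypothesis is
    applied to factors whose order has to be lowered. *)
Lemma differentiable_uptoM n u v : differentiable_upto n u ->
  differentiable_upto n v -> differentiable_upto n (u \* v).
Proof.
elim: n u v => // n IH u v Hu Hv.
have Hu1 := differentiable_upto1 Hu; have Hv1 := differentiable_upto1 Hv.
move: Hu Hv => /= [du Hu] [dv Hv]; split.
  by move=> x; apply: derivableM.
rewrite (_ : derive1 _ = (u \* derive1 v) \+ (v \* derive1 u)).
  by apply: differentiable_uptoD; exact: IH.
by apply/funext => x; rewrite /= !derive1E deriveM.
Qed.

Lemma is_derive_affine (a b x : R) : is_derive x 1 (fun y => a * y + b) a.
Proof.
have -> : (fun y : R => a * y + b) = (a *: id) + cst b by apply/funext => y.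
by apply: is_derive_eq; rewrite addr0 scaler1.
Qed.

Lemma is_derive_comp_affine u (a b x : R) : derivable u (a * x + b) 1 ->
  is_derive x 1 (fun y => u (a * y + b)) (a * derive1 u (a * x + b)).
Proof.
move=> du; rewrite mulrC; apply: (@is_derive1_comp _ u (fun y => a * y + b)).
  by rewrite derive1E; exact: derivableP.
exact: is_derive_affine.
Qed.

Lemma differentiable_upto_comp_affine n u (a b : R) : differentiable_upto n u ->
  differentiable_upto n (fun x => u (a * x + b)).
Proof.
elim: n u => //= n IH u [du Hu]; split.
  by move=> x; have [] := is_derive_comp_affine (du (a * x + b)).
rewrite (_ : derive1 _ = (fun x => a * derive1 u (a * x + b))).
  exact/differentiable_uptoZ/IH.
apply/funext => x; rewrite derive1E.
by have [] := is_derive_comp_affine (du (a * x + b)).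
Qed.

Lemma smoothD u v : smooth u -> smooth v -> smooth (u \+ v).
Proof.
by move=> /smoothP Hu /smoothP Hv; apply/smoothP => n; exact: differentiable_uptoD.
Qed.

Lemma smoothZ (c : R) u : smooth u -> smooth (fun x => c * u x).
Proof. by move=> /smoothP Hu; apply/smoothP => n; exact: differentiable_uptoZ. Qed.

Lemma smoothM u v : smooth u -> smooth v -> smooth (u \* v).
Proof.
by move=> /smoothP Hu /smoothP Hv; apply/smoothP => n; exact: differentiable_uptoM.
Qed.

Lemma smooth_comp_affine u (a b : R) : smooth u -> smooth (fun x => u (a * x + b)).
Proof.
by move=> /smoothP Hu; apply/smoothP => n; exact: differentiable_upto_comp_affine.
Qed.

Lemma smooth_derivable u x : smooth u -> derivable u x 1.
Proof. by move=> /(_ 0%N x). Qed.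

Lemma smooth_derive1 u : smooth u -> smooth (derive1 u).
Proof. by move=> H n x; have := H n.+1 x; rewrite derive1Sn. Qed.

Lemma smooth_primitive u v : (forall x : R, is_derive x 1 u (v x)) -> smooth v ->
  smooth u.
Proof.
move=> H sv [|n] x; first by have [] := H x.
rewrite derive1Sn (_ : derive1 u = v)//; apply/funext => y.
by rewrite derive1E; have [] := H y.
Qed.

Lemma smooth_continuous u : smooth u -> continuous u.
Proof.
move=> su x; apply/differentiable_continuous/derivable1_diffP.
exact: smooth_derivable.
Qed.

Lemma smooth0 : smooth (fun=> 0 : R).
Proof.
apply/smoothP; elim=> //= n IH; split; first by move=> x; exact: derivable_cst.
by rewrite (_ : derive1 _ = (fun=> 0))//; apply/funext => x; rewrite derive1_cst.
Qed.

End smooth_functions.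

(** * A smooth function flat at the origin *)

Section flat_function.
Context {R : realType}.

(** All the functions [x^-k exp (-1/x)], extended by zero, are treated together
    because the derivative of one is a combination of two others. *)
Definition flat (k : nat) (x : R) : R :=
  if 0 < x then x^-1 ^+ k * expR (- x^-1) else 0.

Lemma flat_le0 k x : x <= 0 -> flat k x = 0.
Proof. by rewrite /flat ltNge => ->. Qed.

Lemma flat_ge0 k x : 0 <= flat k x.
Proof.
rewrite /flat; case: ifP => // x0.
by rewrite mulr_ge0 ?expR_ge0// exprn_ge0// invr_ge0 ltW.
Qed.

(** With [t = 1/x], the exponential series gives [t^k <= k! exp t]. *)
Lemma flat_bounded k x : flat k x <= k`!%:R.
Proof.
rewrite /flat; case: ifP => // x0; rewrite expRN ler_pdivrMr ?expR_gt0//.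
have t0 : 0 <= x^-1 by rewrite invr_ge0 ltW.
case: k => [|k]; first by rewrite expr0 mul1r (le_trans _ (expR_ge1Dx _))// lerDl.
rewrite mulrC -ler_pdivrMr ?ltr0n ?fact_gt0//.
by rewrite (le_trans _ (expR_ge1Dxn k t0))// lerDr.
Qed.

(** This makes [flat k.+1] the difference quotient of [flat k] at the origin;
    since [flat k.+1] is bounded, [flat k] is continuous there. *)
Lemma flatS k x : flat k x = x * flat k.+1 x.
Proof.
rewrite /flat; case: ifP => [x0|]; last by rewrite mulr0.
by rewrite exprS !mulrA divff ?mul1r// gt_eqF.
Qed.

Lemma flat_continuous0 k : {for 0, continuous (flat k)}.
Proof.
rewrite /prop_for /continuous_at flat_le0//; apply/cvgr0Pnorm_le => e e0.
near=> x.
rewrite flatS normrM (ger0_norm (flat_ge0 _ _)).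
apply: (@le_trans _ _ (`|x| * k.+1`!%:R)).
  by rewrite ler_wpM2l// flat_bounded.
rewrite -ler_pdivlMr ?ltr0n ?fact_gt0//.
near: x; apply: (@nbhs0_le R R).
by rewrite divr_gt0// ltr0n fact_gt0.
Unshelve. all: by end_near. Qed.

Lemma is_derive_flat k (x : R) :
  is_derive x 1 (flat k) (flat k.+2 x - k%:R * flat k.+1 x).
Proof.
have [x0|x0|->] := ltgtP x 0.
- rewrite !flat_le0 ?ltW// mulr0 subrr.
  apply: (@near_eq_is_derive _ _ _ (cst 0)).
    near=> y; rewrite flat_le0//; apply/ltW; near: y; exact: lt_nbhsl.
- pose h := fun t : R => t ^+ k * expR (- t).
  apply: (@near_eq_is_derive _ _ _ (h \o (fun y : R => y^-1))).
    near=> y; rewrite /flat ifT//; near: y; exact: (cvgr_gt x cvg_id).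
  have dh (t : R) : is_derive t 1 h (k%:R * t ^+ k.-1 * expR (- t) - t ^+ k * expR (- t)).
    rewrite (_ : h = id ^+ k * (expR \o -%R)); last first.
      by apply/funext => y; rewrite /h /= fctE /=; congr (_ * _); elim: (k) => //= n; rewrite !exprS => ->.
    have dX : is_derive t 1 (@id R ^+ k) (k%:R * t ^+ k.-1).
      by apply: is_derive_eq; rewrite -mulr_algl scaler1 mulr1.
    have dE : is_derive t 1 (expR \o -%R) (expR (- t) * -1).
      exact: is_derive1_comp.
    apply: is_derive_eq; rewrite /=.
    rewrite (_ : (id ^+ k) t = t ^+ k); last by elim: (k) => //= n; rewrite !exprS => <-.
    by rewrite /GRing.scale/=; ring.
  have dV : is_derive x 1 (fun y : R => y^-1) (- x ^- 2).
    have dV := @is_deriveV _ id x 1 1 (lt0r_neq0 x0) (is_derive_id _ _).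
    by move: dV; rewrite -mulr_algl scaler1 mulr1.
  apply: (is_derive_eq (is_derive1_comp (dh x^-1) dV)).
  rewrite /flat x0.
  case: (k) => [|n] /=; rewrite ?exprS; set E := expR _.
    by field; exact: lt0r_neq0.
  by set X := _ ^+ n; field; exact: lt0r_neq0.
- rewrite !flat_le0// mulr0 subrr.
  (* [flat k.+1] is the difference quotient, and it is continuous at the origin. *)
  apply/is_derive1_caratheodory; exists (flat k.+1); split => //.
  + by move=> z; rewrite (flat_le0 _ (lexx 0)) !subr0 mulrC flatS.
  + exact: flat_continuous0.
  + by rewrite flat_le0.
Unshelve. all: by end_near. Qed.

Lemma flat_smooth k : smooth (flat k).
Proof.
apply/smoothP => n; elim: n k => //= n IH k; split.
  by move=> x; have [] := is_derive_flat k x.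
rewrite (_ : derive1 _ = flat k.+2 \+ (fun x => - k%:R * flat k.+1 x)).
  by apply: differentiable_uptoD => //; exact: differentiable_uptoZ.
apply/funext => x; rewrite derive1E.
by have [_ ->] := is_derive_flat k x; rewrite /= mulNr.
Qed.

End flat_function.

(** * Test functions and bumps *)

Section test_functions.
Context {R : realType}.
Implicit Types (u v : R -> R).

(** The real counterpart of [test_function]: the analysis is carried out on real
    and imaginary parts separately. *)
Definition real_test u : Prop :=
  smooth u /\ exists a b : R, 0 < a /\ forall r, ~~ (a <= r <= b) -> u r = 0.

Lemma real_testD u v : real_test u -> real_test v -> real_test (u \+ v).
Proof.
move=> [su [a [b [a0 Hu]]]] [sv [c [d [c0 Hv]]]]; split; first exact: smoothD.
exists (Num.min a c), (Num.max b d); split; first by rewrite lt_min a0.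
move=> r; rewrite ge_min le_max negb_and !negb_or => /orP[]/andP[h1 h2] /=.
  by rewrite Hu ?Hv ?addr0// negb_and ?h1 ?h2.
by rewrite Hu ?Hv ?addr0// negb_and ?h1 ?h2 orbT.
Qed.

Lemma real_testZ c u : real_test u -> real_test (fun x => c * u x).
Proof.
move=> [su [a [b [a0 Hu]]]]; split; first exact: smoothZ.
by exists a, b; split=> // r /Hu ->; rewrite mulr0.
Qed.

Lemma derive1_outside u (a b : R) : (forall r, ~~ (a <= r <= b) -> u r = 0) ->
  forall r, ~~ (a <= r <= b) -> derive1 u r = 0.
Proof.
move=> H r rab; rewrite derive1E.
suff d0 : is_derive r 1 u 0 by have [] := d0.
apply: (@near_eq_is_derive _ _ _ (cst 0)).
move: rab; rewrite negb_and -!ltNge => /orP[ra|br].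
  near=> y; rewrite H// negb_and -ltNge; apply/orP; left.
  by near: y; exact: lt_nbhsl.
near=> y; rewrite H// negb_and -!ltNge; apply/orP; right.
by near: y; exact: (cvgr_gt r cvg_id).
Unshelve. all: by end_near. Qed.

Lemma real_test_derive1 u : real_test u -> real_test (derive1 u).
Proof.
move=> [su [a [b [a0 Hu]]]]; split; first exact: smooth_derive1.
by exists a, b; split=> //; exact: derive1_outside.
Qed.

(** Dilating the argument of [flat 0] makes it tend to the indicator of the
    positive reals while staying below [1]; these products therefore tend to
    the indicator of the interval in the setting of dominated convergence. *)
Definition bump (a b : R) (n : nat) (x : R) : R :=
  flat 0 (n.+1%:R * (x - a)) * flat 0 (n.+1%:R * (b - x)).

Lemma bump_ge0 a b n x : 0 <= bump a b n x.
Proof. by rewrite mulr_ge0 ?flat_ge0. Qed.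

Lemma bump_le1 a b n x : bump a b n x <= 1.
Proof. by rewrite mulr_ile1 ?flat_ge0// (flat_bounded 0). Qed.

Lemma bump_out a b n x : ~~ (a < x < b) -> bump a b n x = 0.
Proof.
rewrite negb_and -!leNgt /bump => /orP[h|h].
  by rewrite flat_le0 ?mul0r// pmulr_rle0// subr_le0.
by rewrite [X in _ * X]flat_le0 ?mulr0// pmulr_rle0// subr_le0.
Qed.

Lemma flat_gt0 k (x : R) : 0 < x -> 0 < flat k x.
Proof.
by move=> x0; rewrite /flat x0 mulr_gt0 ?expR_gt0// exprn_gt0// invr_gt0.
Qed.

Lemma bump_smooth a b n : smooth (bump a b n).
Proof.
have s1 := smooth_comp_affine (a := n.+1%:R) (b := - (n.+1%:R * a)) (@flat_smooth R 0).
have s2 := smooth_comp_affine (a := - n.+1%:R) (b := n.+1%:R * b) (@flat_smooth R 0).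
have := smoothM s1 s2; congr smooth.
by apply/funext => x; rewrite /bump /=; congr (flat 0 _ * flat 0 _); ring.
Qed.

Lemma bump_real_test a b n : 0 < a -> real_test (bump a b n).
Proof.
move=> a0; split; first exact: bump_smooth.
exists a, b; split=> // r rab; apply: bump_out; apply: contra rab.
by move=> /andP[/ltW -> /ltW ->].
Qed.

Lemma flat0_cvg (y : R) :
  flat 0 (n.+1%:R * y) @[n --> \oo] --> ((0 < y)%R%:R : R).
Proof.
have [y0|y0] := ltP 0 y; last first.
  apply: cvg_near_cst; near=> n.
  by rewrite flat_le0// pmulr_rle0.
have h : (fun n : nat => flat 0 (n.+1%:R * y)) =
    (fun n => expR (- (harmonic n * y^-1))).
  apply/funext => n; rewrite /flat pmulr_rgt0// y0 expr0 mul1r.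
  by rewrite invfM /harmonic.
rewrite h -expR0; apply: continuous_cvg; first exact: continuous_expR.
rewrite -oppr0; apply: cvgN; rewrite -(mul0r y^-1).
by apply: cvgMl; exact: cvg_harmonic.
Unshelve. all: by end_near. Qed.

Lemma bump_cvg a b x :
  bump a b n x @[n --> \oo] --> (\1_(`]a, b[%classic) x : R).
Proof.
rewrite indicE mem_setE in_itv/= -(subr_gt0 a) -(subr_gt0 x) -mulnb natrM.
by apply: cvgM; exact: flat0_cvg.
Qed.

End test_functions.

(** * Integrals of real functions *)

Section real_integrals.
Context {R : realType}.
Implicit Types (D : set R) (f g h : R -> R) (a b c x y : R).
Local Notation mu := (@lebesgue_measure R).
Local Notation intg D f := (mu.-integrable D (EFin \o f)).

Lemma intg_measurable D f : intg D f -> measurable_fun D f.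
Proof. by move=> /(measurable_int mu)/measurable_EFinP. Qed.

Lemma intgD D f g : measurable D -> intg D f -> intg D g -> intg D (f \+ g).
Proof. by move=> mD if_ ig; exact: (@integrableD _ _ _ mu D mD (EFin \o f) (EFin \o g)). Qed.

Lemma intgZ D c f : measurable D -> intg D f -> intg D (fun x => c * f x).
Proof. by move=> mD if_; exact: (@integrableZl _ _ _ mu D mD c (EFin \o f)). Qed.

Lemma intgB D f g : measurable D -> intg D f -> intg D g -> intg D (f \- g).
Proof. by move=> mD if_ ig; exact: (@integrableB _ _ _ mu D mD (EFin \o f) (EFin \o g)). Qed.

Lemma intg_le D f g : measurable D -> measurable_fun D f -> intg D g ->
  (forall x, D x -> `|f x| <= g x) -> intg D f.
Proof.
move=> mD mf ig fg; apply: le_integrable ig => //; first exact/measurable_EFinP.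
by move=> x Dx /=; rewrite lee_fin (le_trans (fg x Dx))// ler_norm.
Qed.

Lemma intg_norm D f : measurable D -> intg D f -> intg D (fun x => `|f x|).
Proof. by move=> mD if_; exact: integrable_norm. Qed.

Lemma intgM D f h (C : R) : measurable D -> intg D f -> measurable_fun D h ->
  (forall x, D x -> `|h x| <= C) -> intg D (h \* f).
Proof.
move=> mD if_ mh hC; apply: (@intg_le _ _ (fun x => C * `|f x|)) => //.
- by apply: measurable_funM => //; exact: intg_measurable.
- by apply: intgZ => //; exact: intg_norm.
- by move=> x Dx /=; rewrite normrM ler_wpM2r// hC.
Qed.

Lemma intgS D D' f : measurable D -> measurable D' -> D' `<=` D ->
  intg D f -> intg D' f.
Proof. by move=> mD mD' DD'; exact: integrableS. Qed.

Lemma intg_eq D f g : measurable D -> {in D, f =1 g} -> intg D f -> intg D g.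
Proof. by move=> mD fg; apply: eq_integrable => // x xD /=; rewrite fg. Qed.

Lemma intg_cont a b f : {within `[a, b], continuous f} -> intg `[a, b] f.
Proof. by move=> cf; apply: continuous_compact_integrable => //; exact: segment_compact. Qed.

Lemma Rintegral_ae D f g : measurable D -> measurable_fun D f ->
  measurable_fun D g -> ae_eq mu D f g ->
  \int[mu]_(x in D) f x = \int[mu]_(x in D) g x.
Proof.
move=> mD mf mg fg; congr fine; apply: ae_eq_integral => //;
  [exact/measurable_EFinP..|exact: ae_eq_comp].
Qed.

Lemma intg_ae D f g : measurable D -> measurable_fun D g -> ae_eq mu D f g ->
  intg D f -> intg D g.
Proof.
move=> mD mg fg if_; have mf := intg_measurable if_.
case/integrableP : if_ => _ fy; apply/integrableP; split; first exact/measurable_EFinP.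
rewrite (@ae_eq_integral _ _ _ mu D (abse \o (EFin \o f)))//.
- by apply: measurableT_comp => //; exact/measurable_EFinP.
- by apply: measurableT_comp => //; exact/measurable_EFinP.
- by apply: ae_eq_comp; exact/ae_eq_sym/ae_eq_comp.
Qed.

Lemma Rintegral_chasles a b c f : a <= b -> b <= c -> intg `[a, c] f ->
  \int[mu]_(x in `[a, b]) f x + \int[mu]_(x in `[b, c]) f x =
  \int[mu]_(x in `[a, c]) f x.
Proof.
move=> ab bc ic; have := Rintegral_itvB (x := b) ic.
rewrite !bnd_simp => /(_ ab bc) /esym.
rewrite Rintegral_itv_obnd_cbnd => [->|]; first by rewrite addrC subrK.
by apply: intgS ic => //; apply: subset_itv; rewrite bnd_simp.
Qed.

Lemma Rintegral_dominated D (f_ : nat -> R -> R) f g : measurable D ->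
  (forall n, measurable_fun D (f_ n)) -> measurable_fun D f -> intg D g ->
  (forall x, D x -> f_ n x @[n --> \oo] --> f x) ->
  (forall n x, D x -> `|f_ n x| <= g x) ->
  (\int[mu]_(x in D) f_ n x) @[n --> \oo] --> \int[mu]_(x in D) f x.
Proof.
move=> mD mf_ mf ig cf bf; apply: fine_cvg.
have [] := @dominated_convergence _ _ _ mu D mD
  (fun n => EFin \o f_ n) (EFin \o f) (EFin \o g).
- by move=> n; apply/measurable_EFinP; exact: (mf_ n).
- exact/measurable_EFinP.
- by apply: aeW => x Dx; apply: cvg_EFin; [exact: nearW|exact: cf].
- exact: ig.
- by apply: aeW => x Dx n; rewrite /= lee_fin bf.
- by move=> if_ _; rewrite fineK//; exact: integrable_fin_num.
Qed.

Lemma Rintegral_outside D D' f : measurable D -> measurable D' -> D' `<=` D ->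
  (forall x, D x -> ~ D' x -> f x = 0) ->
  \int[mu]_(x in D) f x = \int[mu]_(x in D') f x.
Proof.
move=> mD mD' DD' f0; rewrite Rintegral_mkcond [RHS]Rintegral_mkcond.
apply: eq_Rintegral => x _; rewrite !patchE.
case: (boolP (x \in D')) => xD'.
  by rewrite (_ : x \in D = true)//; apply/mem_set/DD'/set_mem.
by case: ifPn => // xD; apply: f0; [exact/set_mem|move/mem_set; exact/negP].
Qed.

Lemma intg_outside D D' f : measurable D -> measurable D' -> D' `<=` D ->
  (forall x, D x -> ~ D' x -> f x = 0) -> intg D' f -> intg D f.
Proof.
move=> mD mD' DD' f0 if_.
have : intg D (f \_ D').
  rewrite -restrict_EFin; apply: (@integrable_restrict _ _ _ mu D' mD' D mD _).1.
  by rewrite setIidr.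
apply: intg_eq => // x xD; rewrite patchE; case: ifPn => // xD'.
by rewrite f0//; [exact/set_mem|move/mem_set; exact/negP].
Qed.

End real_integrals.

(** * Fubini on a triangle *)

Section fubini_triangle.
Context {R : realType}.
Local Notation mu := (@lebesgue_measure R).
Local Notation intg D f := (mu.-integrable D (EFin \o f)).
Local Notation T := (measurableTypeR R).

(** The integrand is dominated by [|u s| * |v t|], which is integrable on the
    plane. *)
Lemma Fubini_triangle_restricted (u v : R -> R) : intg setT u -> intg setT v ->
  (\int[mu]_s \int[mu]_t (u s * v t * (t <= s)%R%:R)%:E =
   \int[mu]_t \int[mu]_s (u s * v t * (t <= s)%R%:R)%:E)%E.
Proof.
move=> iu iv.
pose f (z : T * T) := (u z.1 * v z.2 * (z.2 <= z.1)%R%:R)%:E.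
have mu1 : measurable_fun setT (u : T -> R) by apply: intg_measurable.
have mv : measurable_fun setT (v : T -> R) by apply: intg_measurable.
have mf : measurable_fun setT f.
  apply/measurable_EFinP; apply: measurable_funM.
    apply: measurable_funM.
      by apply: (@measurableT_comp _ _ _ _ _ _ u) => //; exact: measurable_fst.
    by apply: (@measurableT_comp _ _ _ _ _ _ v) => //; exact: measurable_snd.
  rewrite (_ : (fun _ => _) = (fun z : T * T => if (z.2 : R) <= z.1 then 1 else 0)); last first.
    by apply/funext => z; case: ifP.
  apply: measurable_fun_ifT => //.
  by apply: measurable_fun_ler; [exact: measurable_snd|exact: measurable_fst].
suff fi : ((mu \x mu)%E).-integrable setT f by exact: (Fubini fi).
apply/(integrable12ltyP _ _ mf).
pose K := (\int[mu]_t `|v t|)%R.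
have iK : (\int[mu]_t `|v t|%:E = K%:E)%E.
  rewrite /K /Rintegral fineK//; apply: integrable_fin_num => //.
  exact: intg_norm.
apply: (@le_lt_trans _ _ (\int[mu]_s (K * `|u s|)%:E)%E); last first.
  apply: integrable_lty => //.
  exact: (intgZ K measurableT (intg_norm measurableT iu)).
apply: ge0_le_integral => //=.
- by move=> s _; exact: integral_ge0.
- apply: (measurable_fun_fubini_tonelli_F (abse \o f)) => //=.
  exact: measurableT_comp.
- by apply/measurable_EFinP; apply: measurable_funM => //; apply: measurableT_comp.
move=> s _; rewrite mulrC EFinM -iK -ge0_integralZl//; last first.
  by apply/measurable_EFinP; apply: measurableT_comp.
apply: ge0_le_integral => //=.
- have m1 : measurable_fun setT (fun t : T => f (s, t)).
    by apply: (measurableT_comp mf); exact: pair1_measurable.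
  exact: (@measurableT_comp _ _ _ _ _ _ abse _ (fun t : T => f (s, t))).
- by apply: emeasurable_funM => //; apply/measurable_EFinP; apply: measurableT_comp.
move=> t _; rewrite -EFinM lee_fin !normrM.
by case: (t <= s); rewrite ?normr1 ?normr0 ?mulr1 ?mulr0 ?mulr_ge0.
Qed.

(** Cutting [u] and [v] off outside the segment turns the inner integrals into
    integrals over the line against the indicator of [t <= s]. *)
Lemma Fubini_triangle (a b : R) (u v : R -> R) : a <= b ->
  intg `[a, b] u -> intg `[a, b] v ->
  \int[mu]_(s in `[a, b]) (u s * \int[mu]_(t in `[a, s]) v t) =
  \int[mu]_(t in `[a, b]) (v t * \int[mu]_(s in `[t, b]) u s).
Proof.
move=> ab iu iv.
have mab : measurable (`[a, b]%classic : set R) by [].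
have rE (w : R -> R) (D : set R) x : (w \_ D) x = if x \in D then w x else 0.
  exact: patchE.
have restr (w : R -> R) : intg `[a, b] w -> intg setT (w \_ `[a, b]).
  by move=> iw; rewrite -restrict_EFin; apply: (integrable_mkcond _ _).1.
have H1 s : (\int[mu]_t ((u \_ `[a, b]) s * (v \_ `[a, b]) t * (t <= s)%R%:R)%:E =
    (((fun s => u s * \int[mu]_(t in `[a, s]) v t) \_ `[a, b]) s)%:E)%E.
  rewrite [in RHS]rE; case: ifPn => sab; last first.
    rewrite [(u \_ _) _]rE (negbTE sab).
    by under eq_integral do rewrite !mul0r; rewrite integral0.
  have /andP[as_ sb] : a <= s <= b by move: sab; rewrite mem_setE in_itv.
  rewrite [(u \_ _) _]rE sab.
  have iv' : intg `[a, s] v.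
    by apply: intgS iv => //; apply: subset_itvl; rewrite bnd_simp.
  have iv2 : intg setT (v \_ `[a, s]).
    by rewrite -restrict_EFin; apply: (integrable_mkcond _ _).1.
  rewrite Rintegral_mkcond -RintegralZl// /Rintegral fineK; last first.
    by apply: integrable_fin_num => //; exact: (intgZ (u s) measurableT iv2).
  apply: eq_integral => t _; congr EFin; rewrite -mulrA; congr (_ * _).
  rewrite !rE !mem_setE !in_itv/=; case: (leP a t) => //= at_; rewrite ?mul0r//.
  by case: (leP t s) => ts; rewrite ?mulr0 ?mulr1//= (le_trans ts sb).
have H2 t : (\int[mu]_s ((u \_ `[a, b]) s * (v \_ `[a, b]) t * (t <= s)%R%:R)%:E =
    (((fun t => v t * \int[mu]_(s in `[t, b]) u s) \_ `[a, b]) t)%:E)%E.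
  rewrite [in RHS]rE; case: ifPn => tab; last first.
    rewrite [(v \_ _) _]rE (negbTE tab).
    by under eq_integral do rewrite mulr0 mul0r; rewrite integral0.
  have /andP[at_ tb] : a <= t <= b by move: tab; rewrite mem_setE in_itv.
  rewrite [(v \_ _) _]rE tab.
  have iu' : intg `[t, b] u.
    by apply: intgS iu => //; apply: subset_itvr; rewrite bnd_simp.
  have iu2 : intg setT (u \_ `[t, b]).
    by rewrite -restrict_EFin; apply: (integrable_mkcond _ _).1.
  rewrite Rintegral_mkcond -RintegralZl// /Rintegral fineK; last first.
    by apply: integrable_fin_num => //; exact: (intgZ (v t) measurableT iu2).
  apply: eq_integral => s _; congr EFin; rewrite mulrAC mulrC; congr (_ * _).
  rewrite !rE !mem_setE !in_itv/=; case: (leP t s) => ts /=; rewrite ?mulr0//.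
  by rewrite (le_trans at_ ts)/= mulr1.
have := Fubini_triangle_restricted (restr _ iu) (restr _ iv).
under eq_integral do rewrite H1.
under [X in _ = X]eq_integral do rewrite H2.
by move=> H; rewrite Rintegral_mkcond [RHS]Rintegral_mkcond; exact: (congr1 fine H).
Qed.

End fubini_triangle.

(** * Locally absolutely continuous functions *)

Section ac_primitives.
Context {R : realType}.
Implicit Types (u v U V : R -> R) (a b c x y r : R).
Local Notation mu := (@lebesgue_measure R).
Local Notation intg D f := (mu.-integrable D (EFin \o f)).

(** Local absolute continuity of [u] on the open half-line, with an explicit
    representative [U] of its almost everywhere derivative. *)
Definition ac_primitive u U : Prop := forall x y, 0 < x -> x <= y ->
  intg `[x, y] U /\ u y - u x = \int[mu]_(t in `[x, y]) U t.

Lemma ac_primitiveD u v U V : ac_primitive u U -> ac_primitive v V ->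
  ac_primitive (u \+ v) (U \+ V).
Proof.
move=> Hu Hv x y x0 xy; have [iU eU] := Hu x y x0 xy.
have [iV eV] := Hv x y x0 xy; split; first exact: intgD.
by rewrite RintegralD// -eU -eV /=; ring.
Qed.

Lemma ac_primitiveZ c u U : ac_primitive u U ->
  ac_primitive (fun x => c * u x) (fun x => c * U x).
Proof.
move=> Hu x y x0 xy; have [iU eU] := Hu x y x0 xy; split; first exact: intgZ.
by rewrite RintegralZl// -eU -mulrBr.
Qed.

Lemma ac_primitive_cst c : ac_primitive (fun=> c) (fun=> 0).
Proof.
move=> x y x0 xy; split.
  apply: intg_cont; apply: continuous_subspaceT => z; exact: cvg_cst.
by rewrite subrr Rintegral_cst// mul0r.
Qed.

Lemma ac_primitive_eq u v U V : (forall r, 0 < r -> u r = v r) ->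
  (forall r, 0 < r -> U r = V r) -> ac_primitive u U -> ac_primitive v V.
Proof.
move=> uv UV Hu x y x0 xy; have [iU eU] := Hu x y x0 xy.
have UVxy : {in `[x, y]%classic, U =1 V}.
  move=> z; rewrite mem_setE in_itv/= => /andP[xz _].
  by apply: UV; exact: lt_le_trans xz.
split; first by apply: intg_eq iU.
by rewrite -!uv ?(lt_le_trans x0 xy)// eU; exact: eq_Rintegral.
Qed.

Lemma itvcc_halfline x y : 0 < x -> `[x, y] `<=` halfline R.
Proof.
move=> x0 z; rewrite /halfline /= !in_itv/= => /andP[xz _].
by rewrite andbT (lt_le_trans x0).
Qed.

Lemma measurable_halfline : measurable (halfline R).
Proof. by rewrite /halfline. Qed.

Lemma segment_bounded u a b : {within `[a, b], continuous u} ->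
  exists C : R, forall x, a <= x <= b -> `|u x| <= C.
Proof.
move=> cu; have [M [_ HM]] := compact_bounded (continuous_compact cu (@segment_compact _ a b)).
exists (M + 1) => x xab; apply: (HM (M + 1)); first by rewrite ltrDl.
by exists x => //=; rewrite in_itv.
Qed.

Lemma ac_primitive_ae u U V : measurable_fun (halfline R) V ->
  ae_eq mu (halfline R) U V -> ac_primitive u U -> ac_primitive u V.
Proof.
move=> mV UV Hu x y x0 xy; have [iU eU] := Hu x y x0 xy.
have sub := @itvcc_halfline x y x0.
have mV' : measurable_fun `[x, y] V.
  by apply: measurable_funS mV => //; exact: measurable_halfline.
have UV' : ae_eq mu `[x, y]%classic U V by apply: ae_eq_subset UV.
split; first by apply: intg_ae iU.
by rewrite eU; apply: Rintegral_ae => //; exact: intg_measurable.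
Qed.

Lemma ac_primitive_continuous u U r : 0 < r -> ac_primitive u U ->
  {for r, continuous u}.
Proof.
move=> r0 Hu; have r20 : 0 < r / 2 by rewrite divr_gt0.
have r2r : r / 2 < r by rewrite ltr_pdivrMr// ltr_pMr// ltr1n.
have rr1 : r < r + 1 by rewrite ltrDl.
have r2r1 := lt_trans r2r rr1.
have [iU _] := Hu _ _ r20 (ltW r2r1).
have := parameterized_integral_continuous (ltW r2r1) iU.
move=> /continuous_within_itvP -/(_ r2r1)[+ _ _].
move=> /(_ r); rewrite in_itv/= r2r rr1 => /(_ isT) cP.
have cG : {for r, continuous (fun z => u (r / 2) + parameterized_integral mu (r / 2) z U)}.
  by apply: cvgD => //; exact: cvg_cst.
rewrite /prop_for /continuous_at.
have E z : r / 2 <= z -> u z = u (r / 2) + parameterized_integral mu (r / 2) z U.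
  by move=> rz; have [_ e] := Hu _ _ r20 rz; rewrite /parameterized_integral -e; ring.
rewrite (E r (ltW r2r)); apply: cvg_trans cG; apply: near_eq_cvg.
near=> z; rewrite -E//; apply/ltW; near: z; exact: (cvgr_gt r cvg_id).
Unshelve. all: by end_near. Qed.

Lemma continuous_halfline_within u x y : 0 < x ->
  (forall r, 0 < r -> {for r, continuous u}) -> {within `[x, y], continuous u}.
Proof.
move=> x0 cu; apply: continuous_in_subspaceT => z.
rewrite mem_setE in_itv/= => /andP[xz _]; apply: cu; exact: lt_le_trans xz.
Qed.

Lemma continuous_halfline_measurable u :
  (forall r, 0 < r -> {for r, continuous u}) -> measurable_fun (halfline R) u.
Proof.
move=> cu; apply: open_continuous_measurable_fun; first exact: interval_open.
by move=> z; rewrite /halfline mem_setE in_itv/= andbT => /cu.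
Qed.

Lemma ac_primitive_C1 u U : (forall r : R, 0 < r -> is_derive r 1 u (U r)) ->
  (forall r, 0 < r -> {for r, continuous U}) -> ac_primitive u U.
Proof.
move=> du cU x y x0; rewrite le_eqVlt => /predU1P[<-|xy].
  rewrite set_itv1 subrr Rintegral_set1; split=> //.
  have := intg_cont (@continuous_halfline_within U x x x0 cU).
  by rewrite set_itv1.
have iU := intg_cont (@continuous_halfline_within U x y x0 cU).
split=> //; rewrite /Rintegral (@continuous_FTC2 R U u x y xy) ?fineK//.
- exact: continuous_halfline_within.
- have cu r : 0 < r -> {for r, continuous u}.
    move=> /du[dr _]; exact/differentiable_continuous/derivable1_diffP.
  split.
  + move=> r; rewrite in_itv/= => /andP[xr _].
    by have [] := du r (lt_trans x0 xr).
  + exact/cvg_at_right_filter/cu.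
  + exact/cvg_at_left_filter/cu/(lt_trans x0).
- move=> r; rewrite in_itv/= => /andP[xr _].
  by rewrite derive1E; have [] := du r (lt_trans x0 xr).
Qed.

(** The pointwise product rule is not available for primitives of functions that
    are merely integrable. Writing [v s] as [v x] plus an integral of [V] turns
    the integral of [U * v] into one over a triangle, where the order of
    integration can be exchanged. *)
Lemma ac_primitiveM u v U V : ac_primitive u U -> ac_primitive v V ->
  ac_primitive (u \* v) ((U \* v) \+ (u \* V)).
Proof.
move=> Hu Hv x y x0 xy.
have [iU eU] := Hu x y x0 xy; have [iV eV] := Hv x y x0 xy.
have bounded_mul w W Z : ac_primitive w W -> intg `[x, y] Z -> intg `[x, y] (w \* Z).
  move=> Hw iZ; have cw : {within `[x, y], continuous w}.
    by apply: continuous_halfline_within => // r r0; exact: ac_primitive_continuous Hw.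
  have [C HC] := segment_bounded cw.
  have mw : measurable_fun `[x, y] w by exact: intg_measurable (intg_cont cw).
  by apply: (@intgM _ _ _ _ C) => // z; rewrite /= in_itv; exact: HC.
have iUv : intg `[x, y] (U \* v).
  rewrite (_ : U \* v = v \* U); first exact: bounded_mul Hv iU.
  by apply/funext => z /=; rewrite mulrC.
have iuV := bounded_mul _ _ _ Hu iV.
split; first exact: intgD.
rewrite RintegralD//.
pose P s := \int[mu]_(t in `[x, s]) V t.
have vE : {in `[x, y]%classic, forall s, U s * v s = v x * U s + U s * P s}.
  move=> s; rewrite mem_setE in_itv/= => /andP[xs sy].
  by have [_ e] := Hv x s x0 xs; rewrite /P -e; ring.
have iUP : intg `[x, y] (fun s => U s * P s).
  apply: (@intg_eq _ _ ((U \* v) \- (fun s => v x * U s))) => //.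
    by move=> s sxy; rewrite /= vE// addrC addKr.
  by apply: intgB => //; exact: intgZ.
have uE : {in `[x, y]%classic, forall t, V t * \int[mu]_(s in `[t, y]) U s =
    u y * V t - u t * V t}.
  move=> t; rewrite mem_setE in_itv/= => /andP[xt ty].
  by have [_ e] := Hu t y (lt_le_trans x0 xt) ty; rewrite -e; ring.
have e1 : \int[mu]_(s in `[x, y]) (U s * v s) =
    v x * (u y - u x) + \int[mu]_(s in `[x, y]) (U s * P s).
  by rewrite (@eq_Rintegral _ _ _ mu _ _ _ vE) RintegralD ?RintegralZl// -?eU//; exact: intgZ.
have e2 : \int[mu]_(s in `[x, y]) (U s * P s) =
    u y * (v y - v x) - \int[mu]_(t in `[x, y]) (u t * V t).
  rewrite /P Fubini_triangle// (@eq_Rintegral _ _ _ mu _ _ _ uE) RintegralB//; last exact: intgZ.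
  by rewrite RintegralZl// -eV.
by rewrite /= e1 e2; ring.
Qed.

End ac_primitives.

(** * Weak derivatives *)

Section weak_derivatives.
Context {R : realType}.
Implicit Types (u v U V f g k phi : R -> R) (a b c x y r : R).
Local Notation mu := (@lebesgue_measure R).
Local Notation intg D f := (mu.-integrable D (EFin \o f)).

Definition locally_intg f := forall x y, 0 < x -> x <= y -> intg `[x, y] f.

Lemma locally_intgM f g : locally_intg f ->
  (forall r, 0 < r -> {for r, continuous g}) -> locally_intg (g \* f).
Proof.
move=> lf cg x y x0 xy; have cw := @continuous_halfline_within _ g x y x0 cg.
have [C HC] := segment_bounded cw.
apply: (@intgM _ _ _ _ C) => //; first exact: lf.
  exact: intg_measurable (intg_cont cw).
Qed.

(** Enlarging the support makes the function vanish at both ends of the segment,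
    so that integrations by parts leave no boundary term. *)
Lemma real_test_support phi : real_test phi -> exists x y, [/\ 0 < x, x < y,
  forall r, ~~ (x < r < y) -> phi r = 0 &
  forall r, ~~ (x < r < y) -> derive1 phi r = 0].
Proof.
move=> [_ [a [b [a0 H]]]]; exists (a / 2), (Num.max a b + 1).
have aa : a / 2 < a by rewrite ltr_pdivrMr// ltr_pMr// ltr1n.
have lt1 : b < Num.max a b + 1 by rewrite (@le_lt_trans _ _ (Num.max a b)) ?le_max ?lexx ?orbT// ltrDl.
have lt2 : a < Num.max a b + 1 by rewrite (@le_lt_trans _ _ (Num.max a b)) ?le_max ?lexx// ltrDl.
have sub r : ~~ (a / 2 < r < Num.max a b + 1) -> ~~ (a <= r <= b).
  apply: contra => /andP[h1 h2].
  by rewrite (lt_le_trans aa h1) (le_lt_trans h2 lt1).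
split.
- by rewrite divr_gt0.
- exact: lt_trans lt2.
- by move=> r /sub/H.
- by move=> r /sub; exact: derive1_outside.
Qed.

Lemma halfline_restrict f x y : 0 < x -> (forall r, ~~ (x < r < y) -> f r = 0) ->
  \int[mu]_(r in halfline R) f r = \int[mu]_(r in `[x, y]) f r.
Proof.
move=> x0 f0; apply: Rintegral_outside => //; first exact: measurable_halfline.
  exact: itvcc_halfline.
move=> r _; rewrite /= in_itv/= => rxy; apply: f0; apply/negP => /andP[h1 h2].
by apply: rxy; rewrite !ltW.
Qed.

Lemma intg_halfline_restrict f x y : 0 < x ->
  (forall r, ~~ (x < r < y) -> f r = 0) -> intg `[x, y] f -> intg (halfline R) f.
Proof.
move=> x0 f0; apply: intg_outside => //; first exact: measurable_halfline.
  exact: itvcc_halfline.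
move=> r _; rewrite /= in_itv/= => rxy; apply: f0; apply/negP => /andP[h1 h2].
by apply: rxy; rewrite !ltW.
Qed.

Lemma locally_intg_test f phi : locally_intg f -> real_test phi ->
  intg (halfline R) (f \* phi).
Proof.
move=> lf tphi; have [x [y [x0 xy phi0 _]]] := real_test_support tphi.
apply: (@intg_halfline_restrict _ x y) => //.
  by move=> r /phi0 /= ->; rewrite mulr0.
rewrite (_ : _ \* _ = phi \* f); last by apply/funext => z /=; rewrite mulrC.
apply: locally_intgM => //; last exact: ltW.
by move=> r _; apply: smooth_continuous; have [] := tphi.
Qed.

Lemma smooth_ac_primitive phi : smooth phi -> ac_primitive phi (derive1 phi).
Proof.
move=> sphi; apply: ac_primitive_C1 => r r0.
  by rewrite derive1E; apply: derivableP; exact: smooth_derivable.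
exact/smooth_continuous/smooth_derive1.
Qed.

Lemma ac_primitive_weak u U phi : ac_primitive u U -> real_test phi ->
  \int[mu]_(r in halfline R) (u r * derive1 phi r) =
  - \int[mu]_(r in halfline R) (U r * phi r).
Proof.
move=> Hu tphi; have [x [y [x0 xy phi0 dphi0]]] := real_test_support tphi.
have lU : locally_intg U by move=> a b a0 ab; have [] := Hu a b a0 ab.
have lu : locally_intg u.
  move=> a b a0 ab; apply/intg_cont/continuous_halfline_within => // r r0.
  exact: ac_primitive_continuous Hu.
rewrite (@halfline_restrict _ x y)//; last by move=> r /dphi0 ->; rewrite mulr0.
rewrite (@halfline_restrict _ x y)//; last by move=> r /phi0 ->; rewrite mulr0.
have sphi := tphi.1.
have [_] := ac_primitiveM Hu (smooth_ac_primitive sphi) x0 (ltW xy).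
rewrite /= !phi0 ?ltxx ?andbF// !mulr0 subr0.
have sub : `[x, y] `<=` halfline R by exact: itvcc_halfline.
rewrite RintegralD//; first by move/esym/eqP; rewrite addrC addr_eq0 => /eqP.
  apply: intgS sub _ => //; first exact: measurable_halfline.
  exact: (locally_intg_test lU tphi).
apply: intgS sub _ => //; first exact: measurable_halfline.
exact: (locally_intg_test lu (real_test_derive1 tphi)).
Qed.

(** Bumps tend to indicators, so the integral of [k] over every interval is zero;
    its primitives are then constant, and almost every point is a
    differentiability point where the derivative is [k]. *)
Lemma fundamental_lemma k : locally_intg k ->
  (forall phi, real_test phi -> \int[mu]_(r in halfline R) (k r * phi r) = 0) ->
  ae_eq mu (halfline R) k (fun=> 0).
Proof.
move=> lk k0.
have kxy x y : 0 < x -> x < y -> \int[mu]_(r in `]x, y[) k r = 0.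
  move=> x0 xy.
  have ik : intg `]x, y[ k.
    by apply: intgS (lk x y x0 (ltW xy)) => //; exact: subset_itv_oo_cc.
  have : (\int[mu]_(r in `]x, y[) (k r * bump x y n r)) @[n --> \oo] -->
      \int[mu]_(r in `]x, y[) k r.
    apply: (@Rintegral_dominated _ _ _ _ (fun r => `|k r|)) => //.
    - move=> n; apply: measurable_funM; first exact: intg_measurable.
      apply: measurable_funTS; apply: continuous_measurable_fun.
      exact/smooth_continuous/bump_smooth.
    - exact: intg_measurable.
    - exact: intg_norm.
    - move=> r rxy; rewrite -[X in _ --> X]mulr1; apply: cvgMr.
      by have := @bump_cvg R x y r; rewrite indicE mem_set.
    - move=> n r _; rewrite normrM ler_piMr// ger0_norm ?bump_ge0//.
      exact: bump_le1.
  rewrite (_ : (fun n => _) = (fun=> 0)); last first.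
    apply/funext => n; rewrite -(k0 _ (@bump_real_test R x y n x0)).
    apply/esym; apply: Rintegral_outside => //; first exact: measurable_halfline.
      move=> z; rewrite /halfline /= !in_itv/= => /andP[xz _].
      by rewrite andbT (lt_trans x0).
    move=> z _; rewrite /= in_itv/= => /negP zxy.
    by rewrite bump_out ?mulr0.
  by move/cvg_lim => <-//; rewrite lim_cst.
(* The open half-line is exhausted by these intervals, on each of which [k] is
   integrable. *)
have H n : {ae mu, forall r, n.+1%:R^-1 < r < n.+1%:R -> k r = 0}.
  set a := n.+1%:R^-1; set b := n.+1%:R.
  have a0 : 0 < a by rewrite invr_gt0.
  have [ab|ba] := leP a b; last first.
    by apply: aeW => r /andP[ar rb]; have := lt_trans (lt_trans ar rb) ba; rewrite ltxx.
  have ik : intg `]a, b[ k.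
    by apply: intgS (lk a b a0 ab) => //; exact: subset_itv_oo_cc.
  have iR : intg setT (k \_ `]a, b[).
    by rewrite -restrict_EFin; apply: (integrable_mkcond _ _).1.
  have F1 := @FTC1 R (k \_ `]a, b[) (BRight a)
    (fun y => intgS measurableT _ (@subsetT _ _) iR) (integrable_locally_restrict _ ik).
  apply: filterS (F1 _ _) => //; first exact: (ae_filter_ringOfSetsType mu).
  move=> r /= Hr /andP[ar rb]; have [|_] := Hr; first exact: ar.
  rewrite patchE mem_set; last by rewrite /= in_itv/= ar.
  move=> <-; rewrite derive1E.
  set F := (fun x : R => _).
  suff dF : is_derive r 1 F 0 by have [] := dF.
  apply: (@near_eq_is_derive _ _ _ (cst 0)).
  near=> z.
  have az : a < z by near: z; exact: (cvgr_gt r cvg_id).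
  have zb : z < b by near: z; exact: lt_nbhsl.
  have ikz : intg `]a, z[ k.
    by apply: intgS ik => //; apply: subset_itvl; rewrite bnd_simp ltW.
  rewrite /F (@eq_Rintegral _ _ _ mu _ k); last first.
    move=> t; rewrite mem_setE in_itv/= => /andP[at_ tz].
    by rewrite patchE mem_set//= in_itv/= at_ (le_lt_trans tz zb).
  by rewrite -Rintegral_itv_bndo_bndc// kxy.
have H' : {ae mu, forall r, forall n, n.+1%:R^-1 < r < n.+1%:R -> k r = 0}.
  exact: ae_foralln H.
rewrite /ae_eq; apply: filterS H'; first exact: (ae_filter_ringOfSetsType mu).
move=> r /= Hr; rewrite /halfline /= in_itv/= andbT => r0.
have ri0 : 0 < r^-1 by rewrite invr_gt0.
have s0 : 0 <= r + r^-1 by rewrite addr_ge0 ?ltW.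
have := archi_boundP s0; set n := Num.bound _ => rn.
have nn : n%:R < n.+1%:R :> R by rewrite ltr_nat.
apply: (Hr n); rewrite (lt_trans _ (lt_trans rn nn)) ?andbT ?ltrDl//.
rewrite -[X in _ < X]invrK ltf_pV2 ?posrE ?ltr0n//.
by rewrite (lt_trans _ (lt_trans rn nn))// ltrDr.
Unshelve. all: by end_near. Qed.

Lemma locally_intg_cst c : locally_intg (fun=> c).
Proof.
by move=> x y x0 xy; apply/intg_cont/continuous_subspaceT => z; exact: cvg_cst.
Qed.

(** Otherwise the constant [1] would integrate to zero against all test functions
    and vanish almost everywhere. *)
Lemma real_test_nonzero_integral :
  exists2 eta, real_test eta & \int[mu]_(r in halfline R) eta r != 0.
Proof.
apply: contrapT => H.
have H1 : ae_eq mu (halfline R) (fun=> 1 : R) (fun=> 0).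
  apply: fundamental_lemma; first exact: locally_intg_cst.
  move=> phi tphi.
  under eq_Rintegral do rewrite mul1r.
  by apply: contrapT => /eqP H1; apply: H; exists phi.
have sub : `[1, 2] `<=` halfline R by apply: itvcc_halfline; rewrite ltr01.
have H2 : ae_eq mu `[1, 2]%classic (fun=> 1 : R) (fun=> 0 : R) by apply: ae_eq_subset H1.
have /eqP := Rintegral_ae (measurable_itv _) (measurable_cst _) (measurable_cst _) H2.
rewrite !Rintegral_cst//= lebesgue_measure_itv/= lte_fin ltr1n mul1r mul0r.
by rewrite -EFinB /= (_ : 2 - 1 = 1 :> R) ?oner_eq0//; ring.
Qed.

(** The primitive that vanishes on the left of the support also vanishes on its
    right, because the total integral is zero. *)
Lemma real_test_primitive theta : real_test theta ->
  \int[mu]_(r in halfline R) theta r = 0 ->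
  exists2 Theta, real_test Theta & derive1 Theta = theta.
Proof.
move=> tt t0; have [x [y [x0 xy tE _]]] := real_test_support tt.
have ct : continuous theta by apply: smooth_continuous; have [] := tt.
have it a b : intg `[a, b] theta by exact/intg_cont/continuous_subspaceT.
pose T z := \int[mu]_(t in `[x - 1, z]) theta t.
have x1 : x - 1 < x by rewrite ltrBlDr ltrDl.
have T0 z : z <= x -> T z = 0.
  move=> zx; rewrite /T (@eq_Rintegral _ _ _ mu _ (fun=> 0)) ?Rintegral_cst ?mul0r//.
  move=> t; rewrite mem_setE in_itv/= => /andP[_ tz].
  by rewrite tE// negb_and -!leNgt (le_trans tz zx).
have T1 z : y <= z -> T z = 0.
  move=> yz; rewrite /T -t0 (@halfline_restrict _ x y)//.
  apply: Rintegral_outside => //.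
    by apply: subset_itv; rewrite bnd_simp// ltW.
  move=> t _; rewrite /= in_itv/= => txy; apply: tE; apply/negP => /andP[h1 h2].
  by apply: txy; rewrite !ltW.
have dT (z : R) : is_derive z 1 T (theta z).
  have [zx|xz] := ltP z x.
    rewrite tE; last by rewrite negb_and -!leNgt (ltW zx).
    apply: (@near_eq_is_derive _ _ _ (cst 0)).
    near=> t; rewrite T0//; apply: ltW; near: t; exact: lt_nbhsl.
  have zz : z < z + 1 by rewrite ltrDl.
  have [dz <-] := continuous_FTC1_closed zz (it _ _) (lt_le_trans x1 xz) (ct z).
  by rewrite derive1E; exact: derivableP.
exists T; last by apply/funext => z; rewrite derive1E; have [] := dT z.
split; first by apply: smooth_primitive dT _; have [] := tt.
exists x, y; split=> // r; rewrite negb_and -!ltNge => /orP[h|h].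
  by rewrite T0// ltW.
by rewrite T1// ltW.
Unshelve. all: by end_near. Qed.

(** Subtracting a multiple of a fixed test function of non-zero integral turns any
    test function into the derivative of one, against which [h] integrates to
    zero. *)
Lemma weak_derivative0 h : locally_intg h ->
  (forall phi, real_test phi ->
     \int[mu]_(r in halfline R) (h r * derive1 phi r) = 0) ->
  exists c, ae_eq mu (halfline R) h (fun=> c).
Proof.
move=> lh H; have [eta teta Ieta] := real_test_nonzero_integral.
set I := Rintegral _ _ _ in Ieta.
pose c := (\int[mu]_(r in halfline R) (h r * eta r)) / I; exists c.
have mh : measurable (halfline R) by exact: measurable_halfline.
have itest phi : real_test phi -> intg (halfline R) phi.
  move=> tphi; have := locally_intg_test (locally_intg_cst 1) tphi.
  by apply: intg_eq => // z _ /=; rewrite mul1r.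
have lk : locally_intg (fun r => h r - c).
  by move=> x y x0 xy; apply: intgB => //; [exact: lh|exact: locally_intg_cst].
suff : ae_eq mu (halfline R) (fun r => h r - c) (fun=> 0).
  by apply: filterS => r /= hr /hr /eqP; rewrite subr_eq0 => /eqP.
apply: fundamental_lemma => // phi tphi.
pose J := \int[mu]_(r in halfline R) phi r.
have ttheta := real_testD tphi (real_testZ (- (J / I)) teta).
have [|T tT dT] := real_test_primitive ttheta.
  rewrite RintegralD//; [|exact: itest|exact/itest/real_testZ].
  by rewrite RintegralZl//; [rewrite -/J -/I mulNr divfK// subrr|exact: itest].
have := H _ tT; rewrite dT /=.
have ih := locally_intg_test lh tphi; have ie := locally_intg_test lh teta.
rewrite (@eq_Rintegral _ _ _ mu _ (fun r => h r * phi r + (- (J / I)) * (h r * eta r))); last first.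
  by move=> r _; ring.
rewrite RintegralD//; last exact: (intgZ (- (J / I)) mh ie).
rewrite RintegralZl// => E.
rewrite (@eq_Rintegral _ _ _ mu _ (fun r => h r * phi r + (- c) * phi r)); last first.
  by move=> r _; ring.
rewrite RintegralD//; last by apply: (intgZ (- c) mh); exact: itest.
rewrite RintegralZl//; last exact: itest.
by rewrite -/J -[RHS]E /c; congr (_ + _); field.
Qed.

Lemma ac_primitive_exists G : locally_intg G -> exists u, ac_primitive u G.
Proof.
move=> lG; pose u z := if 1 <= z then \int[mu]_(t in `[1, z]) G t
  else - \int[mu]_(t in `[z, 1]) G t.
exists u => x y x0 xy; split; first exact: lG.
rewrite /u; case: (leP 1 x) => x1; case: (leP 1 y) => y1.
- by rewrite -(@Rintegral_chasles _ 1 x y)//; [rewrite addrC addKr|apply: lG].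
- by have := lt_le_trans y1 (le_trans x1 xy); rewrite ltxx.
- rewrite opprK addrC Rintegral_chasles//; [exact: ltW|exact: lG].
- rewrite -(@Rintegral_chasles _ x y 1)//; [|exact: ltW|by apply: lG => //; exact: ltW].
  by rewrite opprK addrC addrK.
Qed.

(** Du Bois-Reymond: subtracting a primitive of the weak derivative leaves a
    function with vanishing weak derivative, hence a constant. *)
Lemma weak_derivative_primitive f G : locally_intg f -> locally_intg G ->
  (forall phi, real_test phi ->
     \int[mu]_(r in halfline R) (f r * derive1 phi r) =
     - \int[mu]_(r in halfline R) (G r * phi r)) ->
  exists2 u, ac_primitive u G & ae_eq mu (halfline R) f u.
Proof.
move=> lf lG H; have [u Hu] := ac_primitive_exists lG.
have lu : locally_intg u.
  move=> x y x0 xy; apply/intg_cont/continuous_halfline_within => // r r0.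
  exact: ac_primitive_continuous Hu.
have [||c hc] := @weak_derivative0 (f \- u).
- by move=> x y x0 xy; apply: intgB => //; [exact: lf|exact: lu].
- move=> phi tphi; have tdphi := real_test_derive1 tphi.
  rewrite (@eq_Rintegral _ _ _ mu _
      (fun r => f r * derive1 phi r - u r * derive1 phi r)); last first.
    by move=> r _ /=; ring.
  rewrite RintegralB; [|exact: measurable_halfline|exact: (locally_intg_test lf tdphi)|
    exact: (locally_intg_test lu tdphi)].
  by rewrite H// (ac_primitive_weak Hu)// subrr.
exists (fun r => u r + c).
  move=> x y x0 xy; have [iG eG] := Hu x y x0 xy; split=> //.
  by rewrite -eG; ring.
move: hc; apply: filterS.
by move=> r /= hr /hr <-; ring.
Qed.

End weak_derivatives.

(** * Powers and square-integrable functions near the origin *)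

Section integrals_near_zero.
Context {R : realType}.
Implicit Types (u v U V Y y f g : R -> R) (s r x : R).
Local Notation mu := (@lebesgue_measure R).
Local Notation intg D f := (mu.-integrable D (EFin \o f)).

Lemma itvoc_halfline r : `]0, r] `<=` halfline R.
Proof. by move=> z; rewrite /halfline /= !in_itv/= andbT => /andP[]. Qed.

Lemma powR_continuous s r : 0 < r -> {for r, continuous (fun t => t `^ s)}.
Proof.
move=> r0; have [dr _] := @is_derive1_powR R s r r0.
exact/differentiable_continuous/derivable1_diffP.
Qed.

Lemma measurable_powR_halfline s : measurable_fun (halfline R) (fun t => t `^ s).
Proof. by apply: continuous_halfline_measurable => r; exact: powR_continuous. Qed.

Lemma powR_ac_primitive s : s < 1 ->
  ac_primitive (fun t => (1 - s)^-1 * t `^ (1 - s)) (fun t => t `^ (- s)).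
Proof.
move=> s1; apply: ac_primitive_C1; last by move=> r; exact: powR_continuous.
move=> r r0; have := @is_derive1_powR R (1 - s) r r0.
move=> /(@is_deriveZ _ _ _ _ (1 - s)^-1) H.
have s1n : 1 - s != 0 by rewrite gt_eqF// subr_gt0.
apply: (is_derive_eq H); rewrite /GRing.scale/= mulrA mulVf// mul1r.
by congr (_ `^ _); ring.
Qed.

(** Monotone convergence along the segments from [r / n.+1] to [r], on which the
    fundamental theorem of calculus applies. *)
Lemma intg_powR_near0 s r : s < 1 -> 0 < r -> intg `]0, r] (fun t => t `^ (- s)) /\
  \int[mu]_(t in `]0, r]) t `^ (- s) <= (1 - s)^-1 * r `^ (1 - s).
Proof.
move=> s1 r0; pose F (n : nat) := `[r / n.+1%:R, r]%classic.
have Fpos n : 0 < r / n.+1%:R by rewrite divr_gt0.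
have Fle n : r / n.+1%:R <= r by rewrite ler_pdivrMr// ler_peMr ?ler1n// ltW.
have mpow D : measurable D -> D `<=` halfline R -> measurable_fun D (fun t => t `^ (- s)).
  move=> mD DH; apply: measurable_funS (measurable_powR_halfline (- s)) => //.
  exact: measurable_halfline.
have Fsub n : F n `<=` halfline R by exact: itvcc_halfline.
have FU : \bigcup_n F n = `]0, r]%classic.
  apply/seteqP; split=> t.
    move=> [n _]; rewrite /F /= !in_itv/= => /andP[h ->].
    by rewrite (lt_le_trans (Fpos n) h).
  rewrite /= in_itv/= => /andP[t0 tr].
  have rt0 : 0 <= r / t by rewrite divr_ge0 ?ltW.
  exists (Num.bound (r / t)) => //; rewrite /F /= in_itv/= tr andbT.
  rewrite ler_pdivrMr ?ltr0n// mulrC -ler_pdivrMr//.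
  by rewrite (le_trans (ltW (archi_boundP rt0)))// ler_nat.
have mF n : measurable (F n) by exact: measurable_itv.
have mfF n : measurable_fun (F n) (EFin \o (fun t => t `^ (- s))).
  by apply/measurable_EFinP; exact: mpow.
have ndF : {homo F : n k / (n <= k)%N >-> (n <= k)%O}.
  move=> n k nk; apply/subsetPset => t; rewrite /F /= !in_itv/= => /andP[h ->].
  rewrite andbT (le_trans _ h)// ler_wpM2l ?(ltW r0)// lef_pV2 ?posrE ?ltr0n//.
  by rewrite ler_nat.
have ub : (\int[mu]_(t in `]0%R, r]) (t `^ (- s))%:E <= ((1 - s)^-1 * r `^ (1 - s))%:E)%E.
  rewrite -FU; have H := @ge0_nondecreasing_set_cvg_integral _ (measurableTypeR R) R F
    (fun t => (t `^ (- s))%:E) mu ndF mF mfF (fun n t _ => powR_ge0 t (- s)).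
  apply: cvge_le H; apply: nearW => n.
  have [iF eF] := powR_ac_primitive s1 (Fpos n) (Fle n).
  rewrite -[leLHS]fineK; last by apply: integrable_fin_num; [exact: mF|exact: iF].
  rewrite lee_fin -[leLHS]eF lerBlDr lerDl mulr_ge0 ?powR_ge0//.
  by rewrite invr_ge0 subr_ge0 ltW.
have mpr : measurable_fun `]0, r] (fun t => t `^ (- s)).
  by apply: mpow => //; exact: itvoc_halfline.
have i0 : intg `]0, r] (fun t => t `^ (- s)).
  apply/integrableP; split; first exact/measurable_EFinP.
  rewrite (le_lt_trans _ (ltry ((1 - s)^-1 * r `^ (1 - s))))//.
  apply: le_trans ub; rewrite le_eqVlt; apply/orP; left; apply/eqP.
  by apply: eq_integral => t _ /=; rewrite ger0_norm ?powR_ge0.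
split=> //; rewrite -lee_fin /Rintegral fineK//; exact: integrable_fin_num.
Qed.

Lemma Rintegral_near0_cvg Y : intg `]0, 1] Y ->
  (\int[mu]_(t in `]0, r]) Y t) @[r --> 0^'+] --> 0.
Proof.
move=> iY; pose Y' := Y \_ `]0, 1].
have iY' : intg `[0, 1] Y'.
  apply: (intgS measurableT _ (@subsetT _ _)) => //.
  by rewrite -restrict_EFin; apply: (integrable_mkcond _ _).1.
have /cvg_at_right_filter := parameterized_integral_cvg_left (@ltr01 R) iY'.
apply: cvg_trans; apply: near_eq_cvg; near=> r.
have r1 : r <= 1 by near: r; exact: nbhs_right_le.
rewrite /parameterized_integral -Rintegral_itv_obnd_cbnd; last first.
  by apply: intgS iY' => //; apply: subset_itv; rewrite bnd_simp.
apply: eq_Rintegral => t; rewrite mem_setE in_itv/= => /andP[t0 tr].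
by rewrite /Y' patchE mem_set//= in_itv/= t0 (le_trans tr).
Unshelve. all: by end_near. Qed.

(** A derivative integrable up to the origin gives the function a limit there. *)
Lemma ac_primitive_at0 y Y : ac_primitive y Y -> intg `]0, 1] Y ->
  exists A, [/\ (forall r, 0 < r -> r <= 1 -> y r = A + \int[mu]_(t in `]0, r]) Y t) &
    y r @[r --> 0^'+] --> A].
Proof.
move=> Hy iY; exists (y 1 - \int[mu]_(t in `]0, 1]) Y t).
have E r : 0 < r -> r <= 1 ->
    y r = y 1 - \int[mu]_(t in `]0, 1]) Y t + \int[mu]_(t in `]0, r]) Y t.
  move=> r0 r1; have [ir e] := Hy r 1 r0 r1.
  have ir' : intg `]r, 1] Y.
    by apply: intgS ir => //; exact: subset_itv_oc_cc.
  have := @Rintegral_itvB R Y (BRight 0) (BRight 1) r iY.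
  rewrite !bnd_simp => /(_ (ltW r0) r1).
  by rewrite (Rintegral_itv_obnd_cbnd ir') -e => h; lra.
split => //.
rewrite -[X in _ --> X]addr0.
apply: (@cvg_trans _ ((y 1 - \int[mu]_(t in `]0, 1]) Y t + \int[mu]_(t in `]0, r]) Y t) @[r --> 0^'+])).
  apply: near_eq_cvg; near=> r; rewrite [RHS]E//.
  by near: r; exact: nbhs_right_le.
by apply: cvgD; [exact: cvg_cst|exact: Rintegral_near0_cvg].
Unshelve. all: by end_near. Qed.

Definition square_intg u := measurable_fun (halfline R) u /\ intg (halfline R) (fun x => u x ^+ 2).

Lemma ler_norm_mul_sqr (x y : R) : `|x * y| <= x ^+ 2 + y ^+ 2.
Proof.
rewrite normrM -(real_normK (num_real x)) -(real_normK (num_real y)).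
by have := sqr_ge0 (`|x| - `|y|); have := sqr_ge0 (`|x|); have := sqr_ge0 (`|y|); nra.
Qed.

Lemma square_intgM u v : square_intg u -> square_intg v -> intg (halfline R) (u \* v).
Proof.
move=> [mu1 iu] [mv iv]; apply: (@intg_le _ _ _ (fun x => u x ^+ 2 + v x ^+ 2)).
- exact: measurable_halfline.
- exact: measurable_funM.
- by apply: intgD => //; exact: measurable_halfline.
- by move=> x _; exact: ler_norm_mul_sqr.
Qed.

Lemma square_intgD u v : square_intg u -> square_intg v -> square_intg (u \+ v).
Proof.
move=> hu hv; split; first by apply: measurable_funD; [exact: hu.1|exact: hv.1].
have mh := @measurable_halfline R.
have := intgD mh (intgD mh hu.2 hv.2) (intgZ 2 mh (square_intgM hu hv)).
by apply: intg_eq => // x _ /=; ring.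
Qed.

Lemma square_intgZ c u : square_intg u -> square_intg (fun x => c * u x).
Proof.
move=> hu; split; first by apply: measurable_funM => //; exact: hu.1.
have mh := @measurable_halfline R.
by apply: intg_eq (intgZ (c ^+ 2) mh hu.2) => // x _ /=; ring.
Qed.

(** [|u| <= 1 + u^2], and constants are integrable on a bounded interval. *)
Lemma square_intg_itv u r : square_intg u -> 0 < r -> intg `]0, r] u.
Proof.
move=> [mu1 iu] r0; have mh := @measurable_halfline R.
have sub := @itvoc_halfline r.
apply: (@intg_le _ _ _ (fun x => 1 + u x ^+ 2)) => //.
- exact: measurable_funS mu1.
- apply: intgD => //; last exact: intgS iu.
  by apply: (intgS (measurable_itv `[0, r])) => //; [exact: subset_itv_oc_cc|
    apply/intg_cont/continuous_subspaceT => z; exact: cvg_cst].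
- move=> x _; have := ler_norm_mul_sqr 1 (u x).
  by rewrite mul1r expr1n.
Qed.

Lemma square_intg_locally u : square_intg u -> locally_intg u.
Proof.
move=> hu x y x0 xy; apply: intgS (square_intg_itv hu (lt_le_trans x0 xy)) => //.
by apply: subset_itvr; rewrite bnd_simp.
Qed.

End integrals_near_zero.

(** * The radial system and its boundary data *)

Section radial_system.
Context {R : realType}.
Local Notation mu := (@lebesgue_measure R).
Local Notation intg D f := (mu.-integrable D (EFin \o f)).

(** Let [M] be the matrix with rows [(-kap, -q)] and [(p, kap)], so that
    [M^2 = d I]. The system [u' = (M / r) u + F] has the fundamental matrix
    [r^M = a r I + b r M], and [(r / s)^M] has the coefficients
    [a r * a s - d * (b r * b s)] and [b r * a s - a r * b s]. The exponent
    [sigma], which controls the size of [(r / s)^M], lies below [1/2] so that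
    [r^M] is square-integrable near the origin. The powers of the case [d > 0]
    and the logarithm of the case [d = 0] share these properties. *)
Record propagator (p q kap d sigma C : R) (a b : R -> R) : Prop := Propagator {
  propagator_sqr : kap ^+ 2 - p * q = d;
  propagator_exponent : 0 <= sigma < 2^-1;
  propagator_da : forall r : R, 0 < r -> is_derive r 1 a (d * b r / r);
  propagator_db : forall r : R, 0 < r -> is_derive r 1 b (a r / r);
  propagator_det : forall r, 0 < r -> a r ^+ 2 - d * b r ^+ 2 = 1;
  propagator_a1 : a 1 = 1;
  propagator_b1 : b 1 = 0;
  propagator_bound_a : forall r s, 0 < s -> s <= r ->
    `|a r * a s - d * (b r * b s)| <= C * (r `^ sigma * s `^ (- sigma));
  propagator_bound_b : forall r s, 0 < s -> s <= r ->
    `|b r * a s - a r * b s| <= C * (r `^ sigma * s `^ (- sigma)) }.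

Variables (m p q kap d sigma C : R) (a b : R -> R).
Hypothesis prop : propagator p q kap d sigma C a b.
Implicit Types (up um gp gm vp vm lp lm f h : R -> R) (r s t x y : R).

(** The Dirac equation solved for the derivatives of the unknowns; the sources
    [gp] and [gm] change places because the derivatives stand off the
    diagonal. *)
Definition solves up um gp gm : Prop :=
  ac_primitive up (fun t => - (kap / t) * up t - q / t * um t + (m * um t + gm t)) /\
  ac_primitive um (fun t => p / t * up t + kap / t * um t + (m * up t - gp t)).

(** The components of [r^M (x, y)]; [pullp] and [pullm] are those of
    [r^(-M) (x, y)]. *)
Definition flowp x y r := a r * x + b r * (- kap * x - q * y).
Definition flowm x y r := a r * y + b r * (p * x + kap * y).
Definition pullp x y r := a r * x - b r * (- kap * x - q * y).
Definition pullm x y r := a r * y - b r * (p * x + kap * y).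

(** The limit at the origin of [r^(-M) u(r)]. *)
Definition boundary_data up um x y : Prop :=
  (pullp (up r) (um r) r @[r --> 0^'+] --> x) /\
  (pullm (up r) (um r) r @[r --> 0^'+] --> y).

Let da := propagator_da prop.
Let db := propagator_db prop.
Let dE := propagator_sqr prop.
Let sig1 : sigma < 2^-1. Proof. by have /andP[] := propagator_exponent prop. Qed.
Let sig2 : 2 * sigma < 1. Proof. by have := sig1; lra. Qed.

Lemma propagator_cont r : 0 < r -> {for r, continuous a} /\ {for r, continuous b}.
Proof.
move=> r0; have [ha _] := da r0; have [hb _] := db r0.
by split; exact/differentiable_continuous/derivable1_diffP.
Qed.

Lemma propagator_ac : ac_primitive a (fun r => d * b r / r) /\
  ac_primitive b (fun r => a r / r).
Proof.
have cinv r : 0 < r -> {for r, continuous (fun x : R => x^-1)}.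
  by move=> r0; apply: inv_continuous; rewrite gt_eqF.
split; apply: ac_primitive_C1 => // r r0.
  apply: cvgM; last exact: cinv.
  by apply: cvgM; [exact: cvg_cst|exact: (propagator_cont r0).2].
by apply: cvgM; [exact: (propagator_cont r0).1|exact: cinv].
Qed.

Lemma propagator_bounds s : 0 < s -> s <= 1 ->
  `|a s| <= C * s `^ (- sigma) /\ `|b s| <= C * s `^ (- sigma).
Proof.
move=> s0 s1; have := propagator_bound_a prop s0 s1.
have := propagator_bound_b prop s0 s1.
rewrite (propagator_a1 prop) (propagator_b1 prop) powR1 !mul1r !mul0r mulr0 sub0r subr0.
by rewrite normrN.
Qed.

Let C0 : 0 <= C.
Proof.
have [h _] := @propagator_bounds 1 ltr01 (lexx 1).
by move: h; rewrite powR1 mulr1; exact: le_trans.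
Qed.

Lemma pull_flow x y r : 0 < r ->
  pullp (flowp x y r) (flowm x y r) r = x /\ pullm (flowp x y r) (flowm x y r) r = y.
Proof.
move=> r0; have h := propagator_det prop r0; rewrite /pullp /pullm /flowp /flowm.
by split; [rewrite -[RHS]mul1r -h -dE; ring|rewrite -[RHS]mul1r -h -dE; ring].
Qed.

Lemma flow_pull x y r : 0 < r ->
  flowp (pullp x y r) (pullm x y r) r = x /\ flowm (pullp x y r) (pullm x y r) r = y.
Proof.
move=> r0; have h := propagator_det prop r0; rewrite /pullp /pullm /flowp /flowm.
by split; [rewrite -[RHS]mul1r -h -dE; ring|rewrite -[RHS]mul1r -h -dE; ring].
Qed.

(** [r^(-M)] has determinant [a^2 - d b^2 = 1]. *)
Lemma pull_area x y x' y' r : 0 < r ->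
  pullp x y r * pullm x' y' r - pullm x y r * pullp x' y' r = x * y' - y * x'.
Proof.
move=> r0; have h := propagator_det prop r0; rewrite /pullp /pullm.
by rewrite -[RHS]mul1r -h -dE; ring.
Qed.

(** Variation of constants: [r^(-M) u] has the derivative [r^(-M) F], free of
    [u]. *)
Lemma solves_pull up um gp gm : solves up um gp gm ->
  ac_primitive (fun r => pullp (up r) (um r) r)
    (fun r => pullp (m * um r + gm r) (m * up r - gp r) r) /\
  ac_primitive (fun r => pullm (up r) (um r) r)
    (fun r => pullm (m * um r + gm r) (m * up r - gp r) r).
Proof.
move=> [Hp Hm]; have [ha hb] := propagator_ac; split.
  have h1 := ac_primitiveM ha Hp.
  have h2 := ac_primitiveM hb
    (ac_primitiveD (ac_primitiveZ (- kap) Hp) (ac_primitiveZ (- q) Hm)).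
  apply: ac_primitive_eq (ac_primitiveD h1 (ac_primitiveZ (-1) h2)) => r r0.
    by rewrite /pullp /=; ring.
  by rewrite /pullp /= -dE; field; exact: lt0r_neq0.
have h1 := ac_primitiveM ha Hm.
have h2 := ac_primitiveM hb (ac_primitiveD (ac_primitiveZ p Hp) (ac_primitiveZ kap Hm)).
apply: ac_primitive_eq (ac_primitiveD h1 (ac_primitiveZ (-1) h2)) => r r0.
  by rewrite /pullm /=; ring.
by rewrite /pullm /= -dE; field; exact: lt0r_neq0.
Qed.

Lemma powR_opp_sqr t : 0 < t -> t `^ (- sigma) ^+ 2 = t `^ (- (2 * sigma)).
Proof.
move=> t0; rewrite expr2 -powRD; first by congr (_ `^ _); ring.
by rewrite (gt_eqF t0) implybT.
Qed.

(** Both factors are square-integrable near the origin, as [2 * sigma < 1]. *)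
Lemma intg_weighted f r : 0 < r -> square_intg f ->
  intg `]0, r] (fun t => t `^ (- sigma) * f t).
Proof.
move=> r0 [mf if_]; have mh := @measurable_halfline R.
have sub := @itvoc_halfline R r.
have [i2 _] := intg_powR_near0 sig2 r0.
apply: (@intg_le _ _ _ (fun t => t `^ (- (2 * sigma)) + f t ^+ 2)) => //.
- apply: measurable_funM; last exact: measurable_funS mf.
  by apply: measurable_funS (measurable_powR_halfline (- sigma)).
- by apply: intgD => //; exact: intgS if_.
- move=> t; rewrite /= in_itv/= => /andP[t0 _].
  by rewrite -powR_opp_sqr//; exact: ler_norm_mul_sqr.
Qed.

Lemma intg_bounded_weight f h (K : R) : square_intg f -> measurable_fun (halfline R) h ->
  (forall t, 0 < t -> t <= 1 -> `|h t| <= K * t `^ (- sigma)) ->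
  intg `]0, 1] (h \* f).
Proof.
move=> sf mh hK; have sub := @itvoc_halfline R 1.
have mhl := @measurable_halfline R.
apply: (@intg_le _ _ _ (fun t => K * `|t `^ (- sigma) * f t|)) => //.
- by apply: measurable_funM; [exact: measurable_funS mh|exact: measurable_funS sf.1].
- by apply: intgZ => //; apply: intg_norm => //; exact: intg_weighted.
- move=> t; rewrite /= in_itv/= => /andP[t0 t1].
  by rewrite !normrM mulrA ler_wpM2r// (ger0_norm (powR_ge0 _ _)) hK.
Qed.

Lemma measurable_propagator : measurable_fun (halfline R) a /\ measurable_fun (halfline R) b.
Proof.
by split; apply: continuous_halfline_measurable => r r0;
  [exact: (propagator_cont r0).1|exact: (propagator_cont r0).2].
Qed.

Lemma intg_pull f h : square_intg f -> square_intg h ->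
  intg `]0, 1] (fun r => pullp (f r) (h r) r) /\
  intg `]0, 1] (fun r => pullm (f r) (h r) r).
Proof.
move=> sf sh; have [ma mb] := measurable_propagator.
have bnd_a k : square_intg k -> intg `]0, 1] (a \* k).
  by move=> sk; apply: (@intg_bounded_weight _ _ C) => // t t0 t1;
    have [] := propagator_bounds t0 t1.
have bnd_b k : square_intg k -> intg `]0, 1] (b \* k).
  by move=> sk; apply: (@intg_bounded_weight _ _ C) => // t t0 t1;
    have [] := propagator_bounds t0 t1.
split.
  have := intgB (measurable_itv _) (bnd_a _ sf)
    (bnd_b _ (square_intgD (square_intgZ (- kap) sf) (square_intgZ (- q) sh))).
  by apply: intg_eq => // r _; rewrite /pullp /=; ring.
have := intgB (measurable_itv _) (bnd_a _ sh)
  (bnd_b _ (square_intgD (square_intgZ p sf) (square_intgZ kap sh))).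
by apply: intg_eq => // r _; rewrite /pullm /=; ring.
Qed.

Definition forcep um gm r := m * um r + gm r.
Definition forcem up gp r := m * up r - gp r.

Lemma square_intg_force up um gp gm : square_intg up -> square_intg um ->
  square_intg gp -> square_intg gm ->
  square_intg (forcep um gm) /\ square_intg (forcem up gp).
Proof.
move=> sup sum sgp sgm; split.
  exact: (square_intgD (square_intgZ m sum) sgm).
have := square_intgD (square_intgZ m sup) (square_intgZ (-1) sgp).
by congr square_intg; apply/funext => r; rewrite /forcem /=; ring.
Qed.

(** Near the origin both [r^(-M)] and the source [F] are square-integrable, so
    that the derivative of [r^(-M) u] is integrable up to the origin. *)
Lemma boundary_data_exists up um gp gm : solves up um gp gm ->
  square_intg up -> square_intg um -> square_intg gp -> square_intg gm ->
  exists x y, [/\ boundary_data up um x y,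
    forall r, 0 < r -> r <= 1 -> pullp (up r) (um r) r =
      x + \int[mu]_(t in `]0, r]) pullp (forcep um gm t) (forcem up gp t) t &
    forall r, 0 < r -> r <= 1 -> pullm (up r) (um r) r =
      y + \int[mu]_(t in `]0, r]) pullm (forcep um gm t) (forcem up gp t) t].
Proof.
move=> Hs sup sum sgp sgm; have [hp hm] := solves_pull Hs.
have [sfp sfm] := square_intg_force sup sum sgp sgm.
have [ip im] := intg_pull sfp sfm.
have [x [xE xl]] := ac_primitive_at0 hp ip.
have [y [yE yl]] := ac_primitive_at0 hm im.
by exists x, y.
Qed.

(** * Asymptotics at the origin *)

Lemma cvg0Z (F : set_system R) (FF : Filter F) (c : R) (f : R -> R) :
  f r @[r --> F] --> (0 : R) -> (c * f r) @[r --> F] --> (0 : R).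
Proof. by move=> h; rewrite -[X in _ --> X](mulr0 c); exact: cvgMr. Qed.

Lemma cvg0D (F : set_system R) (FF : Filter F) (f g : R -> R) :
  f r @[r --> F] --> (0 : R) -> g r @[r --> F] --> (0 : R) ->
  (f r + g r) @[r --> F] --> (0 : R).
Proof. by move=> h k; rewrite -[X in _ --> X](addr0 0); exact: cvgD. Qed.

Lemma cvg0_squeeze (F : set_system R) (FF : ProperFilter F) (f g : R -> R) :
  (\forall r \near F, `|f r| <= g r) -> g r @[r --> F] --> (0 : R) ->
  f r @[r --> F] --> (0 : R).
Proof.
move=> fg g0; apply/norm_cvg0P; apply: squeeze_cvgr g0; last exact: cvg_cst.
by apply: filterS fg => r ->; rewrite normr_ge0.
Qed.

Lemma young_weighted (l x y : R) : 0 < l -> 0 <= x -> 0 <= y ->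
  x * y <= l * x ^+ 2 + l^-1 * y ^+ 2.
Proof.
move=> l0 x0 y0; rewrite -(ler_pM2l l0) mulrDr (mulrA _ l^-1) divff ?gt_eqF// mul1r.
have lxy : 0 <= l * (x * y) by rewrite mulr_ge0 ?mulr_ge0// ltW.
have e : (l * x - y) ^+ 2 = l * (l * x ^+ 2) + y ^+ 2 - 2 * (l * (x * y)) by ring.
by have := sqr_ge0 (l * x - y); rewrite e; lra.
Qed.

(** By the Cauchy-Schwarz inequality the integral is at most
    [O(r^(1/2 - sigma))] times the norm of [f] on [[0, r]], which tends to zero.
    The inequality is applied in the form of a weighted Young inequality, with
    the weight [l] proportional to [r^(sigma - 1/2)] so that both terms have
    the same order. *)
Lemma Rintegral_weighted_littleo f : square_intg f ->
  (r `^ (sigma - 2^-1) * \int[mu]_(t in `]0, r]) (t `^ (- sigma) * `|f t|))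
    @[r --> 0^'+] --> 0.
Proof.
move=> sf; have mhl := @measurable_halfline R.
have if1 : intg `]0, 1] (fun t => f t ^+ 2).
  by apply: intgS sf.2 => //; exact: itvoc_halfline.
have Phi0 := Rintegral_near0_cvg if1.
set K := (1 - 2 * sigma)^-1.
have K0 : 0 < K by rewrite invr_gt0 subr_gt0.
apply/cvgr0Pnorm_le => eta eta0.
(* With this choice both terms of Young's inequality end up as [eta / 2]. *)
pose e := eta / (2 * K).
have e0 : 0 < e by rewrite divr_gt0// mulr_gt0.
have ee : 0 < e * (eta / 2) by rewrite mulr_gt0// divr_gt0.
near=> r.
have r0 : 0 < r by near: r; exact: nbhs_right_gt.
have r1 : r <= 1 by near: r; exact: nbhs_right_le.
have sub := @itvoc_halfline R r.
have ifr : intg `]0, r] (fun t => f t ^+ 2) by exact: intgS sf.2.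
have [i2 b2] := intg_powR_near0 sig2 r0.
have Phir : \int[mu]_(t in `]0, r]) f t ^+ 2 <= e * (eta / 2).
  rewrite (le_trans (ler_norm _))//; near: r.
  by have /cvgr0Pnorm_le := Phi0; apply.
pose w := r `^ (sigma - 2^-1).
have w0 : 0 < w by rewrite powR_gt0.
pose l := e * w.
have l0 : 0 < l by rewrite mulr_gt0.
have iw := intg_norm (measurable_itv `]0, r]) (intg_weighted r0 sf).
have bound : \int[mu]_(t in `]0, r]) (t `^ (- sigma) * `|f t|) <=
    l * (K * r `^ (1 - 2 * sigma)) + l^-1 * (e * (eta / 2)).
  apply: (@le_trans _ _ (\int[mu]_(t in `]0, r])
      (l * t `^ (- (2 * sigma)) + l^-1 * f t ^+ 2))).
    apply: le_Rintegral => //.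
    + by apply: intg_eq iw => // t _ /=; rewrite normrM ger0_norm ?powR_ge0.
    + by apply: intgD => //; apply: intgZ.
    + move=> t; rewrite /= in_itv/= => /andP[t0 _].
      rewrite -powR_opp_sqr// -(real_normK (num_real (f t))).
      by apply: young_weighted => //; exact: powR_ge0.
  rewrite RintegralD//; [|exact: intgZ|exact: intgZ].
  rewrite !RintegralZl// lerD// ler_wpM2l ?(ltW l0)//.
  by rewrite invr_ge0 ltW.
rewrite ger0_norm; last first.
  by rewrite mulr_ge0 ?powR_ge0//; apply: Rintegral_ge0 => t _; rewrite mulr_ge0 ?powR_ge0.
apply: (le_trans (ler_wpM2l (ltW w0) bound)).
have ww : w * w * r `^ (1 - 2 * sigma) = 1.
  rewrite /w -!powRD ?(gt_eqF r0) ?implybT//.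
  rewrite (_ : _ + _ = 0) ?powRr0//; by field.
rewrite mulrDr (_ : w * (l * _) = e * K * (w * w * r `^ (1 - 2 * sigma))); last first.
  by rewrite /l; ring.
rewrite ww mulr1 (_ : w * (l^-1 * _) = eta / 2); last first.
  by rewrite /l; field; rewrite ?gt_eqF.
rewrite (_ : e * K = eta / 2); last by rewrite /e; field; rewrite gt_eqF.
by lra.
Unshelve. all: by end_near. Qed.

(** Pulling back at [t] and flowing to [r] is the map [(r / t)^M]. *)
Lemma pull_bound (f h : R) r t : 0 < t -> t <= r ->
  `|flowp (pullp f h t) (pullm f h t) r| <=
    C * (r `^ sigma * t `^ (- sigma)) * ((1 + `|kap|) * `|f| + `|q| * `|h|) /\
  `|flowm (pullp f h t) (pullm f h t) r| <=
    C * (r `^ sigma * t `^ (- sigma)) * (`|p| * `|f| + (1 + `|kap|) * `|h|).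
Proof.
move=> t0 tr; have := propagator_bound_a prop t0 tr.
have := propagator_bound_b prop t0 tr.
set be := b r * a t - _; set al := a r * a t - _; set W := C * _ => hb ha.
have W0 : 0 <= W by rewrite !mulr_ge0 ?powR_ge0.
have -> : flowp (pullp f h t) (pullm f h t) r = al * f + be * (- kap * f - q * h).
  by rewrite /flowp /pullp /pullm /al /be -dE; ring.
have -> : flowm (pullp f h t) (pullm f h t) r = al * h + be * (p * f + kap * h).
  by rewrite /flowm /pullp /pullm /al /be -dE; ring.
have E (x y : R) : `|x| <= W -> `|x * y| <= W * `|y|.
  by move=> xW; rewrite normrM ler_wpM2r.
split; apply: (le_trans (ler_normD _ _)).
  rewrite (_ : W * (_ + _) = W * `|f| + W * (`|kap| * `|f| + `|q| * `|h|)); last by ring.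
  rewrite lerD ?E//.
  rewrite (le_trans (E _ _ hb))// ler_wpM2l// (le_trans (ler_normB _ _))//.
  by rewrite !normrM normrN.
rewrite (_ : W * (_ + _) = W * `|h| + W * (`|p| * `|f| + `|kap| * `|h|)); last by ring.
rewrite lerD ?E//.
rewrite (le_trans (E _ _ hb))// ler_wpM2l// (le_trans (ler_normD _ _))//.
by rewrite !normrM.
Qed.

Definition asymptotic up um x y : Prop :=
  ((up r - flowp x y r) * r `^ (- 2^-1) @[r --> 0^'+] --> 0) /\
  ((um r - flowm x y r) * r `^ (- 2^-1) @[r --> 0^'+] --> 0).

Lemma weighted_bound_littleo (g F G : R -> R) (K L : R) :
  square_intg F -> square_intg G ->
  (forall r, 0 < r -> r <= 1 -> `|g r| <= \int[mu]_(t in `]0, r])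
     (r `^ sigma * (t `^ (- sigma) * (K * `|F t| + L * `|G t|)))) ->
  (g r * r `^ (- 2^-1)) @[r --> 0^'+] --> 0.
Proof.
move=> sF sG gle.
have cF := Rintegral_weighted_littleo sF; have cG := Rintegral_weighted_littleo sG.
have H : (K * (r `^ (sigma - 2^-1) * \int[mu]_(t in `]0, r]) (t `^ (- sigma) * `|F t|)) +
  L * (r `^ (sigma - 2^-1) * \int[mu]_(t in `]0, r]) (t `^ (- sigma) * `|G t|)))
    @[r --> 0^'+] --> 0.
  by apply: cvg0D; exact: cvg0Z.
apply: cvg0_squeeze H; near=> r.
have r0 : 0 < r by near: r; exact: nbhs_right_gt.
have r1 : r <= 1 by near: r; exact: nbhs_right_le.
rewrite normrM (ger0_norm (powR_ge0 _ _)).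
apply: (le_trans (ler_wpM2r (powR_ge0 _ _) (gle r r0 r1))).
have iw k : square_intg k -> intg `]0, r] (fun t => t `^ (- sigma) * `|k t|).
  move=> sk; apply: intg_eq (intg_norm (measurable_itv _) (intg_weighted r0 sk)) => //.
  by move=> t _; rewrite normrM ger0_norm ?powR_ge0.
rewrite (@eq_Rintegral _ _ _ mu _ (fun t => r `^ sigma * K * (t `^ (- sigma) * `|F t|)
   + r `^ sigma * L * (t `^ (- sigma) * `|G t|))); last by move=> t _; ring.
rewrite RintegralD//; [|by apply: intgZ => //; exact: iw..].
rewrite !RintegralZl//; [|exact: iw..].
rewrite powRD ?(gt_eqF r0) ?implybT// le_eqVlt; apply/orP; left; apply/eqP; ring.
Unshelve. all: by end_near. Qed.

(** For a fixed [r] the flow is linear with constant coefficients, hence commutes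
    with the integral. *)
Lemma Rintegral_flow f h r : 0 < r -> r <= 1 -> square_intg f -> square_intg h ->
  let X := \int[mu]_(t in `]0, r]) pullp (f t) (h t) t in
  let Y := \int[mu]_(t in `]0, r]) pullm (f t) (h t) t in
  [/\ intg `]0, r] (fun t => flowp (pullp (f t) (h t) t) (pullm (f t) (h t) t) r),
   flowp X Y r = \int[mu]_(t in `]0, r]) flowp (pullp (f t) (h t) t) (pullm (f t) (h t) t) r,
   intg `]0, r] (fun t => flowm (pullp (f t) (h t) t) (pullm (f t) (h t) t) r) &
   flowm X Y r = \int[mu]_(t in `]0, r]) flowm (pullp (f t) (h t) t) (pullm (f t) (h t) t) r].
Proof.
move=> r0 r1 sf sh X Y.
have [ip im] := intg_pull sf sh.
have sub : `]0, r] `<=` `]0, 1] by apply: subset_itvl; rewrite bnd_simp.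
have {}ip : intg `]0, r] (fun t => pullp (f t) (h t) t) by apply: intgS ip.
have {}im : intg `]0, r] (fun t => pullm (f t) (h t) t) by apply: intgS im.
have mr := measurable_itv (`]0, r] : interval R).
have lin k l : [/\ intg `]0, r] (fun t => k * pullp (f t) (h t) t + l * pullm (f t) (h t) t) &
   k * X + l * Y = \int[mu]_(t in `]0, r]) (k * pullp (f t) (h t) t + l * pullm (f t) (h t) t)].
  split; first exact: (intgD mr (intgZ k mr ip) (intgZ l mr im)).
  rewrite RintegralD//; [|exact: intgZ|exact: intgZ].
  by rewrite !RintegralZl.
have [i1 e1] := lin (a r - b r * kap) (- b r * q).
have [i2 e2] := lin (b r * p) (a r + b r * kap).
split.
- by apply: intg_eq i1 => // t _; rewrite /flowp; ring.
- transitivity ((a r - b r * kap) * X + - b r * q * Y); first by rewrite /flowp; ring.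
  by rewrite e1; apply: eq_Rintegral => t _; rewrite /flowp; ring.
- by apply: intg_eq i2 => // t _; rewrite /flowm; ring.
- transitivity (b r * p * X + (a r + b r * kap) * Y); first by rewrite /flowm; ring.
  by rewrite e2; apply: eq_Rintegral => t _; rewrite /flowm; ring.
Qed.

Lemma boundary_data_unique up um x y x' y' :
  boundary_data up um x y -> boundary_data up um x' y' -> x = x' /\ y = y'.
Proof.
by move=> [h1 h2] [h3 h4]; split; [apply: cvg_unique h1 h3|apply: cvg_unique h2 h4];
  exact: Rhausdorff.
Qed.

(** By variation of constants [u(r) - r^M (x, y)] is the integral of
    [(r / t)^M F(t)] over [t] in [[0, r]]. *)
Lemma boundary_data_asymptotic up um gp gm x y : solves up um gp gm ->
  square_intg up -> square_intg um -> square_intg gp -> square_intg gm ->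
  boundary_data up um x y -> asymptotic up um x y.
Proof.
move=> Hs sup sum sgp sgm bd.
have [x' [y' [bd' Ep Em]]] := boundary_data_exists Hs sup sum sgp sgm.
have [xx yy] := boundary_data_unique bd bd'; rewrite -{}xx -{}yy in bd' Ep Em.
have [sfp sfm] := square_intg_force sup sum sgp sgm.
have D r : 0 < r -> r <= 1 ->
    let X := \int[mu]_(t in `]0, r]) pullp (forcep um gm t) (forcem up gp t) t in
    let Y := \int[mu]_(t in `]0, r]) pullm (forcep um gm t) (forcem up gp t) t in
    up r - flowp x y r = flowp X Y r /\ um r - flowm x y r = flowm X Y r.
  move=> r0 r1 X Y; have := flow_pull (up r) (um r) r0.
  rewrite Ep// Em// -/X -/Y => -[f1 f2].
  by rewrite -f1 -f2; split; rewrite /flowp /flowm; ring.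
have wint (K L r : R) : 0 < r -> intg `]0, r] (fun t => r `^ sigma *
    (t `^ (- sigma) * (K * `|forcep um gm t| + L * `|forcem up gp t|))).
  move=> r0; have mr := measurable_itv (`]0, r] : interval R).
  have i1 := intg_norm mr (intg_weighted r0 sfp).
  have i2 := intg_norm mr (intg_weighted r0 sfm).
  apply: (intgZ (r `^ sigma) mr).
  apply: intg_eq (intgD mr (intgZ K mr i1) (intgZ L mr i2)) => // t _ /=.
  by rewrite !normrM (ger0_norm (powR_ge0 _ _)); ring.
split.
- apply: (@weighted_bound_littleo _ (forcep um gm) (forcem up gp)
    (C * (1 + `|kap|)) (C * `|q|)) => // r r0 r1.
  have [-> _] := D r r0 r1; have [i1 -> _ _] := Rintegral_flow r0 r1 sfp sfm.
  apply: (le_trans (le_normr_Rintegral _ i1)) => //.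
  apply: le_Rintegral => //; [exact: intg_norm|exact: wint|].
  move=> t; rewrite /= in_itv/= => /andP[t0 tr].
  have [+ _] := pull_bound (forcep um gm t) (forcem up gp t) t0 tr.
  by move/le_trans; apply; rewrite le_eqVlt; apply/orP; left; apply/eqP; ring.
- apply: (@weighted_bound_littleo _ (forcep um gm) (forcem up gp)
    (C * `|p|) (C * (1 + `|kap|))) => // r r0 r1.
  have [_ ->] := D r r0 r1; have [_ _ i1 ->] := Rintegral_flow r0 r1 sfp sfm.
  apply: (le_trans (le_normr_Rintegral _ i1)) => //.
  apply: le_Rintegral => //; [exact: intg_norm|exact: wint|].
  move=> t; rewrite /= in_itv/= => /andP[t0 tr].
  have [_ +] := pull_bound (forcep um gm t) (forcem up gp t) t0 tr.
  by move/le_trans; apply; rewrite le_eqVlt; apply/orP; left; apply/eqP; ring.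
Qed.

(** [r^(-M) = O(r^(-sigma))] with [sigma < 1/2] turns a remainder [o(r^(1/2))]
    into [o(1)]. *)
Lemma asymptotic_boundary_data up um x y :
  asymptotic up um x y -> boundary_data up um x y.
Proof.
move=> [hp hm].
have small (k g : R -> R) : (forall s, 0 < s -> s <= 1 -> `|k s| <= C * s `^ (- sigma)) ->
    (g r * r `^ (- 2^-1)) @[r --> 0^'+] --> (0 : R) ->
    (k r * g r) @[r --> 0^'+] --> (0 : R).
  move=> kb g0.
  have H : (C * `|g r * r `^ (- 2^-1)|) @[r --> 0^'+] --> (0 : R).
    by apply: cvg0Z; exact/norm_cvg0P.
  apply: cvg0_squeeze H; near=> r.
  have r0 : 0 < r by near: r; exact: nbhs_right_gt.
  have r1 : r <= 1 by near: r; exact: nbhs_right_le.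
  rewrite !normrM (mulrC `|g r|) mulrA ler_wpM2r//.
  rewrite (le_trans (kb r r0 r1))// ler_wpM2l// ger0_norm ?powR_ge0//.
  apply: ger_powR; first by rewrite r0.
  by have := sig1; lra.
have bnda s : 0 < s -> s <= 1 -> `|a s| <= C * s `^ (- sigma).
  by move=> s0 s1; have [] := propagator_bounds s0 s1.
have bndb s : 0 < s -> s <= 1 -> `|b s| <= C * s `^ (- sigma).
  by move=> s0 s1; have [] := propagator_bounds s0 s1.
have ap := small a _ bnda hp.
have bp := small b _ bndb hp.
have am := small a _ bnda hm.
have bm := small b _ bndb hm.
split.
- have H : (x + (a r * (up r - flowp x y r) + kap * (b r * (up r - flowp x y r)) +
     q * (b r * (um r - flowm x y r)))) @[r --> 0^'+] --> x.
    rewrite -[X in _ --> X]addr0; apply: cvgD; first exact: cvg_cst.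
    by apply: cvg0D; [apply: cvg0D => //|]; exact: cvg0Z.
  apply: cvg_trans H; apply: near_eq_cvg; near=> r.
  have r0 : 0 < r by near: r; exact: nbhs_right_gt.
  have [e _] := pull_flow x y r0.
  by rewrite -{1}e /pullp; ring.
- have H : (y + (a r * (um r - flowm x y r) + - p * (b r * (up r - flowp x y r)) +
     - kap * (b r * (um r - flowm x y r)))) @[r --> 0^'+] --> y.
    rewrite -[X in _ --> X]addr0; apply: cvgD; first exact: cvg_cst.
    by apply: cvg0D; [apply: cvg0D => //|]; exact: cvg0Z.
  apply: cvg_trans H; apply: near_eq_cvg; near=> r.
  have r0 : 0 < r by near: r; exact: nbhs_right_gt.
  have [_ e] := pull_flow x y r0.
  by rewrite -{1}e /pullm; ring.
Unshelve. all: by end_near. Qed.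

(** * Green's formula and prescribed boundary data *)

(** Nothing is known of [w] at infinity beyond integrability. The linear cut-off
    [1 - r / n] on [[1/n, n]] removes the boundary term there, and its derivative
    [-1/n] contributes nothing in the limit because [w] is integrable. *)
Lemma Rintegral_halfline_derivative w W (l : R) : ac_primitive w W ->
  intg (halfline R) w -> intg (halfline R) W -> w r @[r --> 0^'+] --> l ->
  \int[mu]_(r in halfline R) W r = - l.
Proof.
move=> Hw iw iW wl.
pose x (n : nat) : R := n.+1%:R^-1; pose y (n : nat) : R := n.+1%:R.
have x0 n : 0 < x n by rewrite invr_gt0.
have y0 n : 0 < y n by [].
have y1 n : 1 <= y n by rewrite ler1n.
have x1 n : x n <= 1 by rewrite /x invf_le1 ?y0 //; exact: y1.
have xy n : x n <= y n by rewrite (le_trans (x1 n)).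
pose aff n t : R := - x n * t + 1.
have Haff n : ac_primitive (aff n) (fun=> - x n).
  apply: ac_primitive_C1 => r _; first exact: is_derive_affine.
  exact: cvg_cst.
pose g n t := W t * aff n t + w t * - x n.
pose f n t := \1_(`[x n, y n]) t * g n t.
have mh := @measurable_halfline R.
have If n : \int[mu]_(t in halfline R) f n t = - (w (x n) * aff n (x n)).
  have [_ /=] := ac_primitiveM Hw (Haff n) (x0 n) (xy n).
  have -> : aff n (y n) = 0 by rewrite /aff /x /y mulNr mulVf ?addNr.
  rewrite mulr0 sub0r => ->.
  transitivity (\int[mu]_(t in `[x n, y n]) f n t).
    apply: Rintegral_outside => //; first exact: itvcc_halfline.
    by move=> t _ txy; rewrite /f indicE memNset// mul0r.
  by apply: eq_Rintegral => t txy; rewrite /f indicE txy mul1r.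
have cvgx : x n @[n --> \oo] --> (0 : R) by exact: cvg_harmonic.
have affc t : aff n t @[n --> \oo] --> (1 : R).
  rewrite -[X in _ --> X]add0r; apply: cvgD; last exact: cvg_cst.
  rewrite -(mul0r t); apply: cvgMl; rewrite -oppr0; exact: cvgN.
have L1 : (\int[mu]_(t in halfline R) f n t) @[n --> \oo] --> \int[mu]_(t in halfline R) W t.
  apply: (@Rintegral_dominated _ _ _ _ (fun t => `|W t| + `|w t|)) => //.
  - move=> n; apply: measurable_funM; first exact: measurable_indic.
    apply: measurable_funD; apply: measurable_funM => //; try exact: intg_measurable.
    by apply: measurable_funTS; apply: measurable_funD => //; exact: measurable_funM.
  - exact: intg_measurable.
  - by apply: intgD => //; exact: intg_norm.
  - move=> t; rewrite /halfline /= in_itv/= andbT => t0.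
    have gc : g n t @[n --> \oo] --> W t.
      rewrite -[X in _ --> X]addr0; apply: cvgD.
        by rewrite -[X in _ --> X]mulr1; apply: cvgMr.
      by rewrite -[X in _ --> X](mulr0 (w t)); apply: cvgMr; rewrite -oppr0; exact: cvgN.
    apply: cvg_trans gc; apply: near_eq_cvg; near=> n.
    rewrite /f indicE mem_set ?mul1r//= in_itv/=; apply/andP; split.
      by near: n; apply: (cvgr_le 0 cvgx).
    apply: (@le_trans _ _ n%:R); last by rewrite ler_nat.
    by near: n; exact: nbhs_infty_ger.
  - move=> n t _; rewrite /f indicE.
    case: (boolP (t \in _)) => [|_]; last by rewrite mul0r normr0 addr_ge0.
    rewrite mem_setE in_itv/= => /andP[xt ty]; rewrite mul1r.
    rewrite (le_trans (ler_normD _ _))// lerD//.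
      rewrite normrM ler_piMr// ger0_norm; rewrite /aff ?mulNr.
        by rewrite gerDr oppr_le0 mulr_ge0 ?ltW// (lt_le_trans (x0 n)).
      rewrite addrC subr_ge0 (le_trans (ler_wpM2l (ltW (x0 n)) ty))//.
      by rewrite /x /y mulVf.
    by rewrite normrM normrN ler_piMr// ger0_norm// ltW.
have L2 : (- (w (x n) * aff n (x n))) @[n --> \oo] --> - l.
  apply: cvgN; rewrite -[X in _ --> X]mulr1; apply: cvgM.
    by move/cvg_at_rightP : wl; apply; split.
  rewrite -[X in _ --> X]add0r; apply: cvgD; last exact: cvg_cst.
  rewrite -(mul0r 0); apply: cvgM => //; rewrite -oppr0; exact: cvgN.
rewrite (_ : (fun n => _) = (fun n => - (w (x n) * aff n (x n)))) in L1; last first.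
  by apply/funext => n; rewrite If.
by apply: cvg_unique L1 L2; exact: Rhausdorff.
Unshelve. all: by end_near. Qed.

(** The integrand is the derivative of [up * vm - um * vp], which is integrable as
    a combination of products of square-integrable functions. The
    area-preserving pull-back expresses its limit at the origin through the
    boundary data. *)
Lemma green up um gp gm vp vm lp lm x y x' y' :
  solves up um gp gm -> solves vp vm lp lm ->
  square_intg up -> square_intg um -> square_intg gp -> square_intg gm ->
  square_intg vp -> square_intg vm -> square_intg lp -> square_intg lm ->
  boundary_data up um x y -> boundary_data vp vm x' y' ->
  \int[mu]_(r in halfline R)
     ((gp r * vp r + gm r * vm r) - (up r * lp r + um r * lm r)) =
  - (x * y' - y * x').
Proof.
move=> [Hup Hum] [Hvp Hvm] sup sum sgp sgm svp svm slp slm [bx by_] [bx' by'].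
have mh := @measurable_halfline R.
apply: (@Rintegral_halfline_derivative (fun r => up r * vm r - um r * vp r)).
- have h1 := ac_primitiveM Hup Hvm; have h2 := ac_primitiveM Hum Hvp.
  apply: ac_primitive_eq (ac_primitiveD h1 (ac_primitiveZ (-1) h2)) => r r0 /=.
    by ring.
  by field; exact: lt0r_neq0.
- exact: (intgB mh (square_intgM sup svm) (square_intgM sum svp)).
- exact: (intgB mh (intgD mh (square_intgM sgp svp) (square_intgM sgm svm))
    (intgD mh (square_intgM sup slp) (square_intgM sum slm))).
- have H : (pullp (up r) (um r) r * pullm (vp r) (vm r) r -
      pullm (up r) (um r) r * pullp (vp r) (vm r) r) @[r --> 0^'+] --> x * y' - y * x'.
    by apply: cvgB; apply: cvgM.
  apply: cvg_trans H; apply: near_eq_cvg; near=> r.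
  by rewrite /= pull_area//; near: r; exact: nbhs_right_gt.
Unshelve. all: by end_near. Qed.

Lemma square_intg_near0 f (K : R) : (forall r, 0 < r -> {for r, continuous f}) ->
  (forall r, 0 < r -> r <= 1 -> `|f r| <= K * r `^ (- sigma)) ->
  (forall r, 1 < r -> f r = 0) -> square_intg f.
Proof.
move=> cf fK f0; have mf := continuous_halfline_measurable cf; split=> //.
have [i2 _] := intg_powR_near0 sig2 ltr01.
have sub := @itvoc_halfline R 1.
have mh := @measurable_halfline R.
apply: (@intg_outside _ _ `]0, 1]) => //.
  move=> r; rewrite /halfline /= !in_itv/= andbT => r0 /negP.
  by rewrite r0/= -ltNge => /f0 ->; rewrite expr0n.
apply: (@intg_le _ _ _ (fun r => K ^+ 2 * r `^ (- (2 * sigma)))) => //.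
- by apply: (measurable_funX 2); exact: measurable_funS mf.
- exact: intgZ.
- move=> r; rewrite /= in_itv/= => /andP[r0 r1].
  rewrite -powR_opp_sqr// -exprMn normrX ler_pXn2r ?nnegrE//; first exact: fK.
  exact: le_trans (fK r r0 r1).
Qed.

(** Cutting the flow [r^M (x, y)] off smoothly does not change its datum, and the
    flow is square-integrable near the origin. *)
Lemma boundary_data_surjective x y : exists up um gp gm,
  [/\ solves up um gp gm, boundary_data up um x y &
  [/\ square_intg up, square_intg um, square_intg gp & square_intg gm]].
Proof.
set c := (flat 0 (1 : R))^-1.
have c0 : flat 0 (1 : R) != 0 by rewrite gt_eqF// flat_gt0.
(* This cut-off is smooth and equals 1 at the origin; near the origin it is not
   constant, which is harmless since only limits matter. *)
pose chi (r : R) := c * flat 0 (1 - r).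
pose dchi (r : R) := - (c * flat 2 (1 - r)).
have dchiP (r : R) : is_derive r 1 chi (dchi r).
  have H := is_derive_comp_affine (u := @flat R 0) (a := -1) (b := 1) (x := r).
  have {}H := H (@flat_smooth R 0 0%N _).
  have -> : chi = (fun y => c * flat 0 (-1 * y + 1)).
    by apply/funext => t; rewrite /chi mulN1r addrC.
  have {}H := @is_deriveZ _ _ _ _ c _ _ _ H.
  apply: (is_derive_eq H); rewrite /GRing.scale/= derive1E.
  have [_ ->] := is_derive_flat 0 (-1 * r + 1).
  by rewrite /dchi mulN1r (addrC _ 1) mul0r subr0; ring.
have flatc k r : {for r, continuous (fun t => flat k (1 - t) : R)}.
  apply: continuous_comp; last exact: (smooth_continuous (@flat_smooth R k)).
  by apply: cvgB; [exact: cvg_cst|exact: cvg_id].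
have cchi r : {for r, continuous chi} by apply: cvgM; [exact: cvg_cst|exact: flatc].
have cdchi r : {for r, continuous dchi}.
  by apply: cvgN; apply: cvgM; [exact: cvg_cst|exact: flatc].
have chi0 : chi 0 = 1 by rewrite /chi subr0 mulVf.
have cpos : 0 <= c by rewrite invr_ge0 flat_ge0.
have chib r : `|chi r| <= c.
  by rewrite normrM (ger0_norm cpos) ler_piMr// ger0_norm ?flat_ge0// (flat_bounded 0).
have dchib r : `|dchi r| <= 2 * c.
  by rewrite normrN normrM (ger0_norm cpos) mulrC ler_wpM2r// ger0_norm ?flat_ge0// (flat_bounded 2).
have chi1 r : 1 < r -> chi r = 0.
  by move=> r1; rewrite /chi flat_le0 ?mulr0// subr_le0 ltW.
have dchi1 r : 1 < r -> dchi r = 0.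
  by move=> r1; rewrite /dchi flat_le0 ?mulr0 ?oppr0// subr_le0 ltW.
(* The sources are what the system leaves once the flow has cancelled. *)
pose up r := chi r * flowp x y r; pose um r := chi r * flowm x y r.
pose gp r := m * up r - dchi r * flowm x y r.
pose gm r := dchi r * flowp x y r - m * um r.
have cflow r : 0 < r -> {for r, continuous (flowp x y)} /\ {for r, continuous (flowm x y)}.
  move=> r0; have [ca cb] := propagator_cont r0.
  by split; apply: cvgD; apply: cvgM => //; exact: cvg_cst.
have flowb : exists K, forall r, 0 < r -> r <= 1 ->
    `|flowp x y r| <= K * r `^ (- sigma) /\ `|flowm x y r| <= K * r `^ (- sigma).
  exists (C * (`|x| + `|- kap * x - q * y| + `|y| + `|p * x + kap * y|)) => r r0 r1.
  have [ba bb] := propagator_bounds r0 r1.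
  have E (z w : R) : `|a r * z + b r * w| <= C * (`|z| + `|w|) * r `^ (- sigma).
    rewrite (le_trans (ler_normD _ _))// !normrM mulrDr mulrDl.
    by rewrite lerD// (mulrAC C) ler_wpM2r.
  split; rewrite (le_trans (E _ _))// ler_wpM2r ?powR_ge0// ler_wpM2l//.
    by rewrite -[leRHS]addrA lerDl addr_ge0.
  by rewrite -(addrA _ `|y|) lerDr addr_ge0.
have [K HK] := flowb.
have K0 : 0 <= K.
  have [h _] := HK 1 ltr01 (lexx 1); move: h; rewrite powR1 mulr1.
  exact: le_trans.
have sq (h F : R -> R) (k : R) : (forall r, {for r, continuous h}) ->
    (forall r, `|h r| <= k) -> (forall r, 1 < r -> h r = 0) ->
    (forall r, 0 < r -> {for r, continuous F}) ->
    (forall r, 0 < r -> r <= 1 -> `|F r| <= K * r `^ (- sigma)) ->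
    square_intg (fun r => h r * F r).
  move=> ch hk h1 cF FK; apply: (@square_intg_near0 _ (k * K)).
  - by move=> r r0; apply: cvgM; [exact: ch|exact: cF].
  - by move=> r r0 r1; rewrite normrM -mulrA ler_pM// FK.
  - by move=> r r1; rewrite h1// mul0r.
have sup : square_intg up.
  by apply: (sq chi _ c) => // r r0; [exact: (cflow r r0).1|move=> r1; exact: (HK r r0 r1).1].
have sum : square_intg um.
  by apply: (sq chi _ c) => // r r0; [exact: (cflow r r0).2|move=> r1; exact: (HK r r0 r1).2].
have sdp : square_intg (fun r => dchi r * flowp x y r).
  by apply: (sq dchi _ (2 * c)) => // r r0; [exact: (cflow r r0).1|move=> r1; exact: (HK r r0 r1).1].
have sdm : square_intg (fun r => dchi r * flowm x y r).
  by apply: (sq dchi _ (2 * c)) => // r r0; [exact: (cflow r r0).2|move=> r1; exact: (HK r r0 r1).2].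
have dc : ac_primitive chi dchi by apply: ac_primitive_C1.
have [aca acb] := propagator_ac.
exists up, um, gp, gm; split; last first.
- split=> //.
  + have := square_intgD (square_intgZ m sup) (square_intgZ (-1) sdm).
    by congr square_intg; apply/funext => r; rewrite /gp /=; ring.
  + have := square_intgD sdp (square_intgZ (- m) sum).
    by congr square_intg; apply/funext => r; rewrite /gm /=; ring.
- have lim z : chi r * z @[r --> 0^'+] --> z.
    rewrite -[X in _ --> X]mul1r -chi0; apply: cvgMl.
    exact/cvg_at_right_filter/cchi.
  split; [apply: cvg_trans (lim x)|apply: cvg_trans (lim y)]; apply: near_eq_cvg; near=> r.
    have r0 : 0 < r by near: r; exact: nbhs_right_gt.
    by have [e _] := pull_flow x y r0; rewrite -{1}e /pullp /up /um; ring.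
  have r0 : 0 < r by near: r; exact: nbhs_right_gt.
  by have [_ e] := pull_flow x y r0; rewrite -{1}e /pullm /up /um; ring.
- have fp := ac_primitiveD (ac_primitiveZ x aca) (ac_primitiveZ (- kap * x - q * y) acb).
  have fm := ac_primitiveD (ac_primitiveZ y aca) (ac_primitiveZ (p * x + kap * y) acb).
  split.
  + apply: ac_primitive_eq (ac_primitiveM dc fp) => r r0 /=.
      by rewrite /up /flowp; ring.
    by rewrite /gm /up /um /flowp /flowm -dE; field; exact: lt0r_neq0.
  + apply: ac_primitive_eq (ac_primitiveM dc fm) => r r0 /=.
      by rewrite /um /flowm; ring.
    by rewrite /gp /up /um /flowp /flowm -dE; field; exact: lt0r_neq0.
Unshelve. all: by end_near. Qed.

End radial_system.

(** * Density of test functions *)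

Section density.
Context {R : realType}.
Implicit Types (u v w phi : R -> R) (x y : R).
Local Notation mu := (@lebesgue_measure R).
Local Notation intg D f := (mu.-integrable D (EFin \o f)).
Local Notation sqdist u v := (\int[mu]_(r in halfline R) (u r - v r) ^+ 2).

Definition approximable u := square_intg u /\
  forall e, 0 < e -> exists2 phi, real_test phi & sqdist u phi < e.

Lemma square_intgB u v : square_intg u -> square_intg v ->
  square_intg (fun r => u r - v r).
Proof.
move=> su sv; have := square_intgD su (square_intgZ (-1) sv).
by congr square_intg; apply/funext => r /=; ring.
Qed.

Lemma real_test_square_intg phi : real_test phi -> square_intg phi.
Proof.
move=> tphi; have cphi : continuous phi by apply: smooth_continuous; have [] := tphi.
split; first by apply: continuous_halfline_measurable => r _; exact: cphi.
have lphi : locally_intg phi.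
  by move=> x y x0 xy; apply/intg_cont/continuous_subspaceT.
have := locally_intg_test lphi tphi.
by apply: intg_eq; [exact: measurable_halfline|move=> r _ /=; rewrite expr2].
Qed.

Lemma sqdist_triangle u v w : square_intg u -> square_intg v -> square_intg w ->
  sqdist u w <= 2 * sqdist u v + 2 * sqdist v w.
Proof.
move=> su sv sw; have mh := @measurable_halfline R.
have i1 := (square_intgB su sv).2; have i2 := (square_intgB sv sw).2.
rewrite -!RintegralZl// -RintegralD//; [|exact: intgZ|exact: intgZ].
apply: le_Rintegral => //; first exact: (square_intgB su sw).2.
  by apply: intgD => //; exact: intgZ.
move=> r _; have := sqr_ge0 (u r - v r - (v r - w r)); nra.
Qed.

Lemma approximable_closed u : square_intg u ->
  (forall e, 0 < e -> exists2 v, approximable v & sqdist u v < e) ->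
  approximable u.
Proof.
move=> su H; split=> // e e0; have e4 : 0 < e / 4 by rewrite divr_gt0.
have [v [sv Hv] uv] := H _ e4; have [phi tphi vphi] := Hv _ e4.
exists phi => //.
rewrite (le_lt_trans (sqdist_triangle su sv (real_test_square_intg tphi)))//.
by move: uv vphi; set X := Rintegral _ _ _; set Y := Rintegral _ _ _; lra.
Qed.

Lemma approximableD u v : approximable u -> approximable v ->
  approximable (u \+ v).
Proof.
move=> [su Hu] [sv Hv]; split; first exact: square_intgD.
move=> e e0; have e4 : 0 < e / 4 by rewrite divr_gt0.
have [phi tphi uphi] := Hu _ e4; have [psi tpsi vpsi] := Hv _ e4.
exists (phi \+ psi); first exact: real_testD.
have mh := @measurable_halfline R.
have sphi := real_test_square_intg tphi; have spsi := real_test_square_intg tpsi.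
have i1 := (square_intgB su sphi).2; have i2 := (square_intgB sv spsi).2.
apply: (@le_lt_trans _ _ (2 * sqdist u phi + 2 * sqdist v psi)); last first.
  by move: uphi vpsi; set X := Rintegral _ _ _; set Y := Rintegral _ _ _; lra.
rewrite -!RintegralZl// -RintegralD//; [|exact: intgZ|exact: intgZ].
apply: le_Rintegral => //.
- exact: (square_intgB (square_intgD su sv) (square_intgD sphi spsi)).2.
- by apply: intgD => //; exact: intgZ.
- by move=> r _ /=; have := sqr_ge0 (u r - phi r - (v r - psi r)); nra.
Qed.

Lemma approximableZ (c : R) u : approximable u -> approximable (fun r => c * u r).
Proof.
move=> [su Hu]; split; first exact: square_intgZ.
move=> e e0; have c1 : 0 < c ^+ 2 + 1 by rewrite ltr_wpDl// sqr_ge0.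
have [phi tphi uphi] := Hu _ (divr_gt0 e0 c1).
exists (fun r => c * phi r); first exact: real_testZ.
have i1 := (square_intgB su (real_test_square_intg tphi)).2.
rewrite (@eq_Rintegral _ _ _ mu _ (fun r => c ^+ 2 * (u r - phi r) ^+ 2)); last first.
  by move=> r _; ring.
rewrite RintegralZl//; last exact: measurable_halfline.
have X0 : 0 <= sqdist u phi by apply: Rintegral_ge0 => r _; exact: sqr_ge0.
move: uphi; rewrite ltr_pdivlMr//; apply: le_lt_trans.
by rewrite mulrDr mulr1 mulrC lerDl.
Qed.

(** This closure property carries the approximation from bumps to indicators of
    intervals, of Borel sets, and on to all non-negative functions. *)
Lemma approximable_dominated (u_ : nat -> R -> R) u w :
  (forall n, approximable (u_ n)) -> measurable_fun (halfline R) u ->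
  square_intg w -> (forall n (r : R), 0 < r -> `|u_ n r| <= w r) ->
  (forall r : R, 0 < r -> u_ n r @[n --> \oo] --> u r) -> approximable u.
Proof.
move=> au mu_ sw uw uu; have mh := @measurable_halfline R.
have pos r : halfline R r -> 0 < r by rewrite /halfline /= in_itv/= andbT.
have uw' r : 0 < r -> `|u r| <= w r.
  move=> r0; have H : `|u_ n r| @[n --> \oo] --> `|u r| by apply: cvg_norm; exact: uu.
  rewrite -(cvg_lim (@Rhausdorff R) H); apply: limr_le.
    by apply/cvg_ex; exists `|u r|.
  by apply: nearW => n; exact: uw.
have su : square_intg u.
  split=> //; apply: (@intg_le _ _ _ (fun r => w r ^+ 2)) => //.
  - exact: (measurable_funX 2).
  - exact: sw.2.
  - move=> r /pos r0; rewrite normrX ler_pXn2r ?nnegrE// ?uw'//.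
    exact: le_trans (uw' r r0).
apply: approximable_closed => // e e0.
have L : sqdist u (u_ n) @[n --> \oo] --> (0 : R).
  rewrite (_ : 0 = \int[mu]_(r in halfline R) (0 : R)); last first.
    by rewrite Rintegral_cst// mul0r.
  apply: (@Rintegral_dominated _ _ _ _ (fun r => 4 * w r ^+ 2)) => //.
  - by move=> n; apply: (measurable_funX 2); apply: measurable_funB => //; exact: (au n).1.1.
  - by apply: intgZ => //; exact: sw.2.
  - move=> r /pos r0; rewrite -[X in _ --> X](expr0n R 2) -(subrr (u r)).
    have c1 : (u r - u_ n r) @[n --> \oo] --> u r - u r.
      by apply: cvgB; [exact: cvg_cst|exact: uu].
    exact: (cvgM c1 c1).
  - move=> n r /pos r0; rewrite normrX.
    have h1 := uw' r r0; have h2 := uw n r r0.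
    have : `|u r - u_ n r| <= 2 * w r.
      by rewrite (le_trans (ler_normB _ _))// mulr2n mulrDl mul1r lerD.
    have : 0 <= `|u r - u_ n r| by [].
    set X := `| _ |; set W := w r; nra.
have /cvgrPdist_lt := L => /(_ e e0)[n _ /(_ n (leqnn n))] /=.
rewrite sub0r normrN => h; exists (u_ n); first exact: au.
exact: le_lt_trans (ler_norm _) h.
Qed.

Lemma square_intg_indic x y (E : set R) : 0 < x -> measurable E -> E `<=` `]x, y[ ->
  square_intg (\1_E : R -> R).
Proof.
move=> x0 mE Exy; have mI D : measurable_fun D (\1_E : R -> R) by exact: measurable_indic.
split=> //; have [xy|yx] := leP x y; last first.
  have E0 r : (\1_E r : R) = 0.
    rewrite indicE memNset// => /Exy; rewrite /= in_itv/= => /andP[xr ry].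
    by have := lt_trans (lt_trans xr ry) yx; rewrite ltxx.
  have := locally_intg_test (@locally_intg_cst R 0) (@bump_real_test R 1 2 0 ltr01).
  by apply: intg_eq; [exact: measurable_halfline|move=> r _ /=; rewrite E0 mul0r expr0n].
apply: (@intg_outside _ _ `[x, y]) => //.
- exact: measurable_halfline.
- exact: itvcc_halfline.
- move=> r _ rxy; rewrite indicE memNset ?expr0n//= => /Exy; rewrite /= in_itv/= => /andP[xr ry].
  by apply: rxy; rewrite /= in_itv/= !ltW.
- apply: (@intg_le _ _ _ (fun=> 1)) => //.
  + exact: (measurable_funX 2).
  + exact: locally_intg_cst.
  + by move=> r _; rewrite indicE; case: (_ \in _); rewrite ?expr1n ?expr0n ?normr1 ?normr0.
Qed.

Lemma indic_bound (E F : set R) r : E `<=` F -> `|\1_E r| <= (\1_F r : R).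
Proof.
move=> EF; rewrite !indicE; case: (boolP (r \in E)) => [/set_mem/EF rF|_].
  by rewrite mem_set// normr1.
by rewrite normr0 ler0n.
Qed.

Lemma approximable_itv x y : 0 < x -> approximable (\1_`]x, y[ : R -> R).
Proof.
move=> x0; have sI := @square_intg_indic x y `]x, y[ x0 (measurable_itv _) (@subset_refl _ _).
apply: (@approximable_dominated (bump x y) _ (\1_`]x, y[)) => //.
- move=> n; have t := @bump_real_test R x y n x0.
  split; first exact: real_test_square_intg.
  move=> e e0; exists (bump x y n) => //.
  rewrite (@eq_Rintegral _ _ _ mu _ (fun=> 0)); last by move=> r _; rewrite subrr expr0n.
  by rewrite Rintegral_cst ?mul0r//; exact: measurable_halfline.
- move=> n r _; rewrite ger0_norm ?bump_ge0// indicE mem_setE in_itv/=.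
  case: (boolP (x < r < y)) => rxy; first exact: bump_le1.
  by rewrite bump_out.
- by move=> r _; exact: bump_cvg.
Qed.

(** Rays are stable under intersection, so Dynkin's lemma applies; the trace on a
    fixed bounded interval makes the complement of a good set good. *)
Lemma approximable_indic x y (E : set R) : 0 < x -> measurable E ->
  approximable (\1_(E `&` `]x, y[) : R -> R).
Proof.
move=> x0 mE; pose I : set R := `]x, y[%classic.
have mI : measurable I by exact: measurable_itv.
have sI := @square_intg_indic x y I x0 (measurable_itv _) (@subset_refl _ _).
pose P (A : set R) := approximable (\1_(A `&` I) : R -> R).
suff : forall S, <<s @RGenOInfty.G R >> S -> P S.
  by apply; rewrite -[X in X E]/(@RGenOInfty.G R).-sigma.-measurable -RGenOInfty.measurableE.
have IE (A : set R) : A `&` I `<=` I by exact: subIsetr.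
apply: (@dynkin_induction _ (measurableTypeR R)).
- exact: RGenOInfty.measurableE.
- move=> _ _ [z ->] [t ->]; exists (Num.max z t); apply/seteqP; split=> r /=.
    by rewrite !in_itv/= !andbT gt_max => -[-> ->].
  by rewrite !in_itv/= !andbT gt_max => /andP.
- by rewrite /P setTI; exact: approximable_itv.
- move=> _ [z ->]; rewrite /P.
  rewrite (_ : _ `&` I = `]Num.max z x, y[%classic); last first.
    apply/seteqP; split=> r; rewrite /I /= !in_itv/= andbT gt_max.
      by move=> [-> ->].
    by move=> /andP[/andP[-> ->] ->].
  by apply: approximable_itv; rewrite lt_max x0 orbT.
- move=> S mS PS; rewrite /P.
  have := approximableD (approximable_itv y x0) (approximableZ (-1) PS).
  congr approximable; apply/funext => r /=; rewrite -/I !indicE !in_setI in_setC.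
  by case: (r \in S); case: (r \in I); rewrite /= ?mulr1 ?mulr0 ?subrr ?addr0 ?mulN1r ?subrr.
- move=> F mF tF PF; rewrite /P.
  pose u_ n := (\1_((\big[setU/set0]_(i < n) F i) `&` I) : R -> R).
  apply: (@approximable_dominated u_ _ (\1_I)) => //.
  + elim=> [|n IH].
      rewrite /u_ big_ord0 set0I indic0.
      have := approximableZ 0 (approximable_itv y x0).
      by congr approximable; apply/funext => r; rewrite mul0r.
    have := approximableD IH (PF n); congr approximable; apply/funext => r.
    rewrite /u_ big_ord_recr /= !indicE !in_setI in_setU.
    case: (boolP (r \in F n)) => rF; rewrite ?orbF ?orbT /=; last by rewrite addr0.
    suff -> : (r \in \big[setU/set0]_(i < n) F i) = false by rewrite /= add0r.
    apply/negP => /set_mem; rewrite -bigcup_mkord => -[i /= ni Fi].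
    have e : i = n by apply: tF => //; exists r; split=> //; exact: set_mem.
    by rewrite e ltnn in ni.
  + by apply: measurable_indic; apply: measurableI => //; apply: bigcup_measurable => k _; exact: mF.
  + by move=> n r _; exact: indic_bound.
  + move=> r _; have [[i _ Fi]|nF] := pselect ((\bigcup_k F k) r).
      apply: cvg_near_cst; near=> n; rewrite /u_ !indicE !in_setI.
      rewrite [X in X && _]mem_set; last first.
        rewrite -bigcup_mkord; exists i => //=; near: n; exact: nbhs_infty_gt.
      by rewrite [X in _ = (X && _)%:R]mem_set//; exists i.
    apply: cvg_near_cst; near=> n; rewrite /u_ !indicE !in_setI.
    rewrite [X in X && _]memNset; last first.
      by rewrite -bigcup_mkord => -[i _ Fi]; apply: nF; exists i.
    by rewrite [X in _ = (X && _)%:R]memNset.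
Unshelve. all: by end_near. Qed.

Import HBNNSimple.

Lemma approximable_nnsfun x y (g : {nnsfun (measurableTypeR R) >-> R}) : 0 < x ->
  approximable (fun r => g r * \1_`]x, y[ r).
Proof.
move=> x0.
have S (s : seq R) : approximable (fun r =>
    \sum_(z <- s) z * (\1_((g @^-1` [set z]) `&` `]x, y[) r : R)).
  elim: s => [|z s IH].
    have := approximableZ 0 (approximable_itv y x0).
    by congr approximable; apply/funext => r; rewrite big_nil mul0r.
  have mz : measurable (g @^-1` [set z]) by exact: measurable_sfunP.
  have := approximableD (approximableZ z (approximable_indic y x0 mz)) IH.
  by congr approximable; apply/funext => r; rewrite big_cons.
have := S (finmap.enum_fset (fset_set (range g))); congr approximable; apply/funext => r.
rewrite [in RHS]fimfunE fsbig_finite//= mulr_suml; apply: eq_bigr => z _.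
by rewrite -mulrA; congr (_ * _); rewrite !indicE in_setI -natrM mulnb.
Qed.

(** Simple functions increase to [u]; cutting them off to bounded intervals away
    from the origin does not change the pointwise limit. *)
Lemma approximable_ge0 u : square_intg u -> (forall r, 0 <= u r) -> approximable u.
Proof.
move=> su u0; have mh := @measurable_halfline R.
have mu1 : measurable_fun (halfline R) (EFin \o u) by apply/measurable_EFinP; exact: su.1.
pose g (n : nat) := nnsfun_approx (T := measurableTypeR R) mh mu1 n.
pose u_ (n : nat) r := g n r * \1_`]n.+1%:R^-1, n.+1%:R[ r.
have u0' x : halfline R x -> (0 <= (EFin \o u) x)%E by move=> _; rewrite lee_fin.
have H (r : R) : 0 < r -> halfline R r by rewrite /halfline /= in_itv/= andbT.
apply: (@approximable_dominated u_ _ u) => //.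
- by move=> n; apply: approximable_nnsfun.
- exact: su.1.
- move=> n r r0; have gr : g n r <= u r.
    by rewrite -lee_fin /g nnsfun_approxE le_approx//; exact: H.
  rewrite /u_ normrM ger0_norm// indicE; case: (_ \in _).
    by rewrite normr1 mulr1.
  by rewrite normr0 mulr0.
- move=> r r0; rewrite /u_ -[X in _ --> X]mulr1; apply: cvgM.
    have := @cvg_nnsfun_approx _ (measurableTypeR R) _ _ mh _ mu1 u0' r (H r r0).
    by move=> c; exact: fine_cvg c.
  have h : \forall n \near \oo, harmonic n < r by apply: (cvgr_lt 0 (@cvg_harmonic R)).
  apply: cvg_near_cst; near=> n; rewrite indicE mem_set//= in_itv/=; apply/andP; split.
    by near: n; exact: h.
  apply: (@lt_trans _ _ n%:R); last by rewrite ltr_nat.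
  by near: n; exact: nbhs_infty_gtr.
Unshelve. all: by end_near. Qed.

Lemma square_intg_approximable u : square_intg u -> approximable u.
Proof.
move=> su; have norm_le (f : R -> R) : measurable_fun (halfline R) f ->
    (forall r, `|f r| <= `|u r|) -> square_intg f.
  move=> mf fu; split=> //; apply: (@intg_le _ _ _ (fun r => u r ^+ 2)).
  - exact: measurable_halfline.
  - exact: (measurable_funX 2).
  - exact: su.2.
  - by move=> r _; rewrite normrX -(real_normK (num_real (u r))) ler_pXn2r ?nnegrE.
have mn : measurable_fun (halfline R) (fun r => `|u r|).
  by apply: measurableT_comp => //; exact: su.1.
pose p r := 2^-1 * (`|u r| + u r); pose q r := 2^-1 * (`|u r| - u r).
have ule r := ler_norm (u r).
have uge r : - u r <= `|u r| by rewrite lerNl lerNnormlW.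
have p0 r : 0 <= p r by rewrite /p; have := uge r; lra.
have q0 r : 0 <= q r by rewrite /q; have := ule r; lra.
have sp : approximable p.
  apply: approximable_ge0 => //; apply: norm_le.
    by apply: measurable_funM => //; apply: measurable_funD => //; exact: su.1.
  by move=> r; rewrite ger0_norm// /p; have := ule r; lra.
have sq : approximable q.
  apply: approximable_ge0 => //; apply: norm_le.
    by apply: measurable_funM => //; apply: measurable_funB => //; exact: su.1.
  by move=> r; rewrite ger0_norm// /q; have := uge r; lra.
have := approximableD sp (approximableZ (-1) sq).
by congr approximable; apply/funext => r; rewrite /p /q /=; field.
Qed.

End density.

(** * Weak solutions of the radial system *)

Section weak_solutions.
Context {R : realType}.
Variables (m p q kap : R).
Local Notation leb := (@lebesgue_measure R).
Local Notation intg D f := (leb.-integrable D (EFin \o f)).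
Implicit Types (up um gp gm f g h phi : R -> R) (r : R).

Definition weakly_solves up um gp gm : Prop := forall phi, real_test phi ->
  \int[leb]_(r in halfline R) (gp r * phi r) =
  \int[leb]_(r in halfline R) ((m + p / r) * up r * phi r
     + (um r * derive1 phi r + kap / r * um r * phi r)) /\
  \int[leb]_(r in halfline R) (gm r * phi r) =
  \int[leb]_(r in halfline R) ((- (up r * derive1 phi r) + kap / r * up r * phi r)
     + (- m + q / r) * um r * phi r).

Lemma locally_intgD f g : locally_intg f -> locally_intg g -> locally_intg (f \+ g).
Proof. by move=> hf hg x y x0 xy; apply: intgD => //; [exact: hf|exact: hg]. Qed.

Lemma locally_intgZ (c : R) f : locally_intg f -> locally_intg (fun r => c * f r).
Proof. by move=> hf x y x0 xy; apply: intgZ => //; exact: hf. Qed.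

Lemma locally_intg_affine_inv (c d : R) f : square_intg f ->
  locally_intg (fun r => (c + d / r) * f r).
Proof.
move=> sf; apply: locally_intgM; first exact: square_intg_locally.
move=> r r0; apply: cvgD; first exact: cvg_cst.
by apply: cvgM; [exact: cvg_cst|apply: inv_continuous; rewrite gt_eqF].
Qed.

Lemma measurable_affine_inv (c d : R) f : measurable_fun (halfline R) f ->
  measurable_fun (halfline R) (fun r => (c + d / r) * f r).
Proof.
move=> mf; apply: measurable_funM => //.
apply: continuous_halfline_measurable => r r0; apply: cvgD; first exact: cvg_cst.
by apply: cvgM; [exact: cvg_cst|apply: inv_continuous; rewrite gt_eqF].
Qed.

Definition rhsp up um gp r := p / r * up r + kap / r * um r + (m * up r - gp r).
Definition rhsm up um gm r := - (kap / r) * up r - q / r * um r + (m * um r + gm r).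

Lemma rhspE up um gp : rhsp up um gp =
  ((fun r => (m + p / r) * up r) \+ (fun r => (0 + kap / r) * um r)) \+ (fun r => -1 * gp r).
Proof. by apply/funext => r; rewrite /rhsp /=; ring. Qed.

Lemma rhsmE up um gm : rhsm up um gm =
  ((fun r => (0 + (- kap) / r) * up r) \+ (fun r => (m + (- q) / r) * um r)) \+ gm.
Proof. by apply/funext => r; rewrite /rhsm /=; ring. Qed.

Lemma locally_intg_rhs up um g : square_intg up -> square_intg um -> square_intg g ->
  locally_intg (rhsp up um g) /\ locally_intg (rhsm up um g).
Proof.
move=> su sv sg; rewrite rhspE rhsmE; split.
  by repeat apply: locally_intgD; [exact: locally_intg_affine_inv..|
    apply: locally_intgZ; exact: square_intg_locally].
by repeat apply: locally_intgD; [exact: locally_intg_affine_inv..|exact: square_intg_locally].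
Qed.

Lemma measurable_rhs up um g : measurable_fun (halfline R) up ->
  measurable_fun (halfline R) um -> measurable_fun (halfline R) g ->
  measurable_fun (halfline R) (rhsp up um g) /\ measurable_fun (halfline R) (rhsm up um g).
Proof.
move=> su sv sg; rewrite rhspE rhsmE; split.
  by repeat apply: measurable_funD; [exact: measurable_affine_inv..|exact: measurable_funM].
by repeat apply: measurable_funD; [exact: measurable_affine_inv..|exact: sg].
Qed.

(** Solved for the weak derivatives, the equations are ready for
    [weak_derivative_primitive]. *)
Lemma weakly_solvesE up um gp gm : square_intg up -> square_intg um ->
  square_intg gp -> square_intg gm ->
  weakly_solves up um gp gm <->
  (forall phi, real_test phi ->
    \int[leb]_(r in halfline R) (um r * derive1 phi r) =
      - (\int[leb]_(r in halfline R) (rhsp up um gp r * phi r)) /\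
    \int[leb]_(r in halfline R) (up r * derive1 phi r) =
      - (\int[leb]_(r in halfline R) (rhsm up um gm r * phi r))).
Proof.
move=> sup sum sgp sgm.
have mh := @measurable_halfline R.
have [lp _] := locally_intg_rhs sup sum sgp.
have [_ lm] := locally_intg_rhs sup sum sgm.
suff E phi : real_test phi ->
   (\int[leb]_(r in halfline R) ((m + p / r) * up r * phi r
     + (um r * derive1 phi r + kap / r * um r * phi r)) =
    \int[leb]_(r in halfline R) (gp r * phi r) +
    (\int[leb]_(r in halfline R) (um r * derive1 phi r) +
      \int[leb]_(r in halfline R) (rhsp up um gp r * phi r))) /\
   (\int[leb]_(r in halfline R) ((- (up r * derive1 phi r) + kap / r * up r * phi r)
     + (- m + q / r) * um r * phi r) =
    \int[leb]_(r in halfline R) (gm r * phi r) -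
    (\int[leb]_(r in halfline R) (up r * derive1 phi r) +
      \int[leb]_(r in halfline R) (rhsm up um gm r * phi r))).
  split=> H phi tphi; have [e1 e2] := E _ tphi; have := H _ tphi.
    rewrite e1 e2 => -[h1 h2]; split; apply/eqP; rewrite -addr_eq0; apply/eqP.
      by apply: (addrI (\int[leb]_(r in halfline R) (gp r * phi r))); rewrite addr0.
    apply/eqP; rewrite -oppr_eq0; apply/eqP.
    by apply: (addrI (\int[leb]_(r in halfline R) (gm r * phi r))); rewrite addr0.
  by rewrite e1 e2 => -[-> ->]; rewrite !addNr addr0 subr0.
have RD := @RintegralD _ _ _ leb (halfline R).
have RB := @RintegralB _ _ _ leb (halfline R).
move=> tphi; have tdphi := real_test_derive1 tphi.
have i1 := locally_intg_test (square_intg_locally sgp) tphi.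
have i2 := locally_intg_test (square_intg_locally sum) tdphi.
have i3 := locally_intg_test lp tphi.
have j1 := locally_intg_test (square_intg_locally sgm) tphi.
have j2 := locally_intg_test (square_intg_locally sup) tdphi.
have j3 := locally_intg_test lm tphi.
split.
  rewrite -(RD _ _ mh i2 i3) -(RD _ _ mh i1 (intgD mh i2 i3)).
  by apply: eq_Rintegral => r _; rewrite /rhsp /=; ring.
rewrite -(RD _ _ mh j2 j3) -(RB _ _ mh j1 (intgD mh j2 j3)).
by apply: eq_Rintegral => r _; rewrite /rhsm /=; ring.
Qed.

(** The right-hand sides are locally integrable, so weak solutions have locally
    absolutely continuous representatives; integration by parts gives the
    converse. *)
Lemma weakly_solvesP up um gp gm : square_intg up -> square_intg um ->
  square_intg gp -> square_intg gm ->
  weakly_solves up um gp gm <-> exists vp vm,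
    [/\ ae_eq leb (halfline R) up vp, ae_eq leb (halfline R) um vm &
        solves m p q kap vp vm gp gm].
Proof.
move=> sup sum sgp sgm; rewrite weakly_solvesE//.
have [lp _] := locally_intg_rhs sup sum sgp.
have [_ lm] := locally_intg_rhs sup sum sgm.
split.
  move=> H.
  have [vm Hvm em] := weak_derivative_primitive (square_intg_locally sum) lp
    (fun phi t => (H phi t).1).
  have [vp Hvp ep] := weak_derivative_primitive (square_intg_locally sup) lm
    (fun phi t => (H phi t).2).
  have mvm : measurable_fun (halfline R) vm.
    by apply: continuous_halfline_measurable => r r0; exact: ac_primitive_continuous Hvm.
  have mvp : measurable_fun (halfline R) vp.
    by apply: continuous_halfline_measurable => r r0; exact: ac_primitive_continuous Hvp.
  exists vp, vm; split=> //; split.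
  - apply: ac_primitive_ae Hvp; first exact: (measurable_rhs mvp mvm sgm.1).2.
    move: ep em; apply: filterS2 => r ep em r0; rewrite /rhsm.
    by rewrite (ep r0) (em r0).
  - apply: ac_primitive_ae Hvm; first exact: (measurable_rhs mvp mvm sgp.1).1.
    move: ep em; apply: filterS2 => r ep em r0; rewrite /rhsp.
    by rewrite (ep r0) (em r0).
move=> [vp [vm [ep em [Hvp Hvm]]]] phi tphi.
have mvm : measurable_fun (halfline R) vm.
  by apply: continuous_halfline_measurable => r r0; exact: ac_primitive_continuous Hvm.
have mvp : measurable_fun (halfline R) vp.
  by apply: continuous_halfline_measurable => r r0; exact: ac_primitive_continuous Hvp.
have mh := @measurable_halfline R.
have mt h : real_test h -> measurable_fun (halfline R) h.
  by move=> /real_test_square_intg[].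
have mphi := mt _ tphi; have mdphi := mt _ (real_test_derive1 tphi).
have wm := ac_primitive_weak Hvm tphi; have wp := ac_primitive_weak Hvp tphi.
have [mp1 _] := measurable_rhs sup.1 sum.1 sgp.1.
have [_ mm1] := measurable_rhs sup.1 sum.1 sgm.1.
have [mp2 _] := measurable_rhs mvp mvm sgp.1.
have [_ mm2] := measurable_rhs mvp mvm sgm.1.
split.
- rewrite (@Rintegral_ae _ _ _ (vm \* derive1 phi)) ?wm//.
  + congr (- _); apply: Rintegral_ae => //; [exact: measurable_funM..|].
    move: ep em; apply: filterS2 => r ep em r0 /=.
    by rewrite /rhsp (ep r0) (em r0).
  + exact: (measurable_funM sum.1 mdphi).
  + exact: measurable_funM.
  + by move: em; apply: filterS => r em r0 /=; rewrite (em r0).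
- rewrite (@Rintegral_ae _ _ _ (vp \* derive1 phi)) ?wp//.
  + congr (- _); apply: Rintegral_ae => //; [exact: measurable_funM..|].
    move: ep em; apply: filterS2 => r ep em r0 /=.
    by rewrite /rhsm (ep r0) (em r0).
  + exact: (measurable_funM sup.1 mdphi).
  + exact: measurable_funM.
  + by move: ep; apply: filterS => r ep r0 /=; rewrite (ep r0).
Qed.

Lemma weakly_solves_unique up um gp gm gp' gm' :
  square_intg gp -> square_intg gm -> square_intg gp' -> square_intg gm' ->
  weakly_solves up um gp gm -> weakly_solves up um gp' gm' ->
  ae_eq leb (halfline R) gp gp' /\ ae_eq leb (halfline R) gm gm'.
Proof.
move=> sgp sgm sgp' sgm' H H'; have mh := @measurable_halfline R.
have key g g' : square_intg g -> square_intg g' ->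
    (forall phi, real_test phi -> \int[leb]_(r in halfline R) (g r * phi r) =
      \int[leb]_(r in halfline R) (g' r * phi r)) -> ae_eq leb (halfline R) g g'.
  move=> sg sg' E.
  have H0 : ae_eq leb (halfline R) (fun r => g r - g' r) (fun=> 0).
    apply: fundamental_lemma; first exact: square_intg_locally (square_intgB sg sg').
    move=> phi tphi.
    have i1 := locally_intg_test (square_intg_locally sg) tphi.
    have i2 := locally_intg_test (square_intg_locally sg') tphi.
    transitivity (\int[leb]_(r in halfline R) (g r * phi r - g' r * phi r)).
      by apply: eq_Rintegral => r _; ring.
    by rewrite RintegralB// E// subrr.
  by move: H0; apply: filterS => r h r0; move: (h r0) => /eqP; rewrite subr_eq0 => /eqP.
split; apply: key => // phi tphi.
  by rewrite (H _ tphi).1 (H' _ tphi).1.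
by rewrite (H _ tphi).2 (H' _ tphi).2.
Qed.

(** A complex test function [phi + i psi] mixes the equations of the real and
    imaginary parts: [c = -1] produces the real part of a product, and [c = 1],
    with the roles of [phi] and [psi] exchanged, its imaginary part. *)
Lemma weakly_solves_combine (c : R) up um gp gm vp vm lp lm phi psi :
  square_intg up -> square_intg um -> square_intg gp -> square_intg gm ->
  square_intg vp -> square_intg vm -> square_intg lp -> square_intg lm ->
  weakly_solves up um gp gm -> weakly_solves vp vm lp lm ->
  real_test phi -> real_test psi ->
  \int[leb]_(r in halfline R) (gp r * phi r + c * (lp r * psi r)) =
  \int[leb]_(r in halfline R) (((m + p / r) * up r * phi r
     + (um r * derive1 phi r + kap / r * um r * phi r))
    + c * ((m + p / r) * vp r * psi r
     + (vm r * derive1 psi r + kap / r * vm r * psi r))) /\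
  \int[leb]_(r in halfline R) (gm r * phi r + c * (lm r * psi r)) =
  \int[leb]_(r in halfline R) (((- (up r * derive1 phi r) + kap / r * up r * phi r)
     + (- m + q / r) * um r * phi r)
    + c * ((- (vp r * derive1 psi r) + kap / r * vp r * psi r)
     + (- m + q / r) * vm r * psi r)).
Proof.
move=> sup sum sgp sgm svp svm slp slm Hu Hv tphi tpsi.
have mh := @measurable_halfline R.
have ig f h : square_intg f -> real_test h -> intg (halfline R) (f \* h).
  by move=> sf th; exact: locally_intg_test (square_intg_locally sf) th.
have e1 f f' h : square_intg f -> square_intg f' -> real_test h ->
    intg (halfline R) (fun r => (m + p / r) * f r * h r
     + (f' r * derive1 h r + kap / r * f' r * h r)).
  move=> sf sf' th.
  have i1 := locally_intg_test (locally_intg_affine_inv m p sf) th.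
  have i2 := locally_intg_test (locally_intg_affine_inv 0 kap sf') th.
  apply: intg_eq (intgD mh i1 (intgD mh (ig _ _ sf' (real_test_derive1 th)) i2)) => //.
  by move=> r _ /=; ring.
have e2 f f' h : square_intg f -> square_intg f' -> real_test h ->
    intg (halfline R) (fun r => (- (f r * derive1 h r) + kap / r * f r * h r)
     + (- m + q / r) * f' r * h r).
  move=> sf sf' th.
  have i1 := locally_intg_test (locally_intg_affine_inv (- m) q sf') th.
  have i2 := locally_intg_test (locally_intg_affine_inv 0 kap sf) th.
  have i3 := intgZ (-1) mh (ig _ _ sf (real_test_derive1 th)).
  apply: intg_eq (intgD mh (intgD mh i3 i2) i1) => //.
  by move=> r _ /=; ring.
have [hu1 hu2] := Hu _ tphi; have [hv1 hv2] := Hv _ tpsi.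
have comb f f' h h' : intg (halfline R) f -> intg (halfline R) f' ->
    intg (halfline R) h -> intg (halfline R) h' ->
    \int[leb]_(r in halfline R) f r = \int[leb]_(r in halfline R) h r ->
    \int[leb]_(r in halfline R) f' r = \int[leb]_(r in halfline R) h' r ->
    \int[leb]_(r in halfline R) (f r + c * f' r) =
    \int[leb]_(r in halfline R) (h r + c * h' r).
  move=> if_ if' ih ih' E E'; rewrite RintegralD//; last exact: intgZ.
  by rewrite RintegralZl// [RHS]RintegralD// ?RintegralZl// ?E ?E'//; exact: intgZ.
split; apply: comb => //; try exact: ig; try exact: e1; try exact: e2.
Qed.

End weak_solutions.

Section continuous_functions.
Context {R : realType}.
Local Notation leb := (@lebesgue_measure R).
Implicit Types (u v : R -> R) (r x y : R).

(** The primitives of the difference are constant, and the difference is their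
    derivative everywhere. *)
Lemma continuous_ae_eq u v : (forall r, 0 < r -> {for r, continuous u}) ->
  (forall r, 0 < r -> {for r, continuous v}) -> ae_eq leb (halfline R) u v ->
  forall r, 0 < r -> u r = v r.
Proof.
move=> cu cv uv.
pose h r := u r - v r.
have ch r : 0 < r -> {for r, continuous h} by move=> r0; apply: cvgB; [exact: cu|exact: cv].
have lh : locally_intg h.
  by move=> x y x0 xy; apply/intg_cont/continuous_halfline_within.
have h0 : ac_primitive (fun=> 0) h.
  apply: ac_primitive_ae (ac_primitive_cst 0); first exact: continuous_halfline_measurable.
  by move: uv; apply: filterS => r e r0; rewrite /h (e r0) subrr.
move=> r r0; apply/eqP; rewrite -subr_eq0; apply/eqP; rewrite -/(h r).
have r2 : 0 < r / 2 by rewrite divr_gt0.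
have r2r : r / 2 < r by rewrite ltr_pdivrMr// ltr_pMr// ltr1n.
have rr : r < r + 1 by rewrite ltrDl.
have [_ <-] := continuous_FTC1_closed rr (lh _ _ r2 (ltW (lt_trans r2r rr))) r2r (ch r r0).
rewrite derive1E; set F := (fun x : R => _).
suff dF : is_derive r 1 F 0 by have [] := dF.
apply: (@near_eq_is_derive _ _ _ (cst 0)); near=> z.
have r2z : r / 2 <= z by apply: ltW; near: z; exact: (cvgr_gt r cvg_id).
by have [_] := h0 _ _ r2 r2z; rewrite subrr.
Unshelve. all: by end_near. Qed.

Lemma square_intg_compact u x y : 0 < x -> (forall r, 0 < r -> {for r, continuous u}) ->
  (forall r, ~~ (x < r < y) -> u r = 0) -> square_intg u.
Proof.
move=> x0 cu u0; split; first exact: continuous_halfline_measurable.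
apply: (@intg_halfline_restrict _ _ x y) => //; first by move=> r /u0 ->; rewrite expr0n.
apply/intg_cont/continuous_halfline_within => // r r0.
rewrite (_ : (fun r => u r ^+ 2) = (fun r => u r * u r)); last by apply/funext => t; rewrite expr2.
by apply: cvgM; exact: cu.
Qed.

End continuous_functions.

(** * Complex waves *)

Section complex_waves.
Context {R : realType}.
Local Notation leb := (@lebesgue_measure R).
Local Notation intg D f := (leb.-integrable D (EFin \o f)).
Local Notation re f i := (fun r => complex.Re (f r i 0)).
Local Notation im f i := (fun r => complex.Im (f r i 0)).
Implicit Types (f g u v fc : wave R) (phi : R -> R[i]) (z w : R[i]) (r : R) (i : 'I_2).

Lemma ReM z w : complex.Re (z * w) = complex.Re z * complex.Re w - complex.Im z * complex.Im w.
Proof. by case: z; case: w. Qed.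

Lemma ImM z w : complex.Im (z * w) = complex.Re z * complex.Im w + complex.Im z * complex.Re w.
Proof. by case: z => a b; case: w => c d. Qed.

Lemma ReD z w : complex.Re (z + w) = complex.Re z + complex.Re w.
Proof. by case: z; case: w. Qed.

Lemma ImD z w : complex.Im (z + w) = complex.Im z + complex.Im w.
Proof. by case: z; case: w. Qed.

Lemma ReN z : complex.Re (- z) = - complex.Re z.
Proof. by case: z. Qed.

Lemma ImN z : complex.Im (- z) = - complex.Im z.
Proof. by case: z. Qed.

Lemma ReJ z : complex.Re (z^*) = complex.Re z.
Proof. by case: z. Qed.

Lemma ImJ z : complex.Im (z^*) = - complex.Im z.
Proof. by case: z. Qed.

Definition ReImE := (ReM, ImM, ReD, ImD, ReN, ImN, ReJ, ImJ).

Lemma complex_ext z w : complex.Re z = complex.Re w -> complex.Im z = complex.Im w -> z = w.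
Proof. by case: z => a b; case: w => c d /= -> ->. Qed.

Lemma sum_I2 (V : nmodType) (F : 'I_2 -> V) : \sum_(i < 2) F i = F 0 + F 1.
Proof.
rewrite big_ord_recl big_ord1; congr (F _ + F _); exact: val_inj.
Qed.

Lemma ord2P (P : 'I_2 -> Prop) : P 0 -> P 1 -> forall i, P i.
Proof.
move=> P0 P1 i; have [|] := boolP (i == 0) => [/eqP ->//|i0].
suff -> : i = 1 by [].
by apply/val_inj; case: i i0 => -[|[|n]].
Qed.

Lemma colvec_ext (v w : 'cV[R[i]]_2) : v 0 0 = w 0 0 -> v 1 0 = w 1 0 -> v = w.
Proof. by move=> e0 e1; apply/matrixP => i j; rewrite (ord1 j); move: i; apply: ord2P. Qed.

Lemma cv2E (T : Type) (a b : T) : (cv2 a b 0 0 = a) * (cv2 a b 1 0 = b).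
Proof. by rewrite !mxE. Qed.

Lemma norm2_sqr (v : 'cV[R[i]]_2) : norm2 v ^+ 2 =
  \sum_(i < 2) (complex.Re (v i 0) ^+ 2 + complex.Im (v i 0) ^+ 2).
Proof. by rewrite sqr_sqrtr// sumr_ge0// => i _; rewrite addr_ge0// sqr_ge0. Qed.

Lemma L2P f : L2 f <-> forall i, square_intg (re f i) /\ square_intg (im f i).
Proof.
have mh := @measurable_halfline R.
split=> [[mf fy] i|H].
  have [mr mi] := mf i.
  have msq j : measurable_fun (halfline R)
      (fun r => complex.Re (f r j 0) ^+ 2 + complex.Im (f r j 0) ^+ 2).
    by apply: measurable_funD; apply: (measurable_funX 2); [exact: (mf j).1|exact: (mf j).2].
  have mn : measurable_fun (halfline R) (fun r => norm2 (f r) ^+ 2).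
    rewrite (_ : (fun r => _) = (fun r => (complex.Re (f r 0 0) ^+ 2 + complex.Im (f r 0 0) ^+ 2)
      + (complex.Re (f r 1 0) ^+ 2 + complex.Im (f r 1 0) ^+ 2))).
      by apply: measurable_funD; exact: msq.
    by apply/funext => r; rewrite norm2_sqr sum_I2.
  have iN : intg (halfline R) (fun r => norm2 (f r) ^+ 2).
    apply/integrableP; split; first exact/measurable_EFinP.
    apply: le_lt_trans fy; rewrite le_eqVlt; apply/orP; left; apply/eqP.
    by apply: eq_integral => r _ /=; rewrite ger0_norm// sqr_ge0.
  have le r : complex.Re (f r i 0) ^+ 2 + complex.Im (f r i 0) ^+ 2 <= norm2 (f r) ^+ 2.
    rewrite norm2_sqr (bigD1 i)//= lerDl sumr_ge0// => j _.
    by rewrite addr_ge0// sqr_ge0.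
  split; split=> //; apply: intg_le iN _ => //; try exact: (measurable_funX 2).
    move=> r _; rewrite ger0_norm ?sqr_ge0// (le_trans _ (le r))// lerDl sqr_ge0//.
  move=> r _; rewrite ger0_norm ?sqr_ge0// (le_trans _ (le r))// lerDr sqr_ge0//.
split; first by move=> i; have [[mr _] [mi _]] := H i.
have [[_ h1] [_ h2]] := H 0; have [[_ h3] [_ h4]] := H 1.
have := intgD mh (intgD mh h1 h2) (intgD mh h3 h4).
move=> /integrableP[_]; apply: le_lt_trans.
rewrite le_eqVlt; apply/orP; left; apply/eqP.
apply: eq_integral => r _ /=; rewrite norm2_sqr sum_I2 ger0_norm//.
by rewrite !addr_ge0// sqr_ge0.
Qed.

Lemma aeqP f g : aeq f g <->
  forall i, ae_eq leb (halfline R) (re f i) (re g i) /\ ae_eq leb (halfline R) (im f i) (im g i).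
Proof.
split=> [fg i|H].
  by split; move: fg; apply: filterS => r /= e r0; rewrite (e r0).
have [h1 h2] := H 0; have [h3 h4] := H 1.
have h12 : ae_eq leb (halfline R) (fun r => f r 0 0) (fun r => g r 0 0).
  by move: h1 h2; apply: filterS2 => r /= e1 e2 r0; apply: complex_ext; [exact: e1|exact: e2].
have h34 : ae_eq leb (halfline R) (fun r => f r 1 0) (fun r => g r 1 0).
  by move: h3 h4; apply: filterS2 => r /= e1 e2 r0; apply: complex_ext; [exact: e1|exact: e2].
rewrite /aeq; move: h12 h34; apply: filterS2 => r /= e1 e2 r0.
by apply: colvec_ext; [exact: e1|exact: e2].
Qed.

Lemma aeq_refl f : aeq f f.
Proof. by apply: aeW. Qed.

Lemma aeq_sym f g : aeq f g -> aeq g f.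
Proof. exact: ae_eq_sym. Qed.

Lemma aeq_trans f g u : aeq f g -> aeq g u -> aeq f u.
Proof. exact: ae_eq_trans. Qed.

Lemma L2_aeq f g : aeq f g -> (forall i, measurable_fun (halfline R) (re g i) /\
  measurable_fun (halfline R) (im g i)) -> L2 f -> L2 g.
Proof.
move=> /aeqP fg mg /L2P Lf; apply/L2P => i; have [e1 e2] := fg i.
have [[_ h1] [_ h2]] := Lf i; have [m1 m2] := mg i.
have mh := @measurable_halfline R.
split; split=> //; [apply: intg_ae h1 => //; first exact: (measurable_funX 2)|
  apply: intg_ae h2 => //; first exact: (measurable_funX 2)].
  by move: e1; apply: filterS => r e r0; rewrite (e r0).
by move: e2; apply: filterS => r e r0; rewrite (e r0).
Qed.

Definition dot (a b : R -> R) : R := \int[leb]_(r in halfline R) (a r * b r).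

Lemma innerE f g : L2 f -> L2 g -> inner f g =
  ((dot (re f 0) (re g 0) + dot (im f 0) (im g 0)) +
   (dot (re f 1) (re g 1) + dot (im f 1) (im g 1))) +i*
  ((dot (re f 0) (im g 0) - dot (im f 0) (re g 0)) +
   (dot (re f 1) (im g 1) - dot (im f 1) (re g 1))).
Proof.
move=> /L2P Lf /L2P Lg; have mh := @measurable_halfline R.
have [f0r f0i] := Lf 0; have [f1r f1i] := Lf 1.
have [g0r g0i] := Lg 0; have [g1r g1i] := Lg 1.
have RD := @RintegralD _ _ _ leb (halfline R).
have RB := @RintegralB _ _ _ leb (halfline R).
have i1 := square_intgM f0r g0r; have i2 := square_intgM f0i g0i.
have i3 := square_intgM f1r g1r; have i4 := square_intgM f1i g1i.
have j1 := square_intgM f0r g0i; have j2 := square_intgM f0i g0r.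
have j3 := square_intgM f1r g1i; have j4 := square_intgM f1i g1r.
apply: complex_ext; rewrite /inner /integralC /= /dot.
  rewrite -(RD _ _ mh i1 i2) -(RD _ _ mh i3 i4) -(RD _ _ mh (intgD mh i1 i2) (intgD mh i3 i4)).
  by apply: eq_Rintegral => r _; rewrite sum_I2 !ReImE /=; ring.
rewrite -(RB _ _ mh j1 j2) -(RB _ _ mh j3 j4) -(RD _ _ mh (intgB mh j1 j2) (intgB mh j3 j4)).
by apply: eq_Rintegral => r _; rewrite sum_I2 !ReImE /=; ring.
Qed.

Lemma inner_aeq f f' g g' : L2 f -> L2 f' -> L2 g -> L2 g' -> aeq f f' -> aeq g g' ->
  inner f g = inner f' g'.
Proof.
move=> Lf Lf' Lg Lg' ff gg; rewrite !innerE//.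
move: Lf Lf' Lg Lg' => /L2P Lf /L2P Lf' /L2P Lg /L2P Lg'.
move: ff gg => /aeqP ff /aeqP gg.
have E a a' b b' : square_intg a -> square_intg a' -> square_intg b -> square_intg b' ->
    ae_eq leb (halfline R) a a' -> ae_eq leb (halfline R) b b' -> dot a b = dot a' b'.
  move=> sa sa' sb sb' aa bb; apply: Rintegral_ae.
  - exact: measurable_halfline.
  - exact: (measurable_funM sa.1 sb.1).
  - exact: (measurable_funM sa'.1 sb'.1).
  - by move: aa bb; apply: filterS2 => r e1 e2 r0 /=; rewrite (e1 r0) (e2 r0).
by congr ((_ + _ + (_ + _)) +i* (_ - _ + (_ - _))); apply: E;
  try exact: (Lf _).1; try exact: (Lf' _).1; try exact: (Lf _).2; try exact: (Lf' _).2;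
  try exact: (Lg _).1; try exact: (Lg' _).1; try exact: (Lg _).2; try exact: (Lg' _).2;
  try exact: (ff _).1; try exact: (ff _).2; try exact: (gg _).1; try exact: (gg _).2.
Qed.

Lemma L2_lin (a : R[i]) f g : L2 f -> L2 g -> L2 (fun r => a *: f r + g r).
Proof.
move=> /L2P Lf /L2P Lg; apply/L2P => i; have [f1 f2] := Lf i; have [g1 g2] := Lg i.
split.
  have := square_intgD (square_intgD (square_intgZ (complex.Re a) f1)
    (square_intgZ (- complex.Im a) f2)) g1.
  by congr square_intg; apply/funext => r; rewrite !mxE !ReImE /=; ring.
have := square_intgD (square_intgD (square_intgZ (complex.Re a) f2)
  (square_intgZ (complex.Im a) f1)) g2.
by congr square_intg; apply/funext => r; rewrite !mxE !ReImE /=; ring.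
Qed.

Lemma test_functionP phi : test_function phi <->
  real_test (fun r => complex.Re (phi r)) /\ real_test (fun r => complex.Im (phi r)).
Proof.
split=> [[s1 [s2 [a [b [a0 H]]]]]|[[s1 [a [b [a0 H]]]] [s2 [c [d [c0 H']]]]]].
  by split; split=> //; exists a, b; split=> // r /H ->.
split=> //; split=> //; exists (Num.min a c), (Num.max b d).
split; first by rewrite lt_min a0.
move=> r; rewrite ge_min le_max negb_and !negb_or => /orP[]/andP[h1 h2] /=.
  by apply: complex_ext; rewrite ?H ?H'//= negb_and ?h1 ?h2.
by apply: complex_ext; rewrite ?H ?H'//= negb_and ?h1 ?h2 orbT.
Qed.

Lemma real_test0 : real_test (fun=> 0 : R).
Proof. by split; [exact: smooth0|exists 1, 1]. Qed.

Lemma test_function_real (h : R -> R) : real_test h -> test_function (fun r => (h r)%:C).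
Proof. by move=> th; apply/test_functionP; split; [exact: th|exact: real_test0]. Qed.

Lemma derivC_real (h : R -> R) r : Defs.derivC (fun r => (h r)%:C) r = (derive1 h r)%:C.
Proof. by rewrite /Defs.derivC /= derive1_cst. Qed.

End complex_waves.

(** * The maximal operator *)

Section maximal_operator.
Context {R : realType}.
Variables (m nu mu lam : R) (k : int).
Local Notation leb := (@lebesgue_measure R).
Local Notation intg D f := (leb.-integrable D (EFin \o f)).
Local Notation re f i := (fun r => complex.Re (f r i 0)).
Local Notation im f i := (fun r => complex.Im (f r i 0)).
Local Notation kap := (k%:~R + lam).
Local Notation p := (nu + mu).
Local Notation q := (nu - mu).
Local Notation dmax := (dirac_max m nu mu lam k).
Local Notation dmin := (dirac_min m nu mu lam k).
Implicit Types (f g u v fc : wave R) (phi : R -> R[i]) (z w : R[i]) (r : R) (i : 'I_2).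

Definition solves_wave f g : Prop :=
  solves m p q kap (re f 0) (re f 1) (re g 0) (re g 1) /\
  solves m p q kap (im f 0) (im f 1) (im g 0) (im g 1).

Lemma eq_Rintegral2 (D : set R) (a b a' b' : R -> R) : a =1 a' -> b =1 b' ->
  \int[leb]_(r in D) a' r = \int[leb]_(r in D) b' r ->
  \int[leb]_(r in D) a r = \int[leb]_(r in D) b r.
Proof. by move=> /funext -> /funext ->. Qed.

(** Real test functions suffice, by linearity in the test function. *)
Lemma dirac_max_weak f g : dmax (f, g) <-> [/\ L2 f, L2 g,
  weakly_solves m p q kap (re f 0) (re f 1) (re g 0) (re g 1) &
  weakly_solves m p q kap (im f 0) (im f 1) (im g 0) (im g 1)].
Proof.
split=> [[/= Lf [Lg H]]|[Lf Lg Hr Hi]].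
  split=> // h th; have [e1 e2] := H _ (test_function_real th).
    split; [move: e1 => /(congr1 (@complex.Re R))|move: e2 => /(congr1 (@complex.Re R))];
      by rewrite /integralC /=; apply: eq_Rintegral2 => r;
        rewrite ?derivC_real !ReImE /=; ring.
  split; [move: e1 => /(congr1 (@complex.Im R))|move: e2 => /(congr1 (@complex.Im R))];
    by rewrite /integralC /=; apply: eq_Rintegral2 => r;
      rewrite ?derivC_real !ReImE /=; ring.
split=> //; split=> // phi /test_functionP[t1 t2].
have /L2P Lf' := Lf; have /L2P Lg' := Lg.
have [Lf0r Lf0i] := Lf' 0; have [Lf1r Lf1i] := Lf' 1.
have [Lg0r Lg0i] := Lg' 0; have [Lg1r Lg1i] := Lg' 1.
(* Real part, then imaginary part, of the product with the test function. *)
have [r1 r2] := weakly_solves_combine (-1) Lf0r Lf1r Lg0r Lg1r Lf0i Lf1i Lg0i Lg1i Hr Hi t1 t2.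
have [i1 i2] := weakly_solves_combine 1 Lf0r Lf1r Lg0r Lg1r Lf0i Lf1i Lg0i Lg1i Hr Hi t2 t1.
split; apply: complex_ext.
- by move: r1; rewrite /integralC /=; apply: eq_Rintegral2 => r; rewrite !ReImE /=; ring.
- by move: i1; rewrite /integralC /=; apply: eq_Rintegral2 => r; rewrite !ReImE /=; ring.
- by move: r2; rewrite /integralC /=; apply: eq_Rintegral2 => r; rewrite !ReImE /=; ring.
- by move: i2; rewrite /integralC /=; apply: eq_Rintegral2 => r; rewrite !ReImE /=; ring.
Qed.

Lemma solves_continuous (up um gp gm : R -> R) : solves m p q kap up um gp gm ->
  forall r, 0 < r -> {for r, continuous up} /\ {for r, continuous um}.
Proof.
by move=> [h1 h2] r r0; split; [exact: ac_primitive_continuous h1|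
  exact: ac_primitive_continuous h2].
Qed.

(** Regularity in one dimension: away from the origin the distributional equation
    yields square-integrable weak derivatives, hence a continuous
    representative which satisfies the system almost everywhere. *)
Lemma dirac_max_solves f g : dmax (f, g) <-> [/\ L2 f, L2 g &
  exists2 fc, continuous_representative f fc & solves_wave fc g].
Proof.
rewrite dirac_max_weak; split=> [[Lf Lg Hr Hi]|[Lf Lg [fc [ffc _] [Hr Hi]]]].
  have /L2P Lf' := Lf; have /L2P Lg' := Lg; split=> //.
  move: Hr Hi => /(weakly_solvesP _ _ _ _ (Lf' 0).1 (Lf' 1).1 (Lg' 0).1 (Lg' 1).1)
    [vp [vm [ep em Hv]]].
  move=> /(weakly_solvesP _ _ _ _ (Lf' 0).2 (Lf' 1).2 (Lg' 0).2 (Lg' 1).2)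
    [wp [wm [ep' em' Hw]]].
  pose fc : wave R := fun r => cv2 (vp r +i* wp r) (vm r +i* wm r).
  have E : ((re fc 0 = vp) * (im fc 0 = wp)) * ((re fc 1 = vm) * (im fc 1 = wm)).
    by split; split; apply/funext => r; rewrite !mxE.
  exists fc.
    split; first by apply/aeqP; apply: ord2P; rewrite !E; split.
    apply: ord2P => r r0; rewrite !E.
      by have [h1 _] := solves_continuous Hv r0; have [h2 _] := solves_continuous Hw r0.
    by have [_ h1] := solves_continuous Hv r0; have [_ h2] := solves_continuous Hw r0.
  by rewrite /solves_wave !E.
have /L2P Lf' := Lf; have /L2P Lg' := Lg; have /aeqP e := ffc.
split=> //.
  apply/(weakly_solvesP _ _ _ _ (Lf' 0).1 (Lf' 1).1 (Lg' 0).1 (Lg' 1).1).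
  by exists (re fc 0), (re fc 1); split; [exact: (e 0).1|exact: (e 1).1|].
apply/(weakly_solvesP _ _ _ _ (Lf' 0).2 (Lf' 1).2 (Lg' 0).2 (Lg' 1).2).
by exists (im fc 0), (im fc 1); split; [exact: (e 0).2|exact: (e 1).2|].
Qed.

Lemma continuous_representative_unique f fc fc' : continuous_representative f fc ->
  continuous_representative f fc' -> forall r, 0 < r -> fc r = fc' r.
Proof.
move=> [e c] [e' c'] r r0.
have /aeqP E := aeq_trans (aeq_sym e) e'.
have H i : fc r i 0 = fc' r i 0.
  apply: complex_ext.
    apply: (continuous_ae_eq (u := re fc i) (v := re fc' i)) => //.
    - by move=> t t0; exact: (c i t t0).1.
    - by move=> t t0; exact: (c' i t t0).1.
    - exact: (E i).1.
  apply: (continuous_ae_eq (u := im fc i) (v := im fc' i)) => //.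
  - by move=> t t0; exact: (c i t t0).2.
  - by move=> t t0; exact: (c' i t t0).2.
  - exact: (E i).2.
by apply: colvec_ext; exact: H.
Qed.

Lemma continuous_representative_measurable f fc : continuous_representative f fc ->
  forall i, measurable_fun (halfline R) (re fc i) /\ measurable_fun (halfline R) (im fc i).
Proof.
by move=> [_ c] i; split; apply: continuous_halfline_measurable => r r0;
  [exact: (c i r r0).1|exact: (c i r r0).2].
Qed.

Lemma continuous_representative_L2 f fc : continuous_representative f fc -> L2 f -> L2 fc.
Proof. by move=> h; apply: L2_aeq h.1 _; exact: continuous_representative_measurable h. Qed.

Lemma solves_wave_eq fc fc' g : (forall r, 0 < r -> fc r = fc' r) ->
  solves_wave fc g -> solves_wave fc' g.
Proof.
by move=> E [[h1 h2] [h3 h4]]; split; split;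
  [move: h1|move: h2|move: h3|move: h4]; apply: ac_primitive_eq => r r0; rewrite E.
Qed.

Lemma dirac_max_representative f g fc : dmax (f, g) -> continuous_representative f fc ->
  solves_wave fc g.
Proof.
move=> /dirac_max_solves[_ _ [fc' rep' H]] rep.
exact: solves_wave_eq (continuous_representative_unique rep' rep) H.
Qed.

Lemma dirac_max_aeq f g f' g' : dmax (f, g) -> L2 f' -> L2 g' ->
  aeq f f' -> aeq g g' -> dmax (f', g').
Proof.
move=> /dirac_max_solves[Lf Lg [fc [e c] [[h1 h2] [h3 h4]]]] Lf' Lg' ff /aeqP gg.
have /L2P Mg := Lg'.
apply/dirac_max_solves; split=> //; exists fc.
  by split=> //; exact: aeq_trans (aeq_sym ff) e.
have mc := continuous_representative_measurable (conj e c).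
have Mp := @measurable_rhs R m p q kap.
split; split.
- apply: ac_primitive_ae h1; first exact: (Mp _ _ _ (mc 0).1 (mc 1).1 (Mg 1).1.1).2.
  by move: (gg 1).1; apply: filterS => r E r0; rewrite (E r0).
- apply: ac_primitive_ae h2; first exact: (Mp _ _ _ (mc 0).1 (mc 1).1 (Mg 0).1.1).1.
  by move: (gg 0).1; apply: filterS => r E r0; rewrite (E r0).
- apply: ac_primitive_ae h3; first exact: (Mp _ _ _ (mc 0).2 (mc 1).2 (Mg 1).2.1).2.
  by move: (gg 1).2; apply: filterS => r E r0; rewrite (E r0).
- apply: ac_primitive_ae h4; first exact: (Mp _ _ _ (mc 0).2 (mc 1).2 (Mg 0).2.1).1.
  by move: (gg 0).2; apply: filterS => r E r0; rewrite (E r0).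
Qed.

Lemma continuous_representative_lin (c : R[i]) f g fc gc :
  continuous_representative f fc -> continuous_representative g gc ->
  continuous_representative (fun r => c *: f r + g r) (fun r => c *: fc r + gc r).
Proof.
move=> [e1 c1] [e2 c2]; split.
  rewrite /aeq; move: e1 e2; apply: filterS2 => r h1 h2 r0.
  by rewrite (h1 r0) (h2 r0).
move=> i r r0; have [c1r c1i] := c1 i r r0; have [c2r c2i] := c2 i r r0.
rewrite (_ : (fun x => complex.Re _) = (fun x => complex.Re c * complex.Re (fc x i 0)
   - complex.Im c * complex.Im (fc x i 0) + complex.Re (gc x i 0))); last first.
  by apply/funext => x; rewrite !mxE !ReImE.
rewrite (_ : (fun x => complex.Im _) = (fun x => complex.Re c * complex.Im (fc x i 0)
   + complex.Im c * complex.Re (fc x i 0) + complex.Im (gc x i 0))); last first.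
  by apply/funext => x; rewrite !mxE !ReImE.
split; apply: cvgD => //; [apply: cvgB|apply: cvgD]; apply: cvgM => //; exact: cvg_cst.
Qed.

Lemma solves_wave_lin (c : R[i]) f g u v : solves_wave f g -> solves_wave u v ->
  solves_wave (fun r => c *: f r + u r) (fun r => c *: g r + v r).
Proof.
move=> [[f1 f2] [f3 f4]] [[u1 u2] [u3 u4]].
have L (A B C D E F : R -> R) :
    ac_primitive A B -> ac_primitive C D -> ac_primitive E F ->
    ac_primitive (fun r => complex.Re c * A r - complex.Im c * C r + E r)
      (fun r => complex.Re c * B r - complex.Im c * D r + F r) /\
    ac_primitive (fun r => complex.Re c * C r + complex.Im c * A r + E r)
      (fun r => complex.Re c * D r + complex.Im c * B r + F r).
  move=> h1 h2 h3; split.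
    apply: ac_primitive_eq (ac_primitiveD (ac_primitiveD (ac_primitiveZ (complex.Re c) h1)
      (ac_primitiveZ (- complex.Im c) h2)) h3) => r _ /=; ring.
  exact: (ac_primitiveD (ac_primitiveD (ac_primitiveZ (complex.Re c) h2)
    (ac_primitiveZ (complex.Im c) h1)) h3).
split; split.
- apply: ac_primitive_eq (L _ _ _ _ _ _ f1 f3 u1).1 => r r0; rewrite !mxE !ReImE /=; ring.
- apply: ac_primitive_eq (L _ _ _ _ _ _ f2 f4 u2).1 => r r0; rewrite !mxE !ReImE /=; ring.
- apply: ac_primitive_eq (L _ _ _ _ _ _ f1 f3 u3).2 => r r0; rewrite !mxE !ReImE /=; ring.
- apply: ac_primitive_eq (L _ _ _ _ _ _ f2 f4 u4).2 => r r0; rewrite !mxE !ReImE /=; ring.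
Qed.

Lemma dirac_max_lin (c : R[i]) f g u v : dmax (f, g) -> dmax (u, v) ->
  dmax (fun r => c *: f r + u r, fun r => c *: g r + v r).
Proof.
move=> /dirac_max_solves[Lf Lg [fc rf sf]] /dirac_max_solves[Lu Lv [uc ru su]].
apply/dirac_max_solves; split; [exact: L2_lin|exact: L2_lin|].
exists (fun r => c *: fc r + uc r); first exact: continuous_representative_lin.
exact: solves_wave_lin.
Qed.

Lemma dirac_max_fun f g g' : dmax (f, g) -> dmax (f, g') -> aeq g g'.
Proof.
move=> /dirac_max_weak[Lf /L2P Lg H1 H2] /dirac_max_weak[_ /L2P Lg' H1' H2'].
have [r0 r1] := weakly_solves_unique (Lg 0).1 (Lg 1).1 (Lg' 0).1 (Lg' 1).1 H1 H1'.
have [i0 i1] := weakly_solves_unique (Lg 0).2 (Lg 1).2 (Lg' 0).2 (Lg' 1).2 H2 H2'.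
by apply/aeqP; apply: ord2P.
Qed.

(** * The minimal operator and its adjoint *)

Definition test_wave f : Prop := forall i, test_function (fun r => f r i 0).

Lemma test_waveP f : test_wave f <-> forall i, real_test (re f i) /\ real_test (im f i).
Proof.
split=> H i; first by have /test_functionP := H i.
by apply/test_functionP; exact: H.
Qed.

Lemma test_wave_L2 f : test_wave f -> L2 f.
Proof.
move=> /test_waveP H; apply/L2P => i.
by split; apply: real_test_square_intg; [exact: (H i).1|exact: (H i).2].
Qed.

Lemma real_test_affine_inv (c d : R) (h : R -> R) : real_test h ->
  square_intg (fun r => (c + d / r) * h r).
Proof.
move=> th; have [x [y [x0 _ h0 _]]] := real_test_support th.
apply: (@square_intg_compact _ _ x y) => //; last by move=> r /h0 ->; rewrite mulr0.
move=> r r0; apply: cvgM; last by apply: smooth_continuous; have [] := th.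
apply: cvgD; first exact: cvg_cst.
by apply: cvgM; [exact: cvg_cst|apply: inv_continuous; rewrite gt_eqF].
Qed.

Lemma dirac_exprE f r :
  ((complex.Re (dirac_expr m nu mu lam k f r 0 0) =
     (m + p / r) * complex.Re (f r 0 0) + (- derive1 (re f 1) r + kap / r * complex.Re (f r 1 0))) *
   (complex.Im (dirac_expr m nu mu lam k f r 0 0) =
     (m + p / r) * complex.Im (f r 0 0) + (- derive1 (im f 1) r + kap / r * complex.Im (f r 1 0)))) *
  ((complex.Re (dirac_expr m nu mu lam k f r 1 0) =
     (derive1 (re f 0) r + kap / r * complex.Re (f r 0 0)) + (- m + q / r) * complex.Re (f r 1 0)) *
   (complex.Im (dirac_expr m nu mu lam k f r 1 0) =
     (derive1 (im f 0) r + kap / r * complex.Im (f r 0 0)) + (- m + q / r) * complex.Im (f r 1 0))).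
Proof. by rewrite /dirac_expr !cv2E !ReImE /= !mul0r; split; split; ring. Qed.

Lemma dirac_expr_L2 f : test_wave f -> L2 (dirac_expr m nu mu lam k f).
Proof.
move=> /test_waveP H; apply/L2P.
have A (g h : R -> R) (c d : R) : real_test g -> real_test h ->
    square_intg (fun r => (c + d / r) * g r + (- derive1 h r + kap / r * h r)) /\
    square_intg (fun r => (derive1 h r + kap / r * h r) + (c + d / r) * g r).
  move=> tg th; have s1 := real_test_affine_inv c d tg.
  have s2 := real_test_affine_inv 0 kap th.
  have s3 := real_test_square_intg (real_test_derive1 th).
  split.
    have := square_intgD s1 (square_intgD (square_intgZ (-1) s3) s2).
    by congr square_intg; apply/funext => r /=; ring.
  have := square_intgD (square_intgD s3 s2) s1.
  by congr square_intg; apply/funext => r /=; ring.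
apply: ord2P; split.
- have := (A _ _ m p (H 0).1 (H 1).1).1.
  by congr square_intg; apply/funext => r; rewrite dirac_exprE.
- have := (A _ _ m p (H 0).2 (H 1).2).1.
  by congr square_intg; apply/funext => r; rewrite dirac_exprE.
- have := (A _ _ (- m) q (H 1).1 (H 0).1).2.
  by congr square_intg; apply/funext => r; rewrite dirac_exprE.
- have := (A _ _ (- m) q (H 1).2 (H 0).2).2.
  by congr square_intg; apply/funext => r; rewrite dirac_exprE.
Qed.

Lemma dirac_min_test f : test_wave f -> dmin (f, dirac_expr m nu mu lam k f).
Proof.
move=> tf; split; first exact: test_wave_L2.
split; first exact: dirac_expr_L2.
by exists f; split=> //; split; exact: aeq_refl.
Qed.

Lemma test_wave_solves f : test_wave f -> solves_wave f (dirac_expr m nu mu lam k f).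
Proof.
move=> /test_waveP H; have S (h : R -> R) : real_test h -> ac_primitive h (derive1 h).
  by move=> [sh _]; exact: smooth_ac_primitive.
split; split.
- by apply: ac_primitive_eq (S _ (H 0).1) => r _ //; rewrite dirac_exprE; ring.
- by apply: ac_primitive_eq (S _ (H 1).1) => r _ //; rewrite dirac_exprE; ring.
- by apply: ac_primitive_eq (S _ (H 0).2) => r _ //; rewrite dirac_exprE; ring.
- by apply: ac_primitive_eq (S _ (H 1).2) => r _ //; rewrite dirac_exprE; ring.
Qed.

Lemma test_wave_continuous f g : test_wave f -> aeq g f -> continuous_representative g f.
Proof.
move=> /test_waveP H gf; split=> // i r _.
by split; apply: smooth_continuous; [have [[]] := H i|have [_ []] := H i].
Qed.

Lemma dirac_min_max f g : dmin (f, g) -> dmax (f, g).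
Proof.
move=> [/= Lf [Lg [h [th [fh gh]]]]].
apply: (@dirac_max_aeq h (dirac_expr m nu mu lam k h)) => //; [|exact: aeq_sym..].
apply/dirac_max_solves; split; [exact: test_wave_L2|exact: dirac_expr_L2|].
exists h; last exact: test_wave_solves.
by apply: test_wave_continuous => //; exact: aeq_refl.
Qed.

Lemma test_wave_near0 f : test_wave f -> \forall r \near 0^'+, f r = 0.
Proof.
move=> /test_waveP H.
have Z (h : R -> R) : real_test h -> \forall r \near 0^'+, h r = 0.
  move=> /real_test_support[x [y [x0 _ h0 _]]]; near=> r.
  apply: h0; rewrite negb_and -leNgt; apply/orP; left.
  by near: r; exact: nbhs_right_le.
have [[r0 i0] [r1 i1]] := (H 0, H 1).
have Z0 : \forall r \near 0^'+, f r 0 0 = 0.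
  move: (Z _ r0) (Z _ i0); apply: filterS2 => r e1 e2; exact: complex_ext.
have Z1 : \forall r \near 0^'+, f r 1 0 = 0.
  move: (Z _ r1) (Z _ i1); apply: filterS2 => r e1 e2; exact: complex_ext.
move: Z0 Z1; apply: filterS2 => r e1 e2.
by apply: colvec_ext; rewrite ?e1 ?e2 !mxE.
Unshelve. all: by end_near. Qed.

Lemma test_function_conj phi : test_function phi -> test_function (fun r => (phi r)^*).
Proof.
move=> /test_functionP[t1 t2]; apply/test_functionP; split.
  by move: t1; congr real_test; apply/funext => r; rewrite ReJ.
by have := real_testZ (-1) t2; congr real_test; apply/funext => r; rewrite ImJ mulN1r.
Qed.

Lemma derivC_conj phi r : test_function phi ->
  Defs.derivC (fun r => (phi r)^*) r = (Defs.derivC phi r)^*.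
Proof.
move=> /test_functionP[[s1 _] [s2 _]].
apply: complex_ext; rewrite /Defs.derivC ?ReJ ?ImJ /=.
  by congr (derive1 _ r); apply/funext => t; rewrite ReJ.
rewrite (_ : (fun x => complex.Im _) = - (fun x => complex.Im (phi x))); last first.
  by apply/funext => t; rewrite ImJ.
by rewrite !derive1E deriveN//; exact: smooth_derivable.
Qed.

Lemma test_function0 : test_function (fun=> 0 : R[i]).
Proof. by apply/test_functionP; split; exact: real_test0. Qed.

(** Pairing with test waves whose only non-zero component is the conjugate of
    [phi] recovers the two distributional equations. *)
Lemma adjoint_dirac_min : adjoint dmin `<=` dmax.
Proof.
move=> [u v] [/= Lu [Lv H]]; split=> //; split=> // phi tphi.
have tc := test_function_conj tphi.
have D0 r : Defs.derivC (fun=> 0 : R[i]) r = 0.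
  by rewrite /Defs.derivC /= derive1_cst.
pose f1 : wave R := fun r => cv2 ((phi r)^*) 0.
pose f2 : wave R := fun r => cv2 0 ((phi r)^*).
have E1 : (forall r, f1 r 0 0 = (phi r)^*) * (forall r, f1 r 1 0 = 0).
  by split=> r; rewrite /f1 !cv2E.
have E2 : (forall r, f2 r 0 0 = 0) * (forall r, f2 r 1 0 = (phi r)^*).
  by split=> r; rewrite /f2 !cv2E.
have t1 : test_wave f1.
  apply: ord2P.
    by move: tc; congr test_function; apply/funext => r; rewrite E1.
  by move: test_function0; congr test_function; apply/funext => r; rewrite E1.
have t2 : test_wave f2.
  apply: ord2P.
    by move: test_function0; congr test_function; apply/funext => r; rewrite E2.
  by move: tc; congr test_function; apply/funext => r; rewrite E2.
have M (a b c d : R -> R[i]) : (forall r, a r = c r) -> (forall r, b r = d r) ->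
    integralC a = integralC b -> integralC c = integralC d.
  by move=> /funext -> /funext ->.
have DJ r : Defs.derivC (fun x => (phi x)^*) r = (Defs.derivC phi r)^*.
  exact: derivC_conj.
have F1 r : Defs.derivC (fun x => f1 x 0 0) r = (Defs.derivC phi r)^* /\
    Defs.derivC (fun x => f1 x 1 0) r = 0.
  rewrite (_ : (fun x => f1 x 0 0) = fun x => (phi x)^*); last by apply/funext => x; rewrite E1.
  by rewrite (_ : (fun x => f1 x 1 0) = fun=> 0) ?D0 ?DJ//; apply/funext => x; rewrite E1.
have F2 r : Defs.derivC (fun x => f2 x 1 0) r = (Defs.derivC phi r)^* /\
    Defs.derivC (fun x => f2 x 0 0) r = 0.
  rewrite (_ : (fun x => f2 x 1 0) = fun x => (phi x)^*); last by apply/funext => x; rewrite E2.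
  by rewrite (_ : (fun x => f2 x 0 0) = fun=> 0) ?D0 ?DJ//; apply/funext => x; rewrite E2.
have H1 := esym (H _ _ (dirac_min_test t1)); have H2 := esym (H _ _ (dirac_min_test t2)).
split.
  move: H1; apply: M => r; rewrite sum_I2 /= /dirac_expr ?cv2E ?E1 ?(F1 r).1 ?(F1 r).2;
  move: (phi r) (Defs.derivC phi r) (u r 0 0) (u r 1 0) (v r 0 0) (v r 1 0)
    => [? ?] [? ?] [? ?] [? ?] [? ?] [? ?]; by apply: complex_ext => /=; ring.
move: H2; apply: M => r; rewrite sum_I2 /= /dirac_expr ?cv2E ?E2 ?(F2 r).1 ?(F2 r).2;
move: (phi r) (Defs.derivC phi r) (u r 0 0) (u r 1 0) (v r 0 0) (v r 1 0)
  => [? ?] [? ?] [? ?] [? ?] [? ?] [? ?]; by apply: complex_ext => /=; ring.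
Qed.

(** The domain contains all test waves, and the four real components of a wave are
    approximated separately. *)
Lemma dense_above_dirac_min (T : graph R) : dmin `<=` T -> densely_defined T.
Proof.
move=> sT u Lu e e0; have /L2P Lu' := Lu.
have A i : exists2 z : (R -> R) * (R -> R), real_test z.1 /\ real_test z.2 &
    dot (fun r => re u i r - z.1 r) (fun r => re u i r - z.1 r) < e ^+ 2 / 4 /\
    dot (fun r => im u i r - z.2 r) (fun r => im u i r - z.2 r) < e ^+ 2 / 4.
  have e4 : 0 < e ^+ 2 / 4 by rewrite divr_gt0// exprn_gt0.
  have [a ta ha] := (square_intg_approximable (Lu' i).1).2 _ e4.
  have [b tb hb] := (square_intg_approximable (Lu' i).2).2 _ e4.
  by exists (a, b).
have [[a0 b0] /= [ta0 tb0] [ha0 hb0]] := A 0.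
have [[a1 b1] /= [ta1 tb1] [ha1 hb1]] := A 1.
pose f : wave R := fun r => cv2 (a0 r +i* b0 r) (a1 r +i* b1 r).
have E : ((re f 0 = a0) * (im f 0 = b0)) * ((re f 1 = a1) * (im f 1 = b1)).
  by split; split; apply/funext => r; rewrite /f cv2E.
have tf : test_wave f by apply/test_waveP; apply: ord2P; rewrite !E.
exists f.
  by exists (dirac_expr m nu mu lam k f); apply: sT; exact: dirac_min_test.
have Luf : L2 (fun r => u r - f r).
  have := L2_lin (-1) (test_wave_L2 tf) Lu.
  by congr L2; apply/funext => r; rewrite scaleN1r addrC.
have N (g h : R -> R) i : g = re f i -> h = im f i ->
    (re (fun r => u r - f r) i = (fun r => re u i r - g r)) /\
    (im (fun r => u r - f r) i = (fun r => im u i r - h r)).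
  by move=> -> ->; split; apply/funext => r; rewrite !mxE !ReImE.
rewrite /L2norm innerE//=.
have [-> ->] := N a0 b0 0 (esym E.1.1) (esym E.1.2).
have [-> ->] := N a1 b1 1 (esym E.2.1) (esym E.2.2).
have -> : e = Num.sqrt (e ^+ 2) by rewrite sqrtr_sqr gtr0_norm.
rewrite ltr_sqrt ?exprn_gt0//.
lra.
Qed.

(** * Boundary data of complex waves *)

Variables (d sigma C : R) (a b : R -> R).
Hypothesis prop : propagator p q kap d sigma C a b.
Implicit Types (A B : R[i]).

Definition wave_boundary fc A B : Prop :=
  boundary_data p q kap a b (re fc 0) (re fc 1) (complex.Re A) (complex.Re B) /\
  boundary_data p q kap a b (im fc 0) (im fc 1) (complex.Im A) (complex.Im B).

Definition has_boundary f A B : Prop :=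
  exists2 fc, continuous_representative f fc & wave_boundary fc A B.

Lemma boundary_data_near (up um vp vm : R -> R) (x y : R) :
  (\forall r \near 0^'+, up r = vp r) -> (\forall r \near 0^'+, um r = vm r) ->
  boundary_data p q kap a b up um x y -> boundary_data p q kap a b vp vm x y.
Proof.
move=> ep em [h1 h2]; split; [apply: cvg_trans h1|apply: cvg_trans h2];
  apply: near_eq_cvg; near=> r.
  by congr (pullp _ _ _ _ _ _ r); near: r.
by congr (pullm _ _ _ _ _ _ r); near: r.
Unshelve. all: by end_near. Qed.

Lemma boundary_data_lin (s t : R) (up um vp vm : R -> R) (x y x' y' : R) :
  boundary_data p q kap a b up um x y -> boundary_data p q kap a b vp vm x' y' ->
  boundary_data p q kap a b (fun r => s * up r + t * vp r) (fun r => s * um r + t * vm r)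
    (s * x + t * x') (s * y + t * y').
Proof.
move=> [h1 h2] [h1' h2']; split.
  rewrite (_ : (fun r => _) = (fun r => s * pullp q kap a b (up r) (um r) r +
      t * pullp q kap a b (vp r) (vm r) r)).
    by apply: cvgD; apply: cvgM => //; exact: cvg_cst.
  by apply/funext => r; rewrite /pullp; ring.
rewrite (_ : (fun r => _) = (fun r => s * pullm p kap a b (up r) (um r) r +
    t * pullm p kap a b (vp r) (vm r) r)).
  by apply: cvgD; apply: cvgM => //; exact: cvg_cst.
by apply/funext => r; rewrite /pullm; ring.
Qed.

Lemma has_boundary_aeq f f' A B : aeq f f' -> has_boundary f A B -> has_boundary f' A B.
Proof.
by move=> e [fc [h c] w]; exists fc => //; split=> //; exact: aeq_trans (aeq_sym e) h.
Qed.

Lemma has_boundary_lin (c : R[i]) f g A B A' B' :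
  has_boundary f A B -> has_boundary g A' B' ->
  has_boundary (fun r => c *: f r + g r) (c * A + A') (c * B + B').
Proof.
move=> [fc rf [f1 f2]] [gc rg [g1 g2]]; exists (fun r => c *: fc r + gc r).
  exact: continuous_representative_lin.
split.
  have := boundary_data_lin 1 1 (boundary_data_lin (complex.Re c) (- complex.Im c) f1 f2) g1.
  by congr boundary_data; try apply/funext => r; rewrite ?mxE ?ReImE /= ?mxE ?ReImE; ring.
have := boundary_data_lin 1 1 (boundary_data_lin (complex.Re c) (complex.Im c) f2 f1) g2.
by congr boundary_data; try apply/funext => r; rewrite ?mxE ?ReImE /= ?mxE ?ReImE; ring.
Qed.

(** Test waves vanish near the origin. *)
Lemma has_boundary_min f g : dmin (f, g) -> has_boundary f 0 0.
Proof.
move=> [/= Lf [Lg [h [th [fh gh]]]]]; exists h; first exact: test_wave_continuous.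
have N := test_wave_near0 th.
have Z : boundary_data p q kap a b (fun=> 0) (fun=> 0) 0 0.
  split.
    rewrite (_ : (fun r => _) = fun=> 0); first exact: cvg_cst.
    by apply/funext => r; rewrite /pullp; ring.
  rewrite (_ : (fun r => _) = fun=> 0); first exact: cvg_cst.
  by apply/funext => r; rewrite /pullm; ring.
by split; move: Z; apply: boundary_data_near; move: N; apply: filterS => r ->; rewrite !mxE.
Qed.

Lemma has_boundary_exists f g : dmax (f, g) -> exists A B, has_boundary f A B.
Proof.
move=> /dirac_max_solves[Lf Lg [fc rf [s1 s2]]].
have /L2P Mf := continuous_representative_L2 rf Lf; have /L2P Mg := Lg.
have [x [y [h _ _]]] :=
  boundary_data_exists prop s1 (Mf 0).1 (Mf 1).1 (Mg 0).1 (Mg 1).1.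
have [x' [y' [h' _ _]]] :=
  boundary_data_exists prop s2 (Mf 0).2 (Mf 1).2 (Mg 0).2 (Mg 1).2.
by exists (x +i* x'), (y +i* y'); exists fc.
Qed.

(** Real data suffice, since the boundary conditions of self-adjoint extensions
    are spanned by real vectors. *)
Lemma has_boundary_surjective (x y : R) :
  exists f g, dmax (f, g) /\ has_boundary f x%:C y%:C.
Proof.
have [up [um [gp [gm [s bd [sup sum sgp sgm]]]]]] := boundary_data_surjective m prop x y.
have [zp [zm [hp [hm [s' bd' [szp szm shp shm]]]]]] := boundary_data_surjective m prop 0 0.
pose fc : wave R := fun r => cv2 (up r +i* zp r) (um r +i* zm r).
pose g : wave R := fun r => cv2 (gp r +i* hp r) (gm r +i* hm r).
have E : ((re fc 0 = up) * (im fc 0 = zp)) * ((re fc 1 = um) * (im fc 1 = zm)).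
  by split; split; apply/funext => r; rewrite /fc cv2E.
have F : ((re g 0 = gp) * (im g 0 = hp)) * ((re g 1 = gm) * (im g 1 = hm)).
  by split; split; apply/funext => r; rewrite /g cv2E.
have rf : continuous_representative fc fc.
  split; first exact: aeq_refl.
  have c := solves_continuous s; have c' := solves_continuous s'.
  apply: ord2P => r r0; rewrite !E; first by split; [exact: (c r r0).1|exact: (c' r r0).1].
  by split; [exact: (c r r0).2|exact: (c' r r0).2].
exists fc, g; split.
  apply/dirac_max_solves; split.
  - by apply/L2P; apply: ord2P; rewrite !E.
  - by apply/L2P; apply: ord2P; rewrite !F.
  - by exists fc => //; rewrite /solves_wave !E !F.
by exists fc => //; rewrite /wave_boundary !E.
Qed.

(** The real formula is applied to each of the four pairs made of a real or
    imaginary part of [f] and one of [u]. *)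
Lemma green_wave f g u v A B A' B' : dmax (f, g) -> dmax (u, v) ->
  has_boundary f A B -> has_boundary u A' B' ->
  inner g u - inner f v = - (A^* * B' - B^* * A').
Proof.
move=> mf mu' [fc rf [f1 f2]] [uc ru [u1 u2]].
have [s1 s2] := dirac_max_representative mf rf.
have [t1 t2] := dirac_max_representative mu' ru.
have /dirac_max_solves[Lf Lg _] := mf; have /dirac_max_solves[Lu Lv _] := mu'.
have Lfc := continuous_representative_L2 rf Lf.
have Luc := continuous_representative_L2 ru Lu.
rewrite (inner_aeq Lg Lg Lu Luc (aeq_refl g) ru.1) (inner_aeq Lf Lfc Lv Lv rf.1 (aeq_refl v)).
rewrite !innerE//; move: Lfc Luc Lg Lv => /L2P Lfc /L2P Luc /L2P Mg /L2P Mv.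
have G11 := green prop s1 t1 (Lfc 0).1 (Lfc 1).1 (Mg 0).1 (Mg 1).1
  (Luc 0).1 (Luc 1).1 (Mv 0).1 (Mv 1).1 f1 u1.
have G12 := green prop s1 t2 (Lfc 0).1 (Lfc 1).1 (Mg 0).1 (Mg 1).1
  (Luc 0).2 (Luc 1).2 (Mv 0).2 (Mv 1).2 f1 u2.
have G21 := green prop s2 t1 (Lfc 0).2 (Lfc 1).2 (Mg 0).2 (Mg 1).2
  (Luc 0).1 (Luc 1).1 (Mv 0).1 (Mv 1).1 f2 u1.
have G22 := green prop s2 t2 (Lfc 0).2 (Lfc 1).2 (Mg 0).2 (Mg 1).2
  (Luc 0).2 (Luc 1).2 (Mv 0).2 (Mv 1).2 f2 u2.
have mh := @measurable_halfline R.
have RD := @RintegralD _ _ _ leb (halfline R).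
have RB := @RintegralB _ _ _ leb (halfline R).
have K (gp gm vp vm up um lp lm : R -> R) :
    square_intg gp -> square_intg gm -> square_intg vp -> square_intg vm ->
    square_intg up -> square_intg um -> square_intg lp -> square_intg lm ->
    \int[leb]_(r in halfline R)
     ((gp r * vp r + gm r * vm r) - (up r * lp r + um r * lm r)) =
    (dot gp vp + dot gm vm) - (dot up lp + dot um lm).
  move=> h1 h2 h3 h4 h5 h6 h7 h8.
  have i1 := square_intgM h1 h3; have i2 := square_intgM h2 h4.
  have i3 := square_intgM h5 h7; have i4 := square_intgM h6 h8.
  by rewrite (RB _ _ mh (intgD mh i1 i2) (intgD mh i3 i4)) (RD _ _ mh i1 i2) (RD _ _ mh i3 i4).
rewrite (K _ _ _ _ _ _ _ _ (Mg 0).1 (Mg 1).1 (Luc 0).1 (Luc 1).1 (Lfc 0).1 (Lfc 1).1 (Mv 0).1 (Mv 1).1) in G11.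
rewrite (K _ _ _ _ _ _ _ _ (Mg 0).1 (Mg 1).1 (Luc 0).2 (Luc 1).2 (Lfc 0).1 (Lfc 1).1 (Mv 0).2 (Mv 1).2) in G12.
rewrite (K _ _ _ _ _ _ _ _ (Mg 0).2 (Mg 1).2 (Luc 0).1 (Luc 1).1 (Lfc 0).2 (Lfc 1).2 (Mv 0).1 (Mv 1).1) in G21.
rewrite (K _ _ _ _ _ _ _ _ (Mg 0).2 (Mg 1).2 (Luc 0).2 (Luc 1).2 (Lfc 0).2 (Lfc 1).2 (Mv 0).2 (Mv 1).2) in G22.
move: G11 G12 G21 G22.
repeat match goal with |- context [dot ?x ?y] => move: (dot x y) => ? end.
by move=> G11 G12 G21 G22; apply: complex_ext; rewrite !ReImE /=; lra.
Qed.

(** * Self-adjoint restrictions of the maximal operator *)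

Lemma proportional_det (F : fieldType) (a1 a2 b1 b2 x y : F) : (x != 0) || (y != 0) ->
  a1 * y = a2 * x -> b1 * y = b2 * x -> a1 * b2 - a2 * b1 = 0.
Proof.
move=> xy0 ea eb; case/orP: xy0 => n0; apply: (mulIf n0); rewrite mul0r mulrBl.
  by rewrite -(mulrA a1) -eb (mulrAC a2) -ea; ring.
by rewrite -(mulrA a2) eb (mulrAC a1) ea; ring.
Qed.

(** The boundary datum is required to lie on the complex line spanned by the real
    vector [(x, y)]. *)
Definition boundary_restriction (x y : R) : graph R :=
  [set fg | dmax fg /\ exists A B, has_boundary fg.1 A B /\ A * y%:C = B * x%:C].

Lemma dirac_min_restriction x y : dmin `<=` boundary_restriction x y.
Proof.
move=> [f g] fg; split; first exact: dirac_min_max.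
by exists 0, 0; split; [exact: has_boundary_min fg|rewrite !mul0r].
Qed.

Lemma test_wave0 : test_wave (fun=> 0).
Proof. by apply: ord2P; move: test_function0; congr test_function; apply/funext => r; rewrite mxE. Qed.

Lemma boundary_restriction_lin x y (c : R[i]) f g u v :
  boundary_restriction x y (f, g) -> boundary_restriction x y (u, v) ->
  boundary_restriction x y (fun r => c *: f r + u r, fun r => c *: g r + v r).
Proof.
move=> [/= mf [A [B [hf e]]]] [/= mu' [A' [B' [hu e']]]]; split; first exact: dirac_max_lin.
exists (c * A + A'), (c * B + B'); split; first exact: has_boundary_lin.
by rewrite !mulrDl -!mulrA e e'.
Qed.

Lemma boundary_restriction_linear x y : linear_operator (boundary_restriction x y).
Proof.
split.
- by move=> f g [/dirac_max_solves[]].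
- move=> f g f' g' [/= mf [A [B [hf e]]]] Lf' Lg' ff gg; split.
    exact: dirac_max_aeq mf Lf' Lg' ff gg.
  by exists A, B; split=> //; exact: has_boundary_aeq hf.
- by move=> f g g' [h _] [h' _]; exact: dirac_max_fun h h'.
- have H := @dirac_min_restriction x y _ (dirac_min_test test_wave0) : boundary_restriction x y _.
  by have := boundary_restriction_lin (-1) H H; congr boundary_restriction; congr pair;
    apply/funext => r; rewrite scaleN1r addNr.
- by move=> c f g u v; exact: boundary_restriction_lin.
Qed.

Lemma adjoint_anti (S T : graph R) : S `<=` T -> adjoint T `<=` adjoint S.
Proof. by move=> ST [u v] [Lu [Lv H]]; split=> //; split=> // f g /ST; exact: H. Qed.

(** By Green's formula the boundary form is the determinant of the conjugate of one
    datum and the other. It vanishes between data on the same real line;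
    conversely, an element of the adjoint is orthogonal for this form to one
    whose datum is [(x, y)], which puts its own datum on that line. *)
Lemma boundary_restriction_adjoint (x y : R) : (x != 0) || (y != 0) ->
  boundary_restriction x y = adjoint (boundary_restriction x y).
Proof.
move=> xy0; apply/seteqP; split=> [[u v] [/= mu' [A' [B' [hu e']]]]|[u v] H].
  have /dirac_max_solves[Lu Lv _] := mu'; split=> //; split=> // f g [/= mf [A [B [hf e]]]].
  apply/eqP; rewrite -subr_eq0 (green_wave mf mu' hf hu) oppr_eq0.
  have ej : A^* * y%:C = B^* * x%:C.
    by move: e => /(congr1 (@conjc R)); rewrite !rmorphM /= oppr0.
  by apply/eqP; apply: proportional_det ej e'; rewrite !fmorph_eq0.
have := adjoint_anti (@dirac_min_restriction x y) H => /adjoint_dirac_min mu'.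
have [A' [B' hu]] := has_boundary_exists mu'.
split=> //; exists A', B'; split=> //.
have [f [g [mf hf]]] := has_boundary_surjective x y.
have T : boundary_restriction x y (f, g).
  by split=> //; exists x%:C, y%:C; split=> //; rewrite mulrC.
have [/= _ [_ /(_ f g T) E]] := H.
have := green_wave mf mu' hf hu.
rewrite E subrr => /esym/eqP; rewrite oppr_eq0 subr_eq0 => /eqP.
move=> e; have e1 := congr1 (@complex.Re R) e; have e2 := congr1 (@complex.Im R) e.
by apply: complex_ext; move: e1 e2; rewrite !ReImE /=; lra.
Qed.

Lemma boundary_restriction_self_adjoint (x y : R) : (x != 0) || (y != 0) ->
  self_adjoint (boundary_restriction x y).
Proof.
move=> xy0; split; first exact: boundary_restriction_linear.
split; last exact: boundary_restriction_adjoint.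
by apply: dense_above_dirac_min; exact: dirac_min_restriction.
Qed.

(** Isotropy says that [A^* * B] is real; multiplying [(A, B)] by the conjugate of
    a non-zero coordinate then gives a real vector on the same complex line. *)
Lemma isotropic_real (A B : R[i]) : (A != 0) || (B != 0) -> A^* * B = B^* * A ->
  exists x y : R, (x != 0) || (y != 0) /\
    forall A' B', A^* * B' = B^* * A' -> A' * y%:C = B' * x%:C.
Proof.
have [->|A0] := eqVneq A 0.
  rewrite /= => B0 _; exists 0, 1; split; first by rewrite oner_eq0 orbT.
  move=> A' B'; rewrite conjC0 mul0r => /esym/eqP; rewrite mulf_eq0 conjC_eq0 (negPf B0) /=.
  by move=> /eqP ->; rewrite mul0r mulr0.
move=> _ e.
have yE : A^* * B = (complex.Re (A^* * B))%:C.
  apply: complex_ext => //=; have := congr1 (@complex.Im R) e.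
  by rewrite !ReImE /=; lra.
have xE : A^* * A = (complex.Re (A^* * A))%:C.
  by apply: complex_ext => //=; rewrite !ReImE /=; ring.
exists (complex.Re (A^* * A)), (complex.Re (A^* * B)); split.
  by rewrite -(inj_eq (@complexI R)) -xE mulf_eq0 conjC_eq0 (negPf A0).
move=> A' B' e'; rewrite -xE -yE e mulrA (mulrC A') -e' .
by rewrite (mulrC _ B') mulrA.
Qed.

(** The data of the domain are isotropic, so one non-zero datum places all of them
    on a real line, and self-adjoint operators have no proper self-adjoint
    extension. Were all data zero, [T] would for the same reason be the
    restriction to any chosen line, where non-zero data are attained. *)
Lemma self_adjoint_above_min (T : graph R) : self_adjoint T -> dmin `<=` T ->
  exists x y : R, (x != 0) || (y != 0) /\ T = boundary_restriction x y.
Proof.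
move=> [_ [_ TT]] sT.
have Tmax : T `<=` dmax by rewrite TT; exact: subset_trans (adjoint_anti sT) adjoint_dirac_min.
have maximal (x y : R) : (x != 0) || (y != 0) -> T `<=` boundary_restriction x y ->
    T = boundary_restriction x y.
  move=> xy0 s; apply/seteqP; split=> //.
  by rewrite TT (boundary_restriction_adjoint xy0); exact: adjoint_anti.
have green0 f g u v A B A' B' : T (f, g) -> T (u, v) -> has_boundary f A B ->
    has_boundary u A' B' -> A^* * B' = B^* * A'.
  move=> h h' hf hu; have := green_wave (Tmax _ h) (Tmax _ h') hf hu.
  move: h'; rewrite {1}TT => -[_ [_ /(_ f g h) ->]]; rewrite subrr => /esym/eqP.
  by rewrite oppr_eq0 subr_eq0 => /eqP.
have [[[f g] [A [B [h hf AB]]]]|N] := pselect (exists fg A B,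
    [/\ T fg, has_boundary fg.1 A B & (A != 0) || (B != 0)]).
  have [x [y [xy0 H]]] := isotropic_real AB (green0 _ _ _ _ _ _ _ _ h h hf hf).
  exists x, y; split=> //; apply: maximal => // -[u v] h'; split; first exact: Tmax.
  have [A' [B' hu]] := has_boundary_exists (Tmax _ h').
  by exists A', B'; split=> //; apply: H; exact: (green0 _ _ _ _ _ _ _ _ h h' hf hu).
exfalso; apply: (N).
have [f [g [mf hf]]] := has_boundary_surjective 1 0.
have n10 : (1 != 0 :> R) || (0 != 0 :> R) by rewrite oner_eq0.
exists (f, g), 1%:C, 0%:C; split=> //; last by rewrite fmorph_eq0 oner_eq0.
rewrite (maximal 1 0 n10); first by split=> //; exists 1%:C, 0%:C; split=> //; rewrite mulrC.
move=> [u v] h; split; first exact: Tmax.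
have [A [B hu]] := has_boundary_exists (Tmax _ h).
exists A, B; split=> //.
have [B0|B0] := eqVneq B 0; first by rewrite B0 mul0r mulr0.
by exfalso; apply: N; exists (u, v), A, B; split=> //; rewrite B0 orbT.
Qed.

(** * Boundary data as asymptotic expansions *)

Lemma norm2_cvg0 (v : wave R) (w : R -> R) : (forall r, 0 <= w r) ->
  (norm2 (v r) * w r @[r --> 0^'+] --> (0 : R)) <->
  (forall i, (complex.Re (v r i 0) * w r @[r --> 0^'+] --> (0 : R)) /\
             (complex.Im (v r i 0) * w r @[r --> 0^'+] --> (0 : R))).
Proof.
move=> w0; split=> [H i|H].
  have le r : `|complex.Re (v r i 0)| <= norm2 (v r) /\ `|complex.Im (v r i 0)| <= norm2 (v r).
    split; rewrite -sqrtr_sqr; apply: ler_wsqrtr; rewrite (bigD1 i)//=.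
      rewrite -addrA lerDl addr_ge0 ?sqr_ge0// sumr_ge0// => j _.
      by rewrite addr_ge0 ?sqr_ge0.
    rewrite -addrA addrCA lerDl addr_ge0 ?sqr_ge0// sumr_ge0// => j _.
    by rewrite addr_ge0 ?sqr_ge0.
  split; apply: cvg0_squeeze H; apply: nearW => r;
    by rewrite normrM (ger0_norm (w0 r)) ler_wpM2r//; have [] := le r.
have [h1 h2] := H 0; have [h3 h4] := H 1.
have N (h : R -> R) : h r @[r --> 0^'+] --> (0 : R) -> `|h r| @[r --> 0^'+] --> (0 : R).
  by move=> ?; exact/norm_cvg0P.
have Hs : `|complex.Re (v r 0 0) * w r| + `|complex.Im (v r 0 0) * w r| +
    (`|complex.Re (v r 1 0) * w r| + `|complex.Im (v r 1 0) * w r|) @[r --> 0^'+] --> (0 : R).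
  by apply: cvg0D; apply: cvg0D; exact: N.
apply: cvg0_squeeze Hs.
apply: nearW => r; rewrite !normrM !(ger0_norm (w0 r)) -!mulrDl ler_wpM2r// /norm2 sum_I2.
rewrite ger0_norm ?sqrtr_ge0// -[leRHS]ger0_norm ?addr_ge0// -sqrtr_sqr ler_wsqrtr//.
rewrite -(real_normK (num_real (complex.Re (v r 0 0)))) -(real_normK (num_real (complex.Im (v r 0 0)))).
rewrite -(real_normK (num_real (complex.Re (v r 1 0)))) -(real_normK (num_real (complex.Im (v r 1 0)))).
set x := `|_|; set y := `|_|; set z := `|_|; set t := `|_|.
have [x0 [y0 [z0 t0]]] : 0 <= x /\ 0 <= y /\ 0 <= z /\ 0 <= t by rewrite !normr_ge0.
by nra.
Qed.
(** The matrix [r^M]. *)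
Definition flow_mx (r : R) : 'M[R]_2 := b r *: Mmx nu mu lam k + (a r)%:M.

Lemma mulmx_cv2 (D : 'M[R]_2) (z w : R[i]) :
  toC D *m cv2 z w = cv2 ((D 0 0)%:C * z + (D 0 1)%:C * w) ((D 1 0)%:C * z + (D 1 1)%:C * w).
Proof. by apply: colvec_ext; rewrite !mxE sum_I2 !mxE. Qed.

Lemma flow_mxE (r : R) : ((flow_mx r 0 0 = b r * - kap + a r) * (flow_mx r 0 1 = b r * - q)) *
  ((flow_mx r 1 0 = b r * p) * (flow_mx r 1 1 = b r * kap + a r)).
Proof.
by rewrite /flow_mx !mxE /= mulr1n mulr0n; split; split; ring.
Qed.

Definition wave_asymptotic fc A B : Prop :=
  asymptotic p q kap a b (re fc 0) (re fc 1) (complex.Re A) (complex.Re B) /\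
  asymptotic p q kap a b (im fc 0) (im fc 1) (complex.Im A) (complex.Im B).

Lemma norm2_asymptotic fc A B :
  (norm2 (fc r - toC (flow_mx r) *m cv2 A B) * r `^ (- 2^-1) @[r --> 0^'+] --> (0 : R)) <->
  wave_asymptotic fc A B.
Proof.
rewrite (norm2_cvg0 (fun r => fc r - toC (flow_mx r) *m cv2 A B)
  (w := fun r => r `^ (- 2^-1))); last by move=> r; exact: powR_ge0.
have E r : ((complex.Re ((fc r - toC (flow_mx r) *m cv2 A B) 0 0) =
     complex.Re (fc r 0 0) - flowp q kap a b (complex.Re A) (complex.Re B) r) *
   (complex.Im ((fc r - toC (flow_mx r) *m cv2 A B) 0 0) =
     complex.Im (fc r 0 0) - flowp q kap a b (complex.Im A) (complex.Im B) r)) *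
   ((complex.Re ((fc r - toC (flow_mx r) *m cv2 A B) 1 0) =
     complex.Re (fc r 1 0) - flowm p kap a b (complex.Re A) (complex.Re B) r) *
   (complex.Im ((fc r - toC (flow_mx r) *m cv2 A B) 1 0) =
     complex.Im (fc r 1 0) - flowm p kap a b (complex.Im A) (complex.Im B) r)).
  rewrite mulmx_cv2 !flow_mxE.
  have S (u v : 'cV[R[i]]_2) i : (u - v) i 0 = u i 0 - v i 0 by rewrite !mxE.
  by rewrite !S !cv2E !ReImE /= /flowp /flowm; split; split; ring.
have S (g h : R -> R) : g =1 h ->
    g r * r `^ (- 2^-1) @[r --> 0^'+] --> (0 : R) ->
    h r * r `^ (- 2^-1) @[r --> 0^'+] --> (0 : R) by move=> /funext ->.
split.
  move=> H; have [h1 h2] := H 0; have [h3 h4] := H 1.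
  by split; split; [exact: (S _ _ (fun r => (E r).1.1) h1)|exact: (S _ _ (fun r => (E r).2.1) h3)
    |exact: (S _ _ (fun r => (E r).1.2) h2)|exact: (S _ _ (fun r => (E r).2.2) h4)].
move=> [[h1 h3] [h2 h4]]; apply: ord2P; split.
- exact: (S _ _ (fun r => esym (E r).1.1) h1).
- exact: (S _ _ (fun r => esym (E r).1.2) h2).
- exact: (S _ _ (fun r => esym (E r).2.1) h3).
- exact: (S _ _ (fun r => esym (E r).2.2) h4).
Qed.

Lemma wave_boundary_asymptotic f g fc A B : dmax (f, g) -> continuous_representative f fc ->
  wave_boundary fc A B <-> wave_asymptotic fc A B.
Proof.
move=> mf rf; split=> [[h1 h2]|[h1 h2]]; last first.
  by split; apply: (asymptotic_boundary_data prop).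
have [s1 s2] := dirac_max_representative mf rf.
have /dirac_max_solves[Lf Lg _] := mf.
have /L2P Lfc := continuous_representative_L2 rf Lf; have /L2P Mg := Lg.
split.
  exact: (boundary_data_asymptotic prop s1 (Lfc 0).1 (Lfc 1).1 (Mg 0).1 (Mg 1).1 h1).
exact: (boundary_data_asymptotic prop s2 (Lfc 0).2 (Lfc 1).2 (Mg 0).2 (Mg 1).2 h2).
Qed.

Lemma domain_boundary_restriction (x y : R) f : domain (boundary_restriction x y) f <->
  domain dmax f /\ exists fc, continuous_representative f fc /\ exists A B,
    A * y%:C = B * x%:C /\
    (norm2 (fc r - toC (flow_mx r) *m cv2 A B) * r `^ (- 2^-1) @[r --> 0^'+] --> (0 : R)).
Proof.
split=> [[g [/= mf [A [B [[fc rf bd] e]]]]]|[[g mf] [fc [rf [A [B [e bd]]]]]]].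
  split; first by exists g.
  exists fc; split=> //; exists A, B; split=> //.
  by apply/norm2_asymptotic; exact: (wave_boundary_asymptotic A B mf rf).1.
exists g; split=> //; exists A, B; split=> //; exists fc => //.
by apply/(wave_boundary_asymptotic A B mf rf)/norm2_asymptotic.
Qed.

Lemma boundary_restrictionZ (c x y : R) : c != 0 ->
  boundary_restriction (c * x) (c * y) = boundary_restriction x y.
Proof.
move=> c0; have cc0 : c%:C != 0 by rewrite fmorph_eq0.
apply/seteqP; split=> -[f g] [mf [A [B [h e]]]]; split=> //; exists A, B; split=> //.
  by apply: (mulfI cc0); rewrite !(mulrCA c%:C) -!rmorphM.
by rewrite !rmorphM !(mulrCA _ c%:C) e.
Qed.

(** * The half turn of self-adjoint extensions *)

Lemma det_mx2 (M : 'M[R]_2) : \det M = M 0 0 * M 1 1 - M 0 1 * M 1 0.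
Proof.
rewrite (expand_det_row _ 0) sum_I2 /cofactor !det_mx11 !mxE /=.
have -> : lift 0 0 = 1 :> 'I_2 by exact: val_inj.
have -> : lift 1 0 = 0 :> 'I_2 by exact: val_inj.
by rewrite expr0 expr1; ring.
Qed.

(** Half a turn is enough because the factor [c] may be negative. *)
Lemma half_turn_polar (x y : R) : (x != 0) || (y != 0) ->
  exists theta c : R, [/\ 0 <= theta < pi, c != 0, x = c * cos theta & y = c * - sin theta].
Proof.
move=> xy0; have pi0 := pi_gt0 R.
have [y0|y0] := eqVneq y 0.
  exists 0, x; rewrite y0 sin0 cos0 mulr1 oppr0 mulr0 lexx pi0; split=> //.
  by move: xy0; rewrite y0 eqxx orbF.
pose n := Num.sqrt (x ^+ 2 + y ^+ 2).
have n2 : n ^+ 2 = x ^+ 2 + y ^+ 2 by rewrite sqr_sqrtr// addr_ge0 ?sqr_ge0.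
have y2 : 0 < y ^+ 2 by rewrite exprn_even_gt0.
have n0 : 0 < n by rewrite sqrtr_gt0 ltr_wpDl ?sqr_ge0.
have xn : `|x| < n by rewrite -(@ltr_pXn2r _ 2)// ?nnegrE ?(ltW n0)// real_normK ?num_real// n2 ltrDl.
(* The sign of the factor is opposite to that of y, to keep the sine positive. *)
pose c := - Num.sg y * n.
have c2 : c ^+ 2 = n ^+ 2 by rewrite exprMn sqrrN sqr_sg y0 mul1r.
have c0 : c != 0 by rewrite mulf_neq0 ?oppr_eq0 ?sgr_eq0// gt_eqF.
have cn : `|c| = n by rewrite normrM normrN normr_sg y0 mul1r gtr0_norm.
have z1 : -1 < x / c < 1.
  by rewrite -ltr_norml normrM normfV cn ltr_pdivrMr// mul1r.
have z1' : -1 <= x / c <= 1 by case/andP: z1 => h h'; rewrite !ltW.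
have z1'' : -1 < x / c <= 1 by case/andP: z1 => h h'; rewrite h ltW.
exists (acos (x / c)), c; split=> //.
- by rewrite acos_ge0//= acos_ltpi.
- by rewrite acosK ?in_itv//= mulrC divfK.
- rewrite sin_acos// (_ : 1 - _ = (y / n) ^+ 2).
    rewrite sqrtr_sqr normrM normfV (gtr0_norm n0) {1}(numEsg y) /c.
    by field; rewrite gt_eqF.
  rewrite !exprMn !exprVn c2 -[in LHS](divff (_ : n ^+ 2 != 0)) ?sqrf_eq0 ?gt_eqF//.
  by rewrite -mulrBl n2; congr (_ / _); ring.
Qed.

(** In the basis given by the columns of [D], the condition
    [Ap * sin theta + Am * cos theta = 0] selects the line spanned by
    [(cos theta, - sin theta)]. Since [D] is real and invertible, these lines are
    exactly the real lines of data. *)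
Lemma self_adjoint_extensions (D : 'M[R]_2) (Q : R[i] -> R[i] -> wave R) :
  D \in unitmx ->
  (forall Ap Am r, 0 < r -> Q Ap Am r = toC (flow_mx r) *m (toC D *m cv2 Ap Am)) ->
  exists t : R -> graph R,
    (forall theta : R, 0 <= theta < pi ->
      dmin `<=` t theta /\
      self_adjoint (t theta) /\
      t theta `<=` dmax /\
      (forall f : wave R,
        domain (t theta) f <->
        domain dmax f /\
        exists fc : wave R, continuous_representative f fc /\
        exists Ap Am : R[i],
          Ap * (sin theta)%:C + Am * (cos theta)%:C = 0 /\
          (norm2 (fc r - Q Ap Am r) * r `^ (- 2^-1)) @[r --> 0^'+] --> (0 : R))) /\
    (forall T : graph R, self_adjoint T -> dmin `<=` T ->
      exists2 theta : R, 0 <= theta < pi & T = t theta).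
Proof.
move=> uD QE.
pose e := D 0 0 * D 1 1 - D 0 1 * D 1 0.
have e0 : e != 0 by move: uD; rewrite unitmxE unitfE det_mx2.
have eC0 : e%:C != 0 by rewrite fmorph_eq0.
pose x (c s : R) := D 0 0 * c + D 0 1 * s.
pose y (c s : R) := D 1 0 * c + D 1 1 * s.
have inv s t : exists c d, x c d = s /\ y c d = t.
  exists ((D 1 1 * s - D 0 1 * t) / e), ((D 0 0 * t - D 1 0 * s) / e).
  by rewrite /x /y; split; move: e0; rewrite /e => e0; field.
have nz (c s : R) : (c != 0) || (s != 0) -> (x c s != 0) || (y c s != 0).
  rewrite -!negb_and; apply: contraNN => /andP[/eqP x0 /eqP y0].
  have c0 : e * c = 0.
    transitivity (D 1 1 * x c s - D 0 1 * y c s); last by rewrite x0 y0 !mulr0 subr0.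
    by rewrite /e /x /y; ring.
  have s0 : e * s = 0.
    transitivity (D 0 0 * y c s - D 1 0 * x c s); last by rewrite x0 y0 !mulr0 subr0.
    by rewrite /e /x /y; ring.
  by move/eqP: c0; move/eqP: s0; rewrite !mulf_eq0 (negPf e0) /= => -> ->.
exists (fun theta => boundary_restriction (x (cos theta) (- sin theta)) (y (cos theta) (- sin theta))).
split.
  move=> theta _; split; first exact: dirac_min_restriction.
  split.
    apply: boundary_restriction_self_adjoint; apply: nz; rewrite oppr_eq0 -negb_and.
    apply/negP => /andP[/eqP c0 /eqP s0]; have := cos2Dsin2 theta.
    by rewrite c0 s0 expr0n /= addr0 => /esym/eqP; rewrite oner_eq0.
  split; first by move=> fg [].
  move=> f; rewrite domain_boundary_restriction.
  have key (Ap Am A B : R[i]) :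
     toC D *m cv2 Ap Am = cv2 A B ->
     Ap * (sin theta)%:C + Am * (cos theta)%:C = 0 <->
     A * (y (cos theta) (- sin theta))%:C = B * (x (cos theta) (- sin theta))%:C.
    rewrite mulmx_cv2 => /matrixP E; have := E 0 0; have := E 1 0; rewrite !cv2E => <- <-.
    have I : ((D 0 0)%:C * Ap + (D 0 1)%:C * Am) * (y (cos theta) (- sin theta))%:C -
      ((D 1 0)%:C * Ap + (D 1 1)%:C * Am) * (x (cos theta) (- sin theta))%:C =
      - e%:C * (Ap * (sin theta)%:C + Am * (cos theta)%:C).
      by rewrite /x /y /e !(rmorphD, rmorphM, rmorphN, rmorphB) /=; ring.
    split=> [h|/eqP]; first by apply/eqP; rewrite -subr_eq0 I h mulr0.
    by rewrite -subr_eq0 I mulf_eq0 oppr_eq0 (negPf eC0) => /eqP.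
  have col (v : 'cV[R[i]]_2) : v = cv2 (v 0 0) (v 1 0) by apply: colvec_ext; rewrite cv2E.
  have near_cvg Ap Am A B fc : toC D *m cv2 Ap Am = cv2 A B ->
      norm2 (fc r - toC (flow_mx r) *m cv2 A B) * r `^ (- 2^-1) @[r --> 0^'+] --> (0 : R) <->
      norm2 (fc r - Q Ap Am r) * r `^ (- 2^-1) @[r --> 0^'+] --> (0 : R).
    move=> E; split=> H; apply: cvg_trans H; apply: near_eq_cvg; near=> r;
      by rewrite QE ?E//; near: r; exact: nbhs_right_gt.
  split=> -[df [fc [rf]]].
    move=> [A [B [eAB bd]]]; split=> //; exists fc; split=> //.
    pose z := toC (invmx D) *m cv2 A B.
    have E : toC D *m cv2 (z 0 0) (z 1 0) = cv2 A B.
      by rewrite -col /z mulmxA -map_mxM mulmxV// map_mx1 mul1mx.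
    exists (z 0 0), (z 1 0); split; first exact: (key _ _ _ _ E).2.
    exact: (near_cvg _ _ _ _ _ E).1.
  move=> [Ap [Am [eA bd]]]; split=> //; exists fc; split=> //.
  pose z := toC D *m cv2 Ap Am; have E : z = cv2 (z 0 0) (z 1 0) by exact: col.
  exists (z 0 0), (z 1 0); split; first exact: (key _ _ _ _ E).1.
  exact: (near_cvg _ _ _ _ _ E).2.
move=> T sT mT; have [x0 [y0 [xy0 ->]]] := self_adjoint_above_min sT mT.
have [s [t [sE tE]]] := inv x0 y0.
have st0 : (s != 0) || (t != 0).
  rewrite -negb_and; apply: contraL xy0 => /andP[/eqP s0 /eqP t0].
  by rewrite -sE -tE /x /y s0 t0 !mulr0 addr0 eqxx.
have [theta [c [th c0 se te]]] := half_turn_polar st0.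
exists theta => //; rewrite -[RHS](boundary_restrictionZ _ _ c0) -sE -tE se te.
by congr boundary_restriction; rewrite /x /y; ring.
Unshelve. all: by end_near. Qed.

End maximal_operator.

(** * The two propagators *)

Section propagators.
Context {R : realType}.
Implicit Types (p q kap gam r s : R).

(** With [X = r^gam] and [Y = s^gam], the coefficients of [(r / s)^M] are
    [(X/Y + Y/X) / 2] and [(X/Y - Y/X) / (2 gam)], where [Y/X <= X/Y]. *)
Lemma propagator_power p q kap gam : 0 < gam < 2^-1 -> kap ^+ 2 - p * q = gam ^+ 2 ->
  propagator p q kap (gam ^+ 2) gam (1 + (2 * gam)^-1)
    (fun r => (r `^ gam + r `^ (- gam)) / 2)
    (fun r => (r `^ gam - r `^ (- gam)) / (2 * gam)).
Proof.
move=> /andP[g0 g1] dE; have g0' : gam != 0 by rewrite gt_eqF.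
have pw r : 0 < r -> 0 < r `^ gam by exact: powR_gt0.
have d1 r : 0 < r -> is_derive r 1 (fun r : R => r `^ gam) (gam * r `^ gam / r).
  move=> r0; apply: (is_derive_eq (is_derive1_powR gam r0)).
  by rewrite powRD ?(gt_eqF r0) ?implybT// powRN powRr1 ?(ltW r0)// mulrA.
have d2 r : 0 < r -> is_derive r 1 (fun r : R => r `^ (- gam)) (- gam * r `^ (- gam) / r).
  move=> r0; apply: (is_derive_eq (is_derive1_powR (- gam) r0)).
  by rewrite powRD ?(gt_eqF r0) ?implybT// (powRN r 1) powRr1 ?(ltW r0)// mulrA.
have mono r s : 0 < s -> s <= r -> (r `^ gam)^-1 * s `^ gam <= r `^ gam * (s `^ gam)^-1.
  move=> s0 sr; have r0 := lt_le_trans s0 sr.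
  have le : s `^ gam <= r `^ gam by apply: ge0_ler_powR; rewrite ?nnegrE ?(ltW s0) ?(ltW r0) ?(ltW g0).
  apply: (@le_trans _ _ 1).
    by rewrite mulrC ler_pdivrMr ?mul1r ?pw.
  by rewrite ler_pdivlMr ?mul1r ?pw.
split => //.
- by rewrite (ltW g0).
- move=> r r0; have h1 := d1 r r0; have h2 := d2 r r0.
  rewrite (_ : (fun r => _) = (fun r : R => 2^-1 * (r `^ gam + r `^ (- gam)))); last first.
    by apply/funext => t; rewrite mulrC.
  apply: is_derive_eq; rewrite /GRing.scale /=.
  by field; rewrite g0' gt_eqF.
- move=> r r0; have h1 := d1 r r0; have h2 := d2 r r0.
  rewrite (_ : (fun r => _) = (fun r : R => (2 * gam)^-1 * (r `^ gam - r `^ (- gam)))); last first.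
    by apply/funext => t; rewrite mulrC.
  apply: is_derive_eq; rewrite /GRing.scale /=.
  by field; rewrite g0' gt_eqF.
- move=> r r0; have r1 := pw r r0; rewrite powRN; field.
  by rewrite g0' (gt_eqF r1).
- by rewrite !powR1; lra.
- by rewrite !powR1 subrr mul0r.
- move=> r s s0 sr; have r0 := lt_le_trans s0 sr.
  have [r1 s1] := (pw r r0, pw s s0); have m := mono r s s0 sr; rewrite !powRN.
  set X := r `^ gam in r1 m *; set Y := s `^ gam in s1 m *.
  have t0 : 0 <= X^-1 * Y by rewrite mulr_ge0 ?invr_ge0 ?ltW.
  have c0 : 0 <= (2 * gam)^-1 * (X * Y^-1) by rewrite mulr_ge0 ?mulr_ge0 ?invr_ge0 ?mulr_ge0 ?ltW.
  rewrite (_ : _ - _ = (X * Y^-1 + X^-1 * Y) / 2); last first.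
    by field; rewrite g0' (gt_eqF r1) (gt_eqF s1).
  have m0 := le_trans t0 m.
  rewrite [leRHS]mulrDl mul1r ger0_norm ?divr_ge0 ?addr_ge0//.
  move: (X / Y) (X^-1 * Y) m c0 t0 m0 => u v; set w := _ * u => *; lra.
- move=> r s s0 sr; have r0 := lt_le_trans s0 sr.
  have [r1 s1] := (pw r r0, pw s s0); have m := mono r s s0 sr; rewrite !powRN.
  set X := r `^ gam in r1 m *; set Y := s `^ gam in s1 m *.
  have t0 : 0 <= X^-1 * Y by rewrite mulr_ge0 ?invr_ge0 ?ltW.
  have i0 : 0 <= (2 * gam)^-1 by rewrite invr_ge0 mulr_ge0 ?ltW.
  rewrite (_ : _ - _ = (2 * gam)^-1 * (X * Y^-1 - X^-1 * Y)); last first.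
    by field; rewrite g0' (gt_eqF r1) (gt_eqF s1).
  rewrite ger0_norm ?mulr_ge0 ?subr_ge0// [leRHS]mulrDl mul1r.
  have := mulr_ge0 i0 t0; have m0 := le_trans t0 m.
  rewrite mulrBr; move: (X / Y) (X^-1 * Y) m0 => u v; set w := _ * u; set z := _ * v => *; lra.
Qed.

(** A logarithm is smaller than any power: [ln z = 4 ln (z^(1/4)) < 4 z^(1/4)].
    The exponent [1/4] is one choice strictly between [0] and [1/2]. *)
Lemma propagator_log p q kap : kap ^+ 2 - p * q = 0 ->
  propagator p q kap 0 4^-1 4 (fun=> 1) (@ln R).
Proof.
move=> dE; split => //.
- by apply/andP; split; lra.
- by move=> r r0; rewrite !mul0r; exact: is_derive_cst.
- by move=> r r0; rewrite mul1r; exact: is_derive1_ln.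
- by move=> r r0; rewrite mul0r subr0 expr1n.
- exact: ln1.
- move=> r s s0 sr; have r0 := lt_le_trans s0 sr.
  have s1 : 0 < s `^ 4^-1 by exact: powR_gt0.
  rewrite mul0r subr0 mul1r normr1 powRN.
  have : 1 <= r `^ 4^-1 / s `^ 4^-1.
    rewrite ler_pdivlMr// mul1r; by apply: ge0_ler_powR; rewrite ?nnegrE ?invr_ge0 ?(ltW s0) ?(ltW r0).
  by move: (_ / _) => u; lra.
- move=> r s s0 sr; have r0 := lt_le_trans s0 sr.
  have s1 : 0 < s `^ 4^-1 by exact: powR_gt0.
  have r1 : 0 < r `^ 4^-1 by exact: powR_gt0.
  rewrite mulr1 mul1r ger0_norm ?subr_ge0 ?ler_ln// powRN.
  rewrite (_ : ln r - ln s = 4 * ln (r `^ 4^-1 / s `^ 4^-1)).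
    by rewrite ler_pM2l// ltW// ln_sublinear// divr_gt0.
  by rewrite ln_div// ln_powR ln_powR; lra.
Qed.

End propagators.

(** * The boundary matrices *)

Section boundary_matrices.
Context {R : realType}.
Variables (nu mu lam : R) (k : int).
Local Notation kap := (k%:~R + lam).
Local Notation p := (nu + mu).
Local Notation q := (nu - mu).
Implicit Types (gam : R).

Lemma mx2E (T : Type) (x y z t : T) :
  ((mx2 x y z t 0 0 = x) * (mx2 x y z t 0 1 = y)) *
  ((mx2 x y z t 1 0 = z) * (mx2 x y z t 1 1 = t)).
Proof. by rewrite !mxE. Qed.

Lemma mx2_ext (S T : 'M[R]_2) :
  S 0 0 = T 0 0 -> S 0 1 = T 0 1 -> S 1 0 = T 1 0 -> S 1 1 = T 1 1 -> S = T.
Proof.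
move=> e00 e01 e10 e11; apply/matrixP; apply: ord2P; apply: ord2P => //.
Qed.

Lemma scalemxE (c : R) (S : 'M[R]_2) i j : (c *: S) i j = c * S i j.
Proof. by rewrite mxE. Qed.

(** The columns of [D] are eigenvectors of [M] for the eigenvalues [gam] and
    [- gam]. The formula for [D] changes where its columns would degenerate: up
    to a non-zero square the determinant is [2 gam (kap - gam)] in general, and
    [- 4] when [kap = gam], in which case [p q = 0]. *)
Lemma Dmx_eigen gam : gam != 0 -> gam ^+ 2 = kap ^+ 2 + mu ^+ 2 - nu ^+ 2 ->
  let D := Dmx nu mu lam k gam in
  [/\ - kap * D 0 0 - q * D 1 0 = gam * D 0 0,
      p * D 0 0 + kap * D 1 0 = gam * D 1 0,
      - kap * D 0 1 - q * D 1 1 = - gam * D 0 1 &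
      p * D 0 1 + kap * D 1 1 = - gam * D 1 1] /\ D 0 0 * D 1 1 - D 0 1 * D 1 0 != 0.
Proof.
move=> g0 dE; rewrite /= /Dmx (addrC lam).
have [c0|c0] := eqVneq (kap - gam) 0; rewrite /= !scalemxE !mx2E.
  set s := (- 4 * _)^-1.
  have s0 : s != 0 by rewrite invr_eq0 mulf_neq0 ?sqrf_eq0// oppr_eq0 pnatr_eq0.
  have gE : kap = gam by apply/eqP; rewrite -subr_eq0 c0.
  have pq : nu ^+ 2 = mu ^+ 2 by move: dE; rewrite gE; lra.
  split; first by split; rewrite gE; ring: pq.
  rewrite (_ : _ - _ = - 4 * (s * gam) ^+ 2); last by ring: pq.
  by rewrite mulf_neq0 ?sqrf_eq0 ?mulf_neq0// oppr_eq0 pnatr_eq0.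
set s := (2 * _ * _)^-1.
have s0 : s != 0 by rewrite invr_eq0 !mulf_neq0// pnatr_eq0.
have pq : nu ^+ 2 = kap ^+ 2 + mu ^+ 2 - gam ^+ 2 by rewrite dE; ring.
split; first by split; ring: pq.
rewrite (_ : _ - _ = s ^+ 2 * (2 * gam * (kap - gam))); last by ring: pq.
by rewrite !mulf_neq0 ?sqrf_eq0// pnatr_eq0.
Qed.

Lemma Dmx_unit gam : gam != 0 -> gam ^+ 2 = kap ^+ 2 + mu ^+ 2 - nu ^+ 2 ->
  Dmx nu mu lam k gam \in unitmx.
Proof. by move=> g0 dE; rewrite unitmxE unitfE det_mx2; exact: (Dmx_eigen g0 dE).2. Qed.

(** [r^M D = D diag (x, x^-1)] with [x = r^gam], since the columns of [D] are
    eigenvectors of [M]. *)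
Lemma Dmx_flow (a b : R -> R) (r x gam : R) (Ap Am : R[i]) : gam != 0 ->
  gam ^+ 2 = kap ^+ 2 + mu ^+ 2 - nu ^+ 2 ->
  a r + gam * b r = x -> a r - gam * b r = x^-1 ->
  toC (Dmx nu mu lam k gam) *m cv2 (Ap * x%:C) (Am * (x^-1)%:C) =
  toC (flow_mx nu mu lam k a b r) *m (toC (Dmx nu mu lam k gam) *m cv2 Ap Am).
Proof.
move=> g0 dE xE yE; have [[e1 e2 e3 e4] _] := Dmx_eigen g0 dE.
set D := Dmx _ _ _ _ _ in e1 e2 e3 e4 *.
have col i : (D i 0)%:C * (Ap * x%:C) + (D i 1)%:C * (Am * (x^-1)%:C) =
    (D i 0 * x)%:C * Ap + (D i 1 * x^-1)%:C * Am by rewrite !rmorphM; ring.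
rewrite [LHS]mulmx_cv2 (mulmx_cv2 D) mulmx_cv2 !flow_mxE !col.
have [f1 f2] : D 0 0 * x = (b r * - kap + a r) * D 0 0 + b r * - q * D 1 0 /\
     D 1 0 * x = b r * p * D 0 0 + (b r * kap + a r) * D 1 0.
  rewrite -xE; split.
    rewrite [LHS](_ : _ = a r * D 0 0 + b r * (gam * D 0 0)); last by ring.
    by rewrite -e1; ring.
  rewrite [LHS](_ : _ = a r * D 1 0 + b r * (gam * D 1 0)); last by ring.
  by rewrite -e2; ring.
have [f3 f4] : D 0 1 * x^-1 = (b r * - kap + a r) * D 0 1 + b r * - q * D 1 1 /\
     D 1 1 * x^-1 = b r * p * D 0 1 + (b r * kap + a r) * D 1 1.
  rewrite -yE; split.
    rewrite [LHS](_ : _ = a r * D 0 1 + b r * (- gam * D 0 1)); last by ring.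
    by rewrite -e3; ring.
  rewrite [LHS](_ : _ = a r * D 1 1 + b r * (- gam * D 1 1)); last by ring.
  by rewrite -e4; ring.
by rewrite f1 f2 f3 f4; congr cv2; rewrite !(rmorphD, rmorphM) /=; ring.
Qed.

Lemma Mmx_sqr0 : kap ^+ 2 + mu ^+ 2 - nu ^+ 2 = 0 ->
  Mmx nu mu lam k *m Mmx nu mu lam k = 0.
Proof.
move=> dE; have pq : nu ^+ 2 = kap ^+ 2 + mu ^+ 2 by lra.
have E0 i j : (0 : 'M[R]_2) i j = 0 by rewrite mxE.
by apply: mx2_ext; rewrite E0 mxE sum_I2 !mx2E; ring: pq.
Qed.

End boundary_matrices.

(** * Self-adjoint realisations of the radial Dirac operator *)

Theorem theorem1p2 (R : realType) (m nu mu lam : R) (k : int) (delta gam : R)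
    (hk : k != 0)
    (hdelta : delta = (k%:~R + lam) ^+ 2 + mu ^+ 2 - nu ^+ 2)
    (hdelta0 : 0 <= delta) (hdelta1 : delta < 4^-1)
    (hgam : gam = Num.sqrt delta) :
  (0 < gam < 2^-1 ->
    Dmx nu mu lam k gam \in unitmx /\
    exists t : R -> graph R,
      (forall theta : R, 0 <= theta < pi ->
        dirac_min m nu mu lam k `<=` t theta /\
        self_adjoint (t theta) /\
        t theta `<=` dirac_max m nu mu lam k /\
        (forall f : wave R,
          domain (t theta) f <->
          domain (dirac_max m nu mu lam k) f /\
          exists fc : wave R, continuous_representative f fc /\
          exists Ap Am : R[i],
            Ap * (sin theta)%:C + Am * (cos theta)%:C = 0 /\
            (norm2 (fc r - toC (Dmx nu mu lam k gam)
                             *m cv2 (Ap * (r `^ gam)%:C)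
                                    (Am * (r `^ (- gam))%:C))
               * r `^ (- 2^-1)) @[r --> 0^'+] --> (0 : R))) /\
      (forall T : graph R, self_adjoint T -> dirac_min m nu mu lam k `<=` T ->
        exists2 theta : R, 0 <= theta < pi & T = t theta)) /\
  (gam = 0 ->
    Mmx nu mu lam k *m Mmx nu mu lam k = 0 /\
    exists t : R -> graph R,
      (forall theta : R, 0 <= theta < pi ->
        dirac_min m nu mu lam k `<=` t theta /\
        self_adjoint (t theta) /\
        t theta `<=` dirac_max m nu mu lam k /\
        (forall f : wave R,
          domain (t theta) f <->
          domain (dirac_max m nu mu lam k) f /\
          exists fc : wave R, continuous_representative f fc /\
          exists Ap Am : R[i],
            Ap * (sin theta)%:C + Am * (cos theta)%:C = 0 /\
            (norm2 (fc r - toC (ln r *: Mmx nu mu lam k + 1%:M) *m cv2 Ap Am)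
               * r `^ (- 2^-1)) @[r --> 0^'+] --> (0 : R))) /\
      (forall T : graph R, self_adjoint T -> dirac_min m nu mu lam k `<=` T ->
        exists2 theta : R, 0 <= theta < pi & T = t theta)).
Proof.
have g2 : gam ^+ 2 = (k%:~R + lam) ^+ 2 + mu ^+ 2 - nu ^+ 2 by rewrite hgam sqr_sqrtr.
split=> [gbound|g0].
  have g0 : gam != 0 by case/andP: gbound => h _; rewrite gt_eqF.
  split; first exact: Dmx_unit.
  have dE : (k%:~R + lam) ^+ 2 - (nu + mu) * (nu - mu) = gam ^+ 2 by rewrite g2; ring.
  have prop := propagator_power gbound dE.
  apply: (self_adjoint_extensions m prop (Dmx_unit g0 g2)) => Ap Am r r0.
  have X0 : r `^ gam != 0 by rewrite gt_eqF ?powR_gt0.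
  by rewrite powRN; apply: Dmx_flow => //=; rewrite powRN; field; rewrite ?g0 ?X0.
have d0 : (k%:~R + lam) ^+ 2 + mu ^+ 2 - nu ^+ 2 = 0 by rewrite -g2 g0 expr0n.
split; first exact: Mmx_sqr0.
have prop : propagator (nu + mu) (nu - mu) (k%:~R + lam) 0 4^-1 4 (fun=> 1) (@ln R).
  by apply: propagator_log; rewrite -[RHS]d0; ring.
apply: (self_adjoint_extensions m prop (unitmx1 _ _)) => Ap Am r r0.
by rewrite /flow_mx [toC 1%:M]map_mx1 mul1mx.
Qed.
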